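(* Suppose the Markov chain $\Xi$ on $\mathbb X\subseteq\mathbb R$ satisfies (N$'$), $(\mathrm T^{\mathrm{bal}}_{\alpha,c})$ and $(\mathrm D'_{\gamma,b})$. Then: (i) if $\gamma>\alpha-1$, $\Xi$ is null recurrent; (ii) if $\gamma<\alpha-1$ and $b<0$, $\Xi$ is positive recurrent; (iii) if $\gamma<\alpha-1$ and $b>0$, $\Xi$ is directional transient; (iv) if $\gamma=\alpha-1$ and $b+c\pi\cot(\frac{\pi\alpha}2)<0$, $\Xi$ is null recurrent. If in addition the four limits in $(\mathrm T^{\mathrm{bal}}_{\alpha,c})$ are strengthened to: each of the four suprema is $O(y^{-\delta})$ as $y\to\infty$ for some $\delta>0$, then (v) if $\gamma=\alpha-1$ and $b+c\pi\cot(\frac{\pi\alpha}2)>0$, $\Xi$ is oscillatory transient.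
   Context: $\Xi=(\xi_n)_{n\ge0}$ is a time-homogeneous Markov chain on an infinite, unbounded, measurable $\mathbb X\subseteq\mathbb R$. $\mathbb P_x,\mathbb E_x$ refer to the chain started at $x$; $\theta:=\xi_1-\xi_0$; $y_+:=y\mathbf 1\{y\ge0\}$, $y_-:=-y\mathbf 1\{y<0\}$; $\mu(x):=\mathbb E_x[\theta]$; $\tau_a:=\min\{n\ge0:|\xi_n|\le a\}$. $\Xi$ is recurrent if $\liminf_n|\xi_n|\le r_0$ a.s. for some deterministic $r_0$; positive recurrent if $\mathbb E_x[\tau_a]<\infty$ for all large $a$ and all $x$; null recurrent if recurrent and $\mathbb E_x[\tau_a]=\infty$ for all large $a$ and $|x|>a$; directional transient if $\lim_n\xi_n\in\{-\infty,+\infty\}$ a.s.; oscillatory transient if a.s. $|\xi_n|\to\infty$, $\liminf_n\xi_n=-\infty$ and $\limsup_n\xi_n=+\infty$. (N$'$): $\limsup_n|\xi_n|=+\infty$ a.s. $(\mathrm T^{\mathrm{bal}}_{\alpha,c})$: there exist $\alpha\in(1,2)$, $c>0$, $x_0\in\mathbb R_+$ such that, as $y\to\infty$, each of $\sup_{x\ge x_0}|y^\alpha\mathbb P_x[\theta_+>y]-c|$, $\sup_{x\ge x_0}|y^\alpha\mathbb P_x[\theta_->y]-c|$, $\sup_{x\le-x_0}|y^\alpha\mathbb P_x[\theta_+>y]-c|$, $\sup_{x\le-x_0}|y^\alpha\mathbb P_x[\theta_->y]-c|$ tends to $0$. $(\mathrm D'_{\gamma,b})$: there exist $\gamma\ge0$,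 $b\in\mathbb R$ with $\lim_{x\to+\infty}x^\gamma\mu(x)=\lim_{x\to-\infty}(-|x|^\gamma\mu(x))=b$. *)

(* Defs.v *)
From mathcomp Require Import all_boot all_order all_algebra.
From mathcomp Require Import all_classical all_reals all_analysis.
Set Implicit Arguments. Unset Strict Implicit. Unset Printing Implicit Defensive.
Import Order.TTheory GRing.Theory Num.Theory numFieldNormedType.Exports.
Local Open Scope classical_set_scope.
Local Open Scope ring_scope.

Definition posp {R : realType} (y : R) : R := if 0 <= y then y else 0.
Definition negp {R : realType} (y : R) : R := if y < 0 then - y else 0.

(** Finite-dimensional distributions of the time-homogeneous Markov chain with
    transition kernel [k] started at [x]:
    fdd k [:: A0; A1; ...; An] x = P_x[xi_0 \in A0, ..., xi_n \in An]
    = 1_{A0}(x) \int k(x,dy) 1_{A1}(y) \int k(y,dz) ... *)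
Fixpoint fdd {R : realType} (k : R.-pker R ~> R) (As : seq (set R)) (x : R)
  : \bar R :=
  match As with
  | [::] => 1%E
  | A :: As' => ((\1_A x)%:E * \int[k x]_y fdd k As' y)%E
  end.

Definition markov_chain {R : realType} (X : set R) (k : R.-pker R ~> R)
  {d : measure_display} {T : measurableType d}
  (P : R -> probability T R) (xi : nat -> T -> R) : Prop :=
  [/\ measurable X,
      (forall x, X x -> k x X = 1%E),
      (forall n, measurable_fun setT (xi n)) &
      (forall x, X x -> forall As : seq (set R),
         (forall i, (i < size As)%N -> measurable (nth set0 As i)) ->
         P x [set w | forall i, (i < size As)%N -> nth set0 As i (xi i w)]
         = fdd k As x)].

Section chain_notions.
Context {R : realType} {d : measure_display} {T : measurableType d}.
Variables (X : set R) (P : R -> probability T R) (xi : nat -> T -> R).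

Definition theta (w : T) : R := xi 1 w - xi 0 w.

Definition mu (x : R) : R := fine (\int[P x]_w (theta w)%:E)%E.

Definition tau (a : R) (w : T) : \bar R :=
  match pselect (exists n, `|xi n w| <= a) with
  | left h => (ex_minn h)%:R%:E
  | right _ => +oo%E
  end.

Definition recurrent : Prop :=
  exists r0 : R, forall x, X x ->
    {ae P x, forall w, forall eps : R, 0 < eps -> forall N : nat,
        exists2 n : nat, (N <= n)%N & `|xi n w| <= r0 + eps}.

Definition positive_recurrent : Prop :=
  exists a0 : R, forall a, a0 <= a -> forall x, X x ->
    (\int[P x]_w tau a w < +oo)%E.

Definition null_recurrent : Prop :=
  recurrent /\
  exists a0 : R, forall a, a0 <= a -> forall x, X x -> a < `|x| ->
    (\int[P x]_w tau a w = +oo)%E.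

Definition directional_transient : Prop :=
  forall x, X x ->
    {ae P x, forall w,
      (forall M : R, exists N : nat, forall n, (N <= n)%N -> M < xi n w) \/
      (forall M : R, exists N : nat, forall n, (N <= n)%N -> xi n w < M)}.

Definition oscillatory_transient : Prop :=
  forall x, X x ->
    {ae P x, forall w,
      [/\ (forall M : R, exists N : nat, forall n, (N <= n)%N -> M < `|xi n w|),
          (forall M : R, forall N : nat, exists2 n, (N <= n)%N & xi n w < M) &
          (forall M : R, forall N : nat, exists2 n, (N <= n)%N & M < xi n w)]}.

Definition cond_N' : Prop :=
  forall x, X x ->
    {ae P x, forall w, forall M : R, forall N : nat,
        exists2 n, (N <= n)%N & M < `|xi n w|}.

Definition tail_plus (alpha y x : R) : R :=
  y `^ alpha * fine (P x [set w | y < posp (theta w)]).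
Definition tail_minus (alpha y x : R) : R :=
  y `^ alpha * fine (P x [set w | y < negp (theta w)]).

(** (T^bal_{alpha,c}) : with alpha in (1,2), c > 0, the four suprema
    sup_{x >= x0} |y^a P_x[theta_+- > y] - c|, sup_{x <= -x0} |...| tend to 0. *)
Definition cond_Tbal (alpha c : R) : Prop :=
  [/\ 1 < alpha, alpha < 2, 0 < c &
  exists x0 : R, 0 <= x0 /\
    forall eps : R, 0 < eps -> exists Y : R, forall y, Y <= y ->
      forall x, X x -> (x0 <= x \/ x <= - x0) ->
        `|tail_plus alpha y x - c| <= eps /\ `|tail_minus alpha y x - c| <= eps].

Definition cond_Tbal_strong (alpha c : R) : Prop :=
  [/\ 1 < alpha, alpha < 2, 0 < c &
  exists x0 : R, 0 <= x0 /\
  exists delta : R, 0 < delta /\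
  exists C : R, exists Y : R, forall y, Y <= y ->
      forall x, X x -> (x0 <= x \/ x <= - x0) ->
        `|tail_plus alpha y x - c| <= C * y `^ (- delta) /\
        `|tail_minus alpha y x - c| <= C * y `^ (- delta)].

Definition cond_D' (gamma b : R) : Prop :=
  0 <= gamma /\
  forall eps : R, 0 < eps -> exists M : R, forall x, X x ->
    (M <= x -> `|x `^ gamma * mu x - b| <= eps) /\
    (x <= - M -> `|- (`|x| `^ gamma * mu x) - b| <= eps).

End chain_notions.

(* Main.v *)
(** At [x = sg * r], [r = |x|], the drift of a test function of [|x|] is computed
    for the normalised jump [u = sg * theta / r], whose two tails are at most
    [K r^-alpha s^-alpha], by the layer-cake formula
      [E F(1+u) - F(1) - F'(1) E u
         = \int_0^oo (F'(1+s) - F'(1)) P(u > s) ds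
           - \int_0^oo (F'(1-s) - F'(1)) P(-u > s) ds].
    For [F(v) = (r^-2 + v^2)^(p/2)] and balanced tails [c r^-alpha s^-alpha], the
    right-hand side is [p c r^-alpha] times an integral tending, as [p] and [1/r]
    go to [0], to the principal value of [\int_0^oo (1/(1+s) - 1/(1-s)) s^-alpha ds],
    which is [pi cot(pi alpha/2)]: this is the sum of the partial fraction
    expansion of the cotangent.  The drift of [(1+x^2)^(p/2)] is thus
    [p |x|^(p-alpha) (b + c pi cot(pi alpha/2) + o(1))] when [gamma = alpha - 1]
    (and the same with [b = 0] when [gamma > alpha - 1]), and the sign of the
    bracket yields a supermartingale with a small [p > 0] (recurrence), or with a
    small [p < 0] (transience).
    When [gamma < alpha - 1] the mean drift dominates all tail contributions:
    [p = 1 + gamma] gives a Lyapunov function of uniformly negative drift if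
    [b < 0]; if [b > 0], functions constant on one half-line and decreasing with
    the distance to it are supermartingales on the other side, for small [p < 0].
    Oscillation: for a one-sided function with small [p > 0] the effect of jumps
    to the opposite half-line is of order [r^-alpha] whereas all other
    contributions are of order [p r^-alpha], so that no half-line can be
    occupied forever.  Null recurrence: the chain makes a jump of size
    [n^(1/alpha)] with probability of order [1/n], and then, by the drift of
    [1/(1+(x/h)^2)], needs [n] steps to come back, so that [P(tau > n) >= c/n]. *)
Require Import Defs.
From mathcomp Require Import all_boot all_order all_algebra.
From mathcomp Require Import all_classical all_reals all_analysis.
From mathcomp Require Import measurable_realfun ring lra.
Import Order.TTheory GRing.Theory Num.Theory numFieldNormedType.Exports.
Set Implicit Arguments. Unset Strict Implicit. Unset Printing Implicit Defensive.
Local Open Scope classical_set_scope.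
Local Open Scope ring_scope.

(** * Partial fractions of the cotangent *)

Section cotangent_series.
Context {R : realType}.
Implicit Types (a b x : R).

(** The chain is given by its finite-dimensional distributions alone, so no filtration, stopping
    time or martingale theorem appears: each probabilistic step is an induction on n about
    [stay A n x] or an iterate of [kop], in which a drift inequality valid on X is integrated once
    more against the kernel. Condition (N') enters through one fact: a bounded set is left. The
    analytic obstacle is a jump that lands near the origin, s close to 1. There the derivative of
    the test function tends, up to the factor p, to 1/v, which is not integrable. The singular part
    is therefore integrated exactly, as a difference of values of [phi], and the deviation of the
    tails from c s^-al is weighed against the total variation of [phi] near 0. This variation is
    bounded for p > 0, but of order r^-p for p < 0. The smoothing r^-2 + v^2 in place of v^2 keeps
    the test function differentiable at 0, so that the fundamental theorem of calculus applies along
    every jump, whatever it crosses. Constants must not depend on h = 1/r: hence the separate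
    treatment of s < 1/2, where 1 - s stays away from 0. *)

Lemma MVT_lipschitz (f df : R -> R) (c d L : R) :
  (forall x, c < x < d -> is_derive x 1 f (df x)) ->
  (forall x, c < x < d -> `|df x| <= L) ->
  forall a b, c < a < d -> c < b < d -> `|f a - f b| <= L * `|a - b|.
Proof.
move=> dI bI a b; wlog ab : a b / a <= b.
  move=> H aI bI'; have [/H|/ltW/H] := leP a b; first exact.
  by rewrite distrC (distrC a); apply.
move=> /andP[ca ad] /andP[cb bd].
have sub x : x \in `[a, b] -> c < x < d.
  by rewrite in_itv/= => /andP[ax xb]; rewrite (lt_le_trans ca ax) (le_lt_trans xb bd).
have [||z zab] := @MVT_segment R f df a b ab.
- by move=> x xab; apply: dI; apply: sub; exact: subset_itv_oo_cc.
- apply: derivable_within_continuous => x xab.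
  by have [] := dI x (sub x xab).
move=> e; rewrite distrC e (distrC a) normrM ler_wpM2r//.
by apply: bI; exact: sub.
Qed.

Lemma sin_le_id x : 0 <= x -> sin x <= x.
Proof.
rewrite le_eqVlt => /predU1P[<-|x0]; first by rewrite sin0.
have h (y : R) : is_derive y 1 (fun y => y - sin y) (1 - cos y).
  by apply: is_derive_eq.
have [|c _] := @MVT R (fun y => y - sin y) (fun y => 1 - cos y) 0 x x0 (fun y _ => h y).
  by apply: derivable_within_continuous => y _; apply: ex_derive.
rewrite sin0 !subr0 => e; rewrite -subr_ge0 e mulr_ge0 ?(ltW x0)// subr_ge0 cos_le1//.
Qed.

Lemma xcos_le_sin x : 0 <= x <= pi -> x * cos x <= sin x.
Proof.
move=> /andP[]; rewrite le_eqVlt => /predU1P[<-|x0 xpi]; first by rewrite sin0 mul0r.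
have h (y : R) : is_derive y 1 (fun y => sin y - y * cos y) (y * sin y).
  by apply: is_derive_eq; rewrite /GRing.scale/=; ring.
have [|c] := @MVT R (fun y => sin y - y * cos y) (fun y => y * sin y) 0 x x0 (fun y _ => h y).
  by apply: derivable_within_continuous => y _; apply: ex_derive.
rewrite in_itv/= => /andP[c0 cx].
rewrite sin0 mul0r !subr0 => e; rewrite -subr_ge0 e mulr_ge0 ?(ltW x0)// mulr_ge0 ?(ltW c0)//.
by apply: sin_ge0_pi; rewrite (ltW c0)/= (le_trans (ltW cx)).
Qed.

(** From 1/sin^2 = cot^2 + 1 and x cos x <= sin x. It serves to cancel a double pole at 0 up to a
    bounded error. *)
Lemma sinV2_bounds x : 0 < x <= pi / 2 ->
  x ^- 2 <= (sin x) ^- 2 <= x ^- 2 + 1.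
Proof.
move=> /andP[x0 xp].
have p2 : pi / 2 < pi :> R by have := @pi_gt0 R; lra.
have s0 : 0 < sin x by apply: sin_gt0_pi; rewrite x0 (le_lt_trans xp).
have c0 : 0 <= cos x by apply: cos_ge0_pihalf; rewrite xp andbT; have := @pi_gt0 R; lra.
apply/andP; split.
  by rewrite lef_pV2 ?posrE ?exprn_gt0// lerXn2r ?nnegrE ?(ltW s0) ?(ltW x0)// sin_le_id// ltW.
have h : cos x / sin x <= x^-1.
  rewrite ler_pdivrMr// -ler_pdivrMl ?invr_gt0// invrK xcos_le_sin//.
  by rewrite (ltW x0) (le_trans xp (ltW p2)).
have -> : (sin x) ^- 2 = (cos x / sin x) ^+ 2 + 1.
  have := cos2Dsin2 x => e; rewrite expr_div_n -[X in _ + X](@divff _ (sin x ^+ 2)) ?expf_neq0 ?gt_eqF//.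
  by rewrite -mulrDl e mul1r.
by rewrite lerD2r -exprVn lerXn2r ?nnegrE ?divr_ge0 ?invr_ge0 ?(ltW s0) ?(ltW x0).
Qed.

(** The simple poles of pi cot(pi a) at -n and n + 1, paired so that the series converges absolutely
    for 0 < a < 1. *)
Definition cot_term a (n : nat) : R := (n%:R + a)^-1 - (n.+1%:R - a)^-1.
Definition cot_sum a (N : nat) : R := \sum_(0 <= n < N) cot_term a n.

(** Term n at a/2 plus term n at (a + 1)/2 is twice the sum of terms 2n and 2n + 1 at a, with their
    subtracted reciprocals exchanged. *)
Lemma cot_sum_half a N : 0 < a < 1 ->
  cot_sum (a / 2) N + cot_sum ((a + 1) / 2) N = 2 * cot_sum a N.*2.
Proof.
move=> /andP[a0 a1]; elim: N => [|N IH].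
  by rewrite /cot_sum !big_geq// addr0 mulr0.
rewrite doubleS /cot_sum !big_nat_recr//= -!/(cot_sum _ _) addrACA IH.
rewrite 2!mulrDr -!addrA; congr (_ + _); rewrite /cot_term.
have N0 : 0 <= N%:R :> R by [].
have -> : N.*2%:R = 2 * N%:R :> R by rewrite -muln2 natrM mulrC.
have -> : N.*2.+1%:R = 2 * N%:R + 1 :> R by rewrite -natr1 -muln2 natrM mulrC.
have -> : N.*2.+2%:R = 2 * N%:R + 2 :> R by rewrite -!natr1 -muln2 natrM; ring.
have -> : N.+1%:R = N%:R + 1 :> R by rewrite -natr1.
move: (N%:R) N0 => x x0.
by field; do ?[apply/andP; split]; rewrite gt_eqF//; lra.
Qed.

Definition cotpi a : R := pi * (cos (pi * a) / sin (pi * a)).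

Lemma sin_pi_gt0 a : 0 < a < 1 -> 0 < sin (pi * a).
Proof.
move=> /andP[a0 a1]; apply: sin_gt0_pi; rewrite mulr_gt0 ?pi_gt0//=.
by rewrite gtr_pMr ?pi_gt0.
Qed.

Lemma cotpi_half a : 0 < a < 1 -> cotpi (a / 2) + cotpi ((a + 1) / 2) = 2 * cotpi a.
Proof.
move=> /andP[a0 a1]; rewrite /cotpi.
have -> : pi * ((a + 1) / 2) = pi * (a / 2) + pi / 2 :> R by ring.
have -> : pi * a = (pi * (a / 2)) *+ 2 :> R by rewrite -mulr_natr; field.
set x := pi * (a / 2).
have s0 : 0 < sin x by apply: sin_pi_gt0; apply/andP; split; lra.
have x2 : x < pi / 2 by rewrite /x; have := @pi_gt0 R; nra.
have x0 : 0 < x by rewrite /x mulr_gt0 ?pi_gt0//; lra.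
have c0 : 0 < cos x by apply: cos_gt0_pihalf; rewrite x2 andbT; have := @pi_gt0 R; lra.
rewrite cosDpihalf sinDpihalf sin_mulr2n cos_mulr2n.
have -> : cos x ^+ 2 *+ 2 - 1 = cos x ^+ 2 - sin x ^+ 2 by rewrite -(cos2Dsin2 x); ring.
by field; rewrite !gt_eqF.
Qed.

Lemma cot_sum_sub_half a N : 0 < a < 1 ->
  2 * (cot_sum a N.*2 - cotpi a) = (cot_sum (a / 2) N - cotpi (a / 2)) +
    (cot_sum ((a + 1) / 2) N - cotpi ((a + 1) / 2)).
Proof.
move=> a01; rewrite mulrBr -cot_sum_half// -cotpi_half//; ring.
Qed.

(** One term of the series already carries both poles of [cotpi] on [0, 1], so the difference can be
    Lipschitz up to the end points. *)
Lemma cotpi_derive a : 0 < a < 1 ->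
  is_derive a 1 (fun a => cot_sum a 1 - cotpi a)
    (- a ^- 2 - (1 - a) ^- 2 + pi ^+ 2 * (sin (pi * a)) ^- 2).
Proof.
move=> a01; have s0 := sin_pi_gt0 a01; move/andP: a01 => [a0 a1].
rewrite (_ : (fun a : R => _) = fun a : R => a^-1 - (1 - a)^-1 - pi * (cos (pi * a) / sin (pi * a))); last first.
  by apply/funext => y; rewrite /cot_sum big_nat1 /cot_term add0r.
have a0' : a != 0 by rewrite gt_eqF.
have a1' : 1 - a != 0 by rewrite subr_eq0 gt_eqF.
have s0' : sin (pi * a) != 0 by rewrite gt_eqF.
have d1 : is_derive a 1 (fun a : R => pi * a) pi.
  by apply: is_derive_eq; rewrite /GRing.scale/=; ring.
have ds := is_derive1_comp (is_derive_sin (pi * a)) d1.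
have dc := is_derive1_comp (is_derive_cos (pi * a)) d1.
have dsV := @is_deriveV _ (sin \o (fun a => pi * a)) a _ 1 s0' ds.
have d2 := @is_deriveV _ id a 1 1 a0' (is_derive_id _ _).
have d3 : is_derive a 1 (fun a : R => 1 - a) (-1).
  by apply: is_derive_eq; ring.
have d4 := @is_deriveV _ (fun a => 1 - a) a _ 1 a1' d3.
have d5 := is_deriveM dc dsV.
have d6 := is_deriveB (is_deriveB d2 d4) (is_deriveZ pi d5).
apply: (is_derive_eq d6).
rewrite /GRing.scale/=.
have e := cos2Dsin2 (pi * a).
rewrite -[X in _ + X / _](mulr1 (pi ^+ 2)) -[X in _ + _ * X / _]e.
by field; do ?[apply/andP; split].
Qed.

(** The expression is symmetric under a -> 1 - a, so a <= 1/2 may be assumed: there pi^2/sin^2 is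
    a^-2 up to pi^2 by [sinV2_bounds], and (1 - a)^-2 <= 4. *)
Lemma cotpi_derive_bound a : 0 < a < 1 ->
  `|- a ^- 2 - (1 - a) ^- 2 + pi ^+ 2 * (sin (pi * a)) ^- 2| <= pi ^+ 2 + 4.
Proof.
have p0 := @pi_gt0 R.
have half b : 0 < b <= 2^-1 ->
  `|- b ^- 2 - (1 - b) ^- 2 + pi ^+ 2 * (sin (pi * b)) ^- 2| <= pi ^+ 2 + 4.
  move=> /andP[b0 b1].
  have [|h1 h2] := andP (@sinV2_bounds (pi * b) _).
    by rewrite mulr_gt0//=; nra.
  have h3 : 0 <= (1 - b) ^- 2 by rewrite invr_ge0 exprn_ge0//; lra.
  have h4 : (1 - b) ^- 2 <= 4.
    rewrite -[leRHS]invrK lef_pV2 ?posrE ?invr_gt0//; last by apply: exprn_gt0; lra.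
    by rewrite expr2; nra.
  have p2 : 0 < pi ^+ 2 :> R by rewrite exprn_gt0.
  have e : pi ^+ 2 * (pi * b) ^- 2 = b ^- 2.
    by rewrite exprMn invfM mulrA divff ?mul1r// gt_eqF.
  have {}h1 : b ^- 2 <= pi ^+ 2 * (sin (pi * b)) ^- 2 by rewrite -e ler_pM2l.
  have {}h2 : pi ^+ 2 * (sin (pi * b)) ^- 2 <= b ^- 2 + pi ^+ 2.
    by rewrite -e -[X in _ + X]mulr1 -mulrDr ler_pM2l.
  have b2 : 0 <= b ^- 2 by rewrite invr_ge0 exprn_ge0// ltW.
  move: h1 h2 h3 h4 b2; move: (pi ^+ 2 * (sin (pi * b)) ^- 2) (b ^- 2) ((1 - b) ^- 2) => x y z *.
  by rewrite ler_norml; apply/andP; split; lra.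
move=> /andP[a0 a1]; have [ah|ah] := leP a 2^-1; first by apply: half; rewrite a0.
have := half (1 - a); rewrite subKr => /(_ _).
have -> : sin (pi * (1 - a)) = sin (pi * a).
  by rewrite mulrBr mulr1 sinB sinpi cospi mul0r sub0r mulN1r opprK.
by rewrite (addrC (- a ^- 2)) => -> //; apply/andP; split; lra.
Qed.

Lemma cot_sum_sub_lipschitz k a b : 0 < a < 1 -> 0 < b < 1 ->
  `|(cot_sum a (2 ^ k) - cotpi a) - (cot_sum b (2 ^ k) - cotpi b)| <=
    (pi ^+ 2 + 4) / 2 ^+ k * `|a - b|.
Proof.
elim: k a b => [|k IH] a b a01 b01.
  rewrite expn0 expr0 divr1.
  exact: (@MVT_lipschitz _ _ 0 1 _ (@cotpi_derive) (@cotpi_derive_bound)).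
have H x : 0 < x < 1 -> (0 < x / 2 < 1) /\ (0 < (x + 1) / 2 < 1).
  by move=> /andP[x0 x1]; split; apply/andP; split; lra.
have [a1 a2] := H _ a01; have [b1 b2] := H _ b01.
have I1 := IH _ _ a1 b1; have I2 := IH _ _ a2 b2.
rewrite expnS mul2n -(@ler_pM2l _ 2)// -[X in X * `|_|]normr_nat.
rewrite -normrM mulrBr !cot_sum_sub_half// (exprS 2).
have -> (x y z t : R) : x + y - (z + t) = (x - z) + (y - t) by ring.
apply: (le_trans (ler_normD _ _)); apply: (le_trans (lerD I1 I2)).
have -> : a / 2 - b / 2 = (a - b) / 2 by ring.
have -> : (a + 1) / 2 - (b + 1) / 2 = (a - b) / 2 by ring.
rewrite normrM normfV (@ger0_norm _ 2)// le_eqVlt; apply/orP; left; apply/eqP.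
by field; rewrite expf_neq0.
Qed.

(* Herglotz's trick: by the duplication formula the difference D of the two sides
   satisfies D(a/2) + D((a+1)/2) = 2 D(a), so a Lipschitz constant of D over
   2^k terms is halved at each duplication; finally D(1/2) = 0. *)
Lemma cot_sum_cvg a : 0 < a < 1 -> cot_sum a (2 ^ k) @[k --> \oo] --> cotpi a.
Proof.
move=> a01.
have h2 : 0 < (2^-1 : R) < 1 by apply/andP; split; lra.
have D0 N : cot_sum 2^-1 N - cotpi 2^-1 = 0.
  rewrite /cotpi cos_pihalf mul0r mulr0 subr0 /cot_sum big1// => n _.
  by rewrite /cot_term -natr1; apply/eqP; rewrite subr_eq0; apply/eqP; congr _^-1; field.
have c0 : (pi ^+ 2 + 4) * (2^-1) ^+ k * `|a - 2^-1| @[k --> \oo] --> (0 : R).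
  rewrite -[X in _ --> X](mul0r `|a - 2^-1|) -[X in X * _](mulr0 (pi ^+ 2 + 4)).
  apply: cvgMl; apply: cvgMr; apply: cvg_expr.
  by rewrite ger0_norm//; lra.
apply/cvgrPdist_le => e e0; move/cvgrPdist_le : c0 => /(_ _ e0).
apply: filterS => k; rewrite sub0r normrN; apply: le_trans.
rewrite distrC; apply: le_trans (ler_norm _).
by have := cot_sum_sub_lipschitz k a01 h2; rewrite D0 subr0 exprVn.
Qed.

End cotangent_series.

(** * Integrals over the half-line and tail probabilities *)

Section ftc.
Context {R : realType}.
Notation leb := (@lebesgue_measure R).

Lemma continuous_FTC2_oo (F G : R -> R) (a b : R) : a <= b ->
  (forall x : R, is_derive x 1 F (G x)) -> continuous G ->
  leb.-integrable `]a, b[ (EFin \o G) /\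
  \int[leb]_(x in `]a, b[) G x = F b - F a.
Proof.
move=> ab dF cG.
have iG : leb.-integrable `[a, b] (EFin \o G).
  apply: continuous_compact_integrable; first exact: segment_compact.
  exact: continuous_subspaceT.
split; first by apply: integrableS iG => //; exact: subset_itv_oo_cc.
move: ab; rewrite le_eqVlt => /predU1P[->|ab].
  by rewrite set_itvoo0 Rintegral_set0 subrr.
rewrite /Rintegral.
rewrite -(@integral_itv_bndoo _ a b (EFin \o G) true false); last first.
  by apply/measurable_EFinP/measurable_funTS; exact: continuous_measurable_fun.
rewrite (@continuous_FTC2 _ G F)//.
- exact: continuous_subspaceT.
- have cF : continuous F.
    by move=> x; apply/differentiable_continuous/derivable1_diffP; apply: ex_derive.
  split=> [x _||].
  + by apply: ex_derive.
  + by apply: cvg_at_right_filter; exact: cF.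
  + by apply: cvg_at_left_filter; exact: cF.
- by move=> x _; rewrite derive1E derive_val.
Qed.

End ftc.


Lemma measurable_set_ltr {R : realType} d (T : measurableType d) (f g : T -> R) :
  measurable_fun setT f -> measurable_fun setT g ->
  measurable [set x | f x < g x].
Proof.
move=> mf mg; rewrite -[X in measurable X]setTI.
by have := measurable_fun_ltr mf mg; apply.
Qed.

Definition tail {R : realType} d (T : measurableType d) (P : probability T R)
  (u : T -> R) (s : R) : R := fine (P [set w | s < u w]).

Section tail.
Context {R : realType} d (T : measurableType d) (P : probability T R).
Notation leb := (@lebesgue_measure R).
Variables (u : T -> R) (H : R -> R).
Hypotheses (mu_ : measurable_fun setT u) (mH : measurable_fun setT H).

Let tau : R -> R := tail P u.

Let mlt s : measurable [set w | s < u w].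
Proof. exact: measurable_set_ltr. Qed.

Lemma measurable_tail : measurable_fun setT (tail P u).
Proof.
apply: nonincreasing_measurable => // x y xy.
rewrite /tail fine_le ?fin_num_measure// le_measure ?inE//.
by move=> w /=; exact: le_lt_trans.
Qed.

Hypothesis iH : forall t, leb.-integrable `]0, t[ (EFin \o H).
Hypothesis iHtau : leb.-integrable `]0, +oo[ (EFin \o (fun s => H s * tau s)).

Let A : set (T * R) := [set ws | 0 < ws.2 < u ws.1].
Let f (ws : T * R) : \bar R := (H ws.2 * \1_A ws)%:E.

Let mA : measurable A.
Proof.
rewrite (_ : A = [set ws | 0 < ws.2] `&` [set ws | ws.2 < u ws.1]); last first.
  by apply/seteqP; split => [ws /andP[]|ws [/= a b]]//; apply/andP.
by apply: measurableI; apply: measurable_set_ltr => //; exact: measurableT_comp.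
Qed.

Let mf : measurable_fun setT f.
Proof.
apply/measurable_EFinP; apply: measurable_funM => //.
  exact: measurableT_comp.
Qed.

Let fs (w : T) : (\int[leb]_s f (w, s) = \int[leb]_(s in `]0%R, u w[) (H s)%:E)%E.
Proof.
rewrite [RHS]integral_mkcond; apply: eq_integral => s _.
rewrite /f /= patchE indicE; case: ifPn => [|h].
  rewrite inE/= => h; rewrite mem_set ?mulr1// /A /=; by move: h; rewrite in_itv.
rewrite (_ : (_ \in _) = false) ?mulr0//; apply/negbTE; move: h; apply: contra.
by rewrite !inE/=.
Qed.

Let fw (g : R -> R) s : (\int[P]_w (g s * \1_A (w, s))%:E =
  ((fun s => (g s * tau s)%:E) \_ `]0%R, +oo[) s)%E.
Proof.
rewrite patchE mem_setE in_itv/= andbT; case: ifPn => s0.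
  rewrite (eq_integral (fun w => (g s)%:E * (\1_[set w | s < u w] w)%:E)%E); last first.
    move=> w _; rewrite -EFinM; congr (_ * _)%:E; rewrite !indicE; congr (nat_of_bool _)%:R.
    by apply/idP/idP; rewrite !inE /A /= s0.
  rewrite integralZl//; last exact: integrable_indic.
  by rewrite integral_indic// setIT /tau /tail EFinM fineK// fin_num_measure.
rewrite integral0_eq// => w _; rewrite indicE (_ : (_ \in _) = false) ?mulr0//.
by apply/negbTE; rewrite notin_setE /A /= (negbTE s0).
Qed.

(** Fubini on the region 0 < s < u w. For fixed w its section is an interval, empty if u w <= 0; for
    fixed s > 0 it is the event whose probability is [tail P u s]. As H may change sign, the
    integrability of H times the tail is what permits the exchange. *)
Lemma tail_integral :
  P.-integrable setT (EFin \o (fun w => \int[leb]_(s in `]0, u w[) H s)) /\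
  \int[P]_w (\int[leb]_(s in `]0, u w[) H s) =
  \int[leb]_(s in `]0, +oo[) (H s * tail P u s).
Proof.
have fsE w : (\int[leb]_s f (w, s) = (\int[leb]_(s in `]0%R, u w[) H s)%:E)%E.
  by rewrite fs /Rintegral fineK//; exact: integrable_fin_num.
have if_ : (P \x leb)%E.-integrable setT f.
  apply/integrable21ltyP => //=.
  under eq_integral do under eq_integral do rewrite /f /= normrM (@ger0_norm _ (\1_ _ _))//.
  under eq_integral do rewrite (fw (fun s => `|H s|)).
  rewrite -integral_mkcond; have [_] := integrableP _ _ _ iHtau.
  apply: le_lt_trans; apply: ge0_le_integral => //=.
  - by move=> s _; rewrite lee_fin mulr_ge0// fine_ge0.
  - apply/measurable_EFinP/measurable_funM.
      by apply: measurableT_comp => //; exact: measurable_funTS.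
    by apply: measurable_funTS; exact: measurable_tail.
  - apply/measurable_EFinP; apply: measurableT_comp => //; apply: measurable_funM.
      exact: measurable_funTS.
    by apply: measurable_funTS; exact: measurable_tail.
  - by move=> s _; rewrite lee_fin normrM (@ger0_norm _ (tau s))// fine_ge0.
split.
  have := integrable_fubini_F if_; apply: eq_integrable => // w _.
  exact: fsE.
have := Fubini if_.
under eq_integral do rewrite fsE.
under [RHS]eq_integral do rewrite /f /= (fw H).
by rewrite -integral_mkcond /Rintegral => ->.
Qed.

End tail.

(** * Improper integrals of nonnegative functions *)

Section ftc_open.
Context {R : realType}.
Notation leb := (@lebesgue_measure R).
Implicit Types (f F : R -> R) (a b la lb : R).

(** Monotone convergence along compact intervals exhausting I: for f >= 0 the limits of a primitive
    at the two ends give the value of the improper integral, and its finiteness with it. *)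
Lemma ge0_FTC2_exhaust f F (I : set R) (a_ b_ : nat -> R) la lb :
  nonincreasing_seq a_ -> nondecreasing_seq b_ -> (forall n, a_ n < b_ n) ->
  I = \bigcup_n `[a_ n, b_ n]%classic ->
  (forall x, I x -> is_derive x 1 F (f x)) ->
  (forall x, I x -> {for x, continuous f}) ->
  (forall x, I x -> 0 <= f x) ->
  F (a_ n) @[n --> \oo] --> la -> F (b_ n) @[n --> \oo] --> lb ->
  (\int[leb]_(x in I) (f x)%:E = (lb - la)%:E)%E.
Proof.
move=> nia ndb ab IE dF cf f0 Fa Fb.
have sub n x : x \in `[a_ n, b_ n] -> I x by move=> h; rewrite IE; exists n.
have cfn n : {within `[a_ n, b_ n], continuous f}.
  apply: continuous_in_subspaceT => x; rewrite inE/= => h.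
  exact: cf (sub n _ h).
have cFn n x : x \in `[a_ n, b_ n] -> {for x, continuous F}.
  move=> h; apply/differentiable_continuous/derivable1_diffP.
  by have [] := dF x (sub n _ h).
have key n : (\int[leb]_(x in `[a_ n, b_ n]) (f x)%:E = (F (b_ n))%:E - (F (a_ n))%:E)%E.
  rewrite (@continuous_FTC2 _ f F)//.
  - split.
    + by move=> x h; have [] := dF x (sub n _ (subset_itv_oo_cc h)).
    + by apply: cvg_at_right_filter; apply: (cFn n); rewrite in_itv/= lexx ltW.
    + by apply: cvg_at_left_filter; apply: (cFn n); rewrite in_itv/= lexx ltW.
  - move=> x h; rewrite derive1E.
    by have [_ ->] := dF x (sub n _ (subset_itv_oo_cc h)).
have h : (\int[leb]_(x in `[a_ n, b_ n]) (f x)%:E)%E @[n --> \oo] -->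
         (\int[leb]_(x in \bigcup_n `[a_ n, b_ n]%classic) (f x)%:E)%E.
  apply: ge0_nondecreasing_set_cvg_integral => //.
  - move=> m n mn; apply/subsetPset => x /=; rewrite !in_itv/= => /andP[xa xb].
    by rewrite (le_trans _ xa) ?(le_trans xb)//; [exact: ndb|exact: nia].
  - by move=> n; apply/measurable_EFinP; apply: subspace_continuous_measurable_fun.
  - by move=> n x /sub Ix; rewrite lee_fin f0.
have h2 : (F (b_ n) - F (a_ n))%:E @[n --> \oo] --> (lb - la)%:E.
  by apply: cvg_EFin; [exact: nearW|exact: cvgB].
rewrite IE; apply: (cvg_unique _ h) => //.
by move: h2; apply: cvg_trans; apply: near_eq_cvg; apply: nearW => n; rewrite key EFinB.
Qed.

Let invn_cvg : (n.+2%:R^-1 : R) @[n --> \oo] --> (0 : R).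
Proof. by rewrite (cvg_shiftS (fun n => n.+1%:R^-1 : R)); exact: cvg_harmonic. Qed.

Lemma ge0_FTC2_oo f F a b la lb : a < b ->
  (forall x, a < x < b -> is_derive x 1 F (f x)) ->
  (forall x, a < x < b -> {for x, continuous f}) ->
  (forall x, a < x < b -> 0 <= f x) ->
  F x @[x --> a^'+] --> la -> F x @[x --> b^'-] --> lb ->
  (\int[leb]_(x in `]a, b[) (f x)%:E = (lb - la)%:E)%E.
Proof.
move=> ab dF cf f0 Fa Fb.
(* With n.+3 the two margins together are shorter than b - a already at n = 0. *)
pose e n := (b - a) / n.+3%:R.
have e0 n : 0 < e n by rewrite divr_gt0 ?subr_gt0// ltr0n.
have ecvg : e n @[n --> \oo] --> (0 : R).
  rewrite -[X in _ --> X](mulr0 (b - a)); apply: cvgMr.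
  by rewrite (cvg_shiftS (fun n => n.+2%:R^-1 : R)).
have eni m n : (m <= n)%N -> e n <= e m.
  by move=> mn; rewrite ler_pM2l ?subr_gt0// lef_pV2 ?posrE ?ltr0n// ler_nat !ltnS.
have e2 n : e n + e n < b - a.
  rewrite -mulrDr gtr_pMr ?subr_gt0//.
  have : n.+3%:R^-1 < 2^-1 :> R by rewrite ltf_pV2 ?posrE ?ltr0n// ltr_nat.
  by move: (_^-1) => y; lra.
apply: (@ge0_FTC2_exhaust f F _ (fun n => a + e n) (fun n => b - e n)) => //.
- by move=> m n mn; rewrite lerD2l eni.
- by move=> m n mn; rewrite lerD2l lerN2 eni.
- by move=> n; have := e2 n; lra.
- apply/seteqP; split => x /=.
    rewrite in_itv/= => /andP[ax xb].
    have m0 : 0 < Num.min (x - a) (b - x) by rewrite lt_min !subr_gt0 ax.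
    have /cvgrPdist_lt/(_ _ m0)[N _ /(_ N (leqnn N))] := ecvg.
    rewrite sub0r normrN gtr0_norm// lt_min => /andP[h1 h2].
    by exists N => //; rewrite /= ?in_itv/=; apply/andP; split; lra.
  case=> n _ /=; rewrite ?in_itv/=; have := e0 n => en /andP[h1 h2].
  by apply/andP; split; lra.
- move/cvg_at_rightP : Fa; apply; split; first by move=> n; rewrite ltrDl.
  by rewrite -[X in _ --> X]addr0; apply: cvgD => //; exact: cvg_cst.
- move/cvg_at_leftP : Fb; apply; split; first by move=> n; rewrite ltrBlDr ltrDl.
  by rewrite -[X in _ --> X]subr0; apply: cvgB => //; exact: cvg_cst.
Qed.

Lemma ge0_FTC2_oy f F a la lb :
  (forall x, a < x -> is_derive x 1 F (f x)) ->
  (forall x, a < x -> {for x, continuous f}) ->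
  (forall x, a < x -> 0 <= f x) ->
  F x @[x --> a^'+] --> la -> F x @[x --> +oo] --> lb ->
  (\int[leb]_(x in `]a, +oo[) (f x)%:E = (lb - la)%:E)%E.
Proof.
move=> dF cf f0 Fa Fb.
have e1 n : n.+2%:R^-1 < (1 : R) by rewrite invf_lt1 ?ltr0n// ltr1n.
have e0 n : 0 < n.+2%:R^-1 :> R by rewrite invr_gt0 ltr0n.
apply: (@ge0_FTC2_exhaust f F _ (fun n => a + n.+2%:R^-1) (fun n => a + n.+2%:R)) => //.
- by move=> m n mn; rewrite lerD2l lef_pV2 ?posrE ?ltr0n// ler_nat !ltnS.
- by move=> m n mn; rewrite lerD2l ler_nat !ltnS.
- by move=> n; rewrite ltrD2l (lt_trans (e1 n))// ltr1n.
- apply/seteqP; split => x /=.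
    rewrite in_itv/= andbT -subr_gt0 => ax.
    have /cvgrPdist_lt/(_ _ ax)[N _ hN] := invn_cvg.
    have [M _ hM] := nbhs_infty_ger (x - a).
    exists (maxn N M) => //; rewrite /= ?in_itv/=.
    have := hN _ (leq_maxl N M); rewrite /= sub0r normrN gtr0_norm// => h1.
    have := hM _ (leq_maxr N M) => /= h2.
    have h3 : (maxn N M)%:R <= (maxn N M).+2%:R :> R by rewrite ler_nat ltnW.
    rewrite -lerBlDl (le_trans h2 h3) andbT.
    by move: h1; move: (_^-1) => y; lra.
  case=> n _ /=; rewrite ?in_itv/=; have := e0 n => en /andP[h1 h2].
  by rewrite andbT; move: h1 en; move: (_^-1) => y; lra.
- by move=> x; rewrite /= in_itv/= andbT; exact: dF.
- by move=> x; rewrite /= in_itv/= andbT; exact: cf.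
- by move=> x; rewrite /= in_itv/= andbT; exact: f0.
- move/cvg_at_rightP : Fa; apply; split; first by move=> n; rewrite ltrDl.
  by rewrite -[X in _ --> X]addr0; apply: cvgD => //; exact: cvg_cst.
- have [+ _] := cvg_pinftyP F lb => /(_ Fb); apply.
  apply/cvgryPge => A; near=> n; rewrite -lerBlDl.
  rewrite (@le_trans _ _ n%:R)// ?ler_nat; last by rewrite ltnW.
  by near: n; exact: nbhs_infty_ger.
Unshelve. all: by end_near. Qed.

End ftc_open.

(** * Powers as dominating functions *)

Section weight.
Context {R : realType}.
Notation leb := (@lebesgue_measure R).

Lemma powR_cvgy0 (r : R) : 0 < r -> x `^ (- r) @[x --> +oo] --> 0.
Proof.
move=> r0; apply/cvgrPdist_le => e e0.
near=> x.
have x0 : 0 < x by near: x; exact: nbhs_pinfty_gt.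
rewrite sub0r normrN ger0_norm ?powR_ge0// powRN -[leRHS]invrK.
rewrite lef_pV2 ?posrE ?invr_gt0 ?powR_gt0//.
have -> : e^-1 = (e^-1 `^ r^-1) `^ r.
  by rewrite -powRrM mulVf ?gt_eqF// powRr1// invr_ge0 ltW.
apply: ge0_ler_powR; rewrite ?nnegrE ?powR_ge0 ?(ltW r0) ?(ltW x0)//.
Unshelve. all: by end_near. Qed.

(** Profile of the dominating functions: the exponent a decides integrability at 0, the exponent b
    at infinity. The break is at 1/2 because a jump down by s < 1/2 from 1 stays beyond 1/2, where
    [psi] is Lipschitz uniformly in h. *)
Definition weight (a b s : R) : R := if s < 2^-1 then s `^ a else s `^ b.

Lemma weight_ge0 a b s : 0 <= weight a b s.
Proof. by rewrite /weight; case: ifP => _; exact: powR_ge0. Qed.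

Lemma measurable_weight a b : measurable_fun setT (weight a b).
Proof.
apply: measurable_fun_ifT.
- by apply: measurable_fun_ltr => //; exact: measurable_cst.
- exact: measurable_powR.
- exact: measurable_powR.
Qed.

Lemma continuous_powR (p x : R) : 0 < x -> {for x, continuous (fun s : R => s `^ p)}.
Proof.
move=> x0; apply/differentiable_continuous/derivable1_diffP.
by have [] := is_derive1_powR p x0.
Qed.

Lemma integral_powR_0 (a r : R) : -1 < a -> 0 < r ->
  (\int[leb]_(s in `]0%R, r[) (s `^ a)%:E = (r `^ (a + 1) / (a + 1))%:E)%E.
Proof.
move=> a1 r0; have a10 : 0 < a + 1 by lra.
rewrite -[X in X%:E]subr0.
apply: (@ge0_FTC2_oo _ _ (fun s => s `^ (a + 1) / (a + 1))) => //.
- move=> x /andP[x0 _].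
  have h := is_derive1_powR (a + 1) x0.
  have -> : x `^ a = (a + 1)^-1 *: ((a + 1) * x `^ (a + 1 - 1)).
    by rewrite addrK /GRing.scale/= mulrA mulVf ?mul1r// gt_eqF.
  rewrite (_ : (fun s => _) = (a + 1)^-1 \*: (fun s : R => s `^ (a + 1) : R^o)); last first.
    by apply/funext => s /=; rewrite mulrC.
  exact: is_deriveZ.
- by move=> x /andP[x0 _]; exact: continuous_powR.
- by move=> x _; exact: powR_ge0.
- rewrite -[X in _ --> X](mul0r (a + 1)^-1); apply: cvgMl.
  exact: powR_cvg0.
- apply: cvg_at_left_filter; apply: cvgMl; exact: continuous_powR.
Qed.

Lemma integral_powR_y (b r : R) : b < -1 -> 0 < r ->
  (\int[leb]_(s in `]r, +oo[) (s `^ b)%:E = (- (r `^ (b + 1) / (b + 1)))%:E)%E.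
Proof.
move=> b1 r0; have b10 : b + 1 < 0 by lra.
rewrite -[X in X%:E]sub0r.
apply: (@ge0_FTC2_oy _ _ (fun s => s `^ (b + 1) / (b + 1))) => //.
- move=> x xr; have x0 : 0 < x by exact: lt_trans xr.
  have h := is_derive1_powR (b + 1) x0.
  have -> : x `^ b = (b + 1)^-1 *: ((b + 1) * x `^ (b + 1 - 1)).
    by rewrite addrK /GRing.scale/= mulrA mulVf ?mul1r// lt_eqF.
  rewrite (_ : (fun s => _) = (b + 1)^-1 \*: (fun s : R => s `^ (b + 1) : R^o)); last first.
    by apply/funext => s /=; rewrite mulrC.
  exact: is_deriveZ.
- by move=> x xr; apply: continuous_powR; exact: lt_trans xr.
- by move=> x _; exact: powR_ge0.
- by apply: cvg_at_right_filter; apply: cvgMl; exact: continuous_powR.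
- rewrite -[X in _ --> X](mul0r (b + 1)^-1); apply: cvgMl.
  have h : 0 < - (b + 1) by lra.
  by have := powR_cvgy0 h; rewrite opprK.
Qed.

Lemma integrable_powR_0 (a r : R) : -1 < a -> 0 < r ->
  leb.-integrable `]0, r[ (EFin \o (fun s => s `^ a)).
Proof.
move=> a1 r0; apply/integrableP; split.
  by apply/measurable_EFinP/measurable_funTS; exact: measurable_powR.
under eq_integral do rewrite /= ger0_norm ?powR_ge0//.
by rewrite integral_powR_0// ltry.
Qed.

Lemma integrable_powR_y (b r : R) : b < -1 -> 0 < r ->
  leb.-integrable `]r, +oo[ (EFin \o (fun s => s `^ b)).
Proof.
move=> b1 r0; apply/integrableP; split.
  by apply/measurable_EFinP/measurable_funTS; exact: measurable_powR.
under eq_integral do rewrite /= ger0_norm ?powR_ge0//.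
by rewrite integral_powR_y// ltry.
Qed.

Lemma integrable_split (a r : R) (b : itv_bound R) (f : R -> R) : a < r ->
  (BRight r <= b)%O -> measurable_fun setT f ->
  leb.-integrable `]a, r[ (EFin \o f) ->
  leb.-integrable [set` Interval (BRight r) b] (EFin \o f) ->
  leb.-integrable [set` Interval (BRight a) b] (EFin \o f).
Proof.
move=> ar rb mf /integrableP[_ i1] /integrableP[_ i2].
have mef (D : set R) : measurable D -> measurable_fun D (fun x => `|(EFin \o f) x|%E).
  move=> mD; apply: measurableT_comp => //; apply/measurable_EFinP.
  exact: measurable_funTS.
apply/integrableP; split; first by apply/measurable_EFinP; exact: measurable_funTS.
rewrite (@itv_bndbnd_setU _ _ _ (BLeft r)) ?bnd_simp//; last first.
  by apply: le_trans rb; rewrite bnd_simp.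
rewrite ge0_integral_setU//=.
- rewrite -integral_itv_obnd_cbnd; last exact: mef.
  by rewrite lte_add_pinfty.
- by apply: mef; exact: measurableU.
- apply/disj_setPS => y [/=]; rewrite 2!in_itv/= => /andP[_ yx] /andP[].
  by rewrite leNgt yx.
Qed.

Lemma integrable_weight (a b : R) : -1 < a -> b < -1 ->
  leb.-integrable `]0, +oo[ (EFin \o weight a b).
Proof.
move=> a1 b1; apply: (@integrable_split 0 2^-1) => //.
- exact: measurable_weight.
- apply: eq_integrable (integrable_powR_0 a1 _) => // s.
  by rewrite inE/= in_itv/= /weight => /andP[_ ->].
- apply: eq_integrable (integrable_powR_y b1 _) => // s.
  by rewrite inE/= in_itv/= andbT /weight => h; rewrite ltNge (ltW h).
Qed.

Lemma Rintegral_split (a r : R) (b : itv_bound R) (f : R -> R) : a < r ->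
  (BRight r <= b)%O -> leb.-integrable [set` Interval (BRight a) b] (EFin \o f) ->
  \int[leb]_(s in [set` Interval (BRight a) b]) f s =
  \int[leb]_(s in `]a, r[) f s + \int[leb]_(s in [set` Interval (BRight r) b]) f s.
Proof.
move=> ar rb fi; rewrite -(@Rintegral_itvB _ f (BRight a) b r)//=; last first.
  by rewrite bnd_simp ltW.
rewrite -Rintegral_itv_bndo_bndc; first by rewrite addrC subrK.
apply: integrableS fi => //; apply: subset_itvl; apply: le_trans rb.
by rewrite bnd_simp.
Qed.

Lemma dominated_Rintegral d (T : measurableType d) (m : {measure set T -> \bar R})
    (D : set T) (f g : T -> R) : measurable D -> measurable_fun D f ->
  m.-integrable D (EFin \o g) -> (forall x, D x -> `|f x| <= g x) ->
  m.-integrable D (EFin \o f) /\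
  `|\int[m]_(x in D) f x| <= \int[m]_(x in D) g x.
Proof.
move=> mD mf ig fg.
have if_ : m.-integrable D (EFin \o f).
  apply: le_integrable ig => //; first exact/measurable_EFinP.
  by move=> x Dx; rewrite /= lee_fin (le_trans (fg _ Dx))// ler_norm.
split => //; apply: le_trans (le_normr_Rintegral _ if_) _ => //.
by apply: le_Rintegral => //; exact: integrable_norm.
Qed.

End weight.

(** * Layer-cake formula for the mean of a function after one jump *)

Section drift_identity.
Context {R : realType} d (T : measurableType d) (P : probability T R).
Notation leb := (@lebesgue_measure R).
Variables (u : T -> R) (F G : R -> R) (b : R).
Hypotheses (mu_ : measurable_fun setT u).
Hypothesis dF : forall x : R, is_derive x 1 F (G x).
Hypothesis cG : continuous G.
Hypothesis iGp :
  leb.-integrable `]0, +oo[ (EFin \o (fun s => G (b + s) * tail P u s)).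
Hypothesis iGn :
  leb.-integrable `]0, +oo[ (EFin \o (fun s => G (b - s) * tail P (\- u) s)).

(** F(b + u) - F(b) is the integral of G along the jump. Of the intervals ]0, u[ and ]0, -u[ at
    least one is empty, so both signs fit in one formula, and [tail_integral] applies to each
    half. *)
Lemma drift_identity :
  P.-integrable setT (EFin \o (fun w => F (b + u w))) /\
  \int[P]_w F (b + u w) = F b +
    \int[leb]_(s in `]0, +oo[) (G (b + s) * tail P u s) -
    \int[leb]_(s in `]0, +oo[) (G (b - s) * tail P (\- u) s).
Proof.
have cGp : continuous (fun s => G (b + s)).
  move=> s; apply: continuous_comp; last exact: cG.
  by apply: cvgD => //; exact: cvg_cst.
have cGn : continuous (fun s => G (b - s)).
  move=> s; apply: continuous_comp; last exact: cG.
  by apply: cvgB => //; exact: cvg_cst.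
have dp (s : R) : is_derive s 1 (fun s : R => F (b + s)) (G (b + s)).
  have h := dF (b + s); have := @is_derive1_comp _ F (fun s : R => b + s) s.
  by move=> /(_ _ 1 h); rewrite mulr1; apply; apply: is_derive_eq; rewrite add0r mulr1.
have dn (s : R) : is_derive s 1 (fun s : R => - F (b - s)) (G (b - s)).
  have h := dF (b - s); have := @is_derive1_comp _ F (fun s : R => b - s) s.
  move=> /(_ _ (-1) h); rewrite mulrN1 => H.
  have {}H : is_derive s 1 (F \o (fun s => b - s)) (- G (b - s)).
    by apply: H; apply: is_derive_eq; ring.
  by rewrite -[G _]opprK; apply: is_deriveN.
have ftcp t : leb.-integrable `]0, t[ (EFin \o (fun s => G (b + s))) /\
    (0 <= t -> \int[leb]_(s in `]0, t[) G (b + s) = F (b + t) - F b).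
  have [t0|t0] := leP 0 t; last by rewrite set_itv_ge ?bnd_simp -?leNgt ?ltW//; split => //; exact: integrable_set0.
  by have [? ->] := continuous_FTC2_oo t0 dp cGp; rewrite addr0.
have ftcn t : leb.-integrable `]0, t[ (EFin \o (fun s => G (b - s))) /\
    (0 <= t -> \int[leb]_(s in `]0, t[) G (b - s) = F b - F (b - t)).
  have [t0|t0] := leP 0 t; last by rewrite set_itv_ge ?bnd_simp -?leNgt ?ltW//; split => //; exact: integrable_set0.
  by have [? ->] := continuous_FTC2_oo t0 dn cGn; rewrite subr0 addrC opprK.
have Np (t : R) (g : R -> R) : t <= 0 -> \int[leb]_(s in `]0, t[) g s = 0.
  by move=> t0; rewrite set_itv_ge ?bnd_simp -?leNgt// Rintegral_set0.
have E w : F (b + u w) = F b + (\int[leb]_(s in `]0, u w[) G (b + s)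
    - \int[leb]_(s in `]0, (\- u) w[) G (b - s)).
  have [u0|u0] := leP 0 (u w).
    rewrite (Np ((\- u) w))/= ?oppr_le0// subr0.
    by rewrite (ftcp _).2//; ring.
  rewrite (Np (u w)) ?ltW// sub0r (ftcn _).2/= ?oppr_ge0 ?ltW// opprK.
  by ring.
have mu_N : measurable_fun setT (\- u) by exact: measurable_funN.
have mGp : measurable_fun setT (fun s : R => G (b + s)) by exact: continuous_measurable_fun.
have mGn : measurable_fun setT (fun s : R => G (b - s)) by exact: continuous_measurable_fun.
have [ip Ep] := tail_integral mu_ mGp (fun t => (ftcp t).1) iGp.
have [in_ En] := tail_integral mu_N mGn (fun t => (ftcn t).1) iGn.
have ic : P.-integrable setT (EFin \o (fun=> F b)) by exact: finite_measure_integrable_cst.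
have ib : P.-integrable setT (EFin \o (fun w => \int[leb]_(s in `]0, u w[) G (b + s)
    - \int[leb]_(s in `]0, (\- u) w[) G (b - s))).
  by have := integrableB measurableT ip in_; apply: eq_integrable.
split.
  have := integrableD measurableT ic ib; apply: eq_integrable => // w _ /=.
  by rewrite [in RHS]E EFinD.
under eq_Rintegral do rewrite E.
rewrite RintegralD// RintegralB// Ep En Rintegral_cst//. 
by rewrite (_ : fine _ = 1) ?mulr1 ?addrA//; exact: (congr1 fine (probability_setT P)).
Qed.

End drift_identity.

(** * Smoothed powers and the principal value *)

Section psi.
Context {R : realType}.
Implicit Types (p h v r : R).

Lemma le_powR_nonpos r a b : r <= 0 -> 0 < a -> a <= b -> b `^ r <= a `^ r.
Proof.
move=> r0 a0 ab; have b0 := lt_le_trans a0 ab.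
rewrite -(opprK r) !(powRN _ (- r)) lef_pV2 ?posrE ?powR_gt0//.
by apply: ge0_ler_powR; rewrite ?nnegrE ?oppr_ge0// ltW.
Qed.

Lemma powR_sqr v r : (v ^+ 2) `^ (r / 2) = `|v| `^ r.
Proof.
rewrite -[v ^+ 2]ger0_norm ?sqr_ge0// normrX -powR_mulrn// -powRrM.
by congr (_ `^ _); field.
Qed.

(* With h = 1/r, phi p h is the function (1 + x^2)^(p/2) rescaled by r, see
   [phi_scale]; its derivative is [p * psi p h]. *)
Definition phi p h v : R := (h ^+ 2 + v ^+ 2) `^ (p / 2).
Definition psi p h v : R := v * (h ^+ 2 + v ^+ 2) `^ (p / 2 - 1).
Definition dpsi p h v : R := (h ^+ 2 + v ^+ 2) `^ (p / 2 - 1) +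
  v * ((p / 2 - 1) * (h ^+ 2 + v ^+ 2) `^ (p / 2 - 1 - 1) * (2 * v)).

Lemma phi_ge0 p h v : 0 <= phi p h v. Proof. exact: powR_ge0. Qed.

Lemma phiN p h v : phi p h (- v) = phi p h v.
Proof. by rewrite /phi sqrrN. Qed.

Lemma psiN p h v : psi p h (- v) = - psi p h v.
Proof. by rewrite /psi sqrrN mulNr. Qed.

Let base_gt0 h v : 0 < h -> 0 < h ^+ 2 + v ^+ 2.
Proof. by move=> h0; rewrite ltr_pwDl ?exprn_gt0 ?sqr_ge0. Qed.

Lemma is_derive_powR_sqr h v r : 0 < h ->
  is_derive v 1 (fun v : R => (h ^+ 2 + v ^+ 2) `^ r)
    (r * (h ^+ 2 + v ^+ 2) `^ (r - 1) * (2 * v)).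
Proof.
move=> h0.
have d1 := is_derive1_powR r (base_gt0 v h0).
have d2 : is_derive v 1 (fun v : R => h ^+ 2 + v ^+ 2) (2 * v).
  by apply: is_derive_eq; rewrite /GRing.scale/=; ring.
have := @is_derive1_comp _ (fun y : R => y `^ r) (fun v : R => h ^+ 2 + v ^+ 2) v _ _ d1 d2.
exact.
Qed.

Lemma is_derive_phi p h v : 0 < h ->
  is_derive v 1 (phi p h) (p * psi p h v).
Proof.
move=> h0; have := is_derive_powR_sqr v (p / 2) h0.
rewrite (_ : p / 2 * _ * _ = p * psi p h v)//.
by rewrite /psi; field.
Qed.

Lemma is_derive_psi p h v : 0 < h -> is_derive v 1 (psi p h) (dpsi p h v).
Proof.
move=> h0; have d1 := is_derive_powR_sqr v (p / 2 - 1) h0.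
have d2 := is_deriveM (is_derive_id v 1) d1.
apply: (is_derive_eq d2); rewrite /dpsi /GRing.scale/=; ring.
Qed.

Lemma continuous_psi p h : 0 < h -> continuous (psi p h).
Proof.
move=> h0 v; apply/differentiable_continuous/derivable1_diffP.
by have [] := is_derive_psi p v h0.
Qed.

Lemma continuous_phi p h : 0 < h -> continuous (phi p h).
Proof.
move=> h0 v; apply/differentiable_continuous/derivable1_diffP.
by have [] := is_derive_phi p v h0.
Qed.

Lemma psi_abs_le p h v : p <= 2 -> v != 0 -> `|psi p h v| <= `|v| `^ (p - 1).
Proof.
move=> p2 v0; have v0' : 0 < `|v| by rewrite normr_gt0.
rewrite /psi normrM (ger0_norm (powR_ge0 _ _)).
apply: (@le_trans _ _ (`|v| * (v ^+ 2) `^ (p / 2 - 1))).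
  rewrite ler_wpM2l// le_powR_nonpos//; first lra.
    by rewrite -real_normK ?num_real// exprn_gt0.
  by rewrite lerDr sqr_ge0.
rewrite (_ : p / 2 - 1 = (p - 2) / 2); last by field.
rewrite powR_sqr -{1}[`|v|]powRr1// -powRD; last by rewrite (gt_eqF v0') implybT.
by rewrite (_ : 1 + (p - 2) = p - 1)//; ring.
Qed.

Lemma dpsi_abs_le p h v : 0 < h ->
  `|dpsi p h v| <= (3 + `|p|) * (h ^+ 2 + v ^+ 2) `^ (p / 2 - 1).
Proof.
move=> h0; rewrite /dpsi; have B0 := base_gt0 v h0.
set B := h ^+ 2 + v ^+ 2 in B0 *.
have -> : B `^ (p / 2 - 1) = B * B `^ (p / 2 - 1 - 1).
  rewrite -{2}[B]powRr1 ?ltW// -powRD; last by rewrite (gt_eqF B0) implybT.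
  by congr (_ `^ _); ring.
have Q0 := powR_ge0 B (p / 2 - 1 - 1); move: (B `^ _) Q0 => Q Q0.
have -> : B * Q + v * ((p / 2 - 1) * Q * (2 * v)) = (B + (p - 2) * v ^+ 2) * Q.
  by field.
rewrite normrM (ger0_norm Q0) (mulrA _ B Q) ler_wpM2r//.
have v2 := sqr_ge0 v; have vB : v ^+ 2 <= B by rewrite /B lerDr sqr_ge0.
apply: (le_trans (ler_normD _ _)); rewrite normrM (ger0_norm v2) (gtr0_norm B0).
have : `|p - 2| <= `|p| + 2 by rewrite (le_trans (ler_normB _ _))// (ger0_norm (_ : 0 <= 2)).
by move: `|p - 2| (normr_ge0 p) (normr_ge0 (p - 2)) => y; nra.
Qed.

(** Lipschitz constant of [psi p h] beyond 1/2, for p <= 2: since h^2 + v^2 >= v^2 > 1/4 there, it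
    does not depend on h. *)
Definition Kpsi p : R := (3 + `|p|) * 2^-1 `^ (p - 2).

Lemma psi_lipschitz p h a b : p <= 2 -> 0 < h -> 2^-1 < a -> 2^-1 < b ->
  `|psi p h a - psi p h b| <= Kpsi p * `|a - b|.
Proof.
move=> p2 h0 ha hb.
pose d := Num.max a b + 1.
have had : 2^-1 < a < d by rewrite ha/= /d; have := le_max a a b; rewrite lexx/=; move: (Num.max a b) => m hm; lra.
have hbd : 2^-1 < b < d by rewrite hb/= /d; have := le_max b a b; rewrite lexx orbT; move: (Num.max a b) => m hm; lra.
apply: (@MVT_lipschitz _ (psi p h) (dpsi p h) 2^-1 d) => //.
  by move=> x _; exact: is_derive_psi.
move=> x /andP[hx _]; apply: (le_trans (dpsi_abs_le _ _ h0)).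
rewrite /Kpsi ler_wpM2l ?addr_ge0//.
apply: (@le_trans _ _ ((x ^+ 2) `^ (p / 2 - 1))).
  rewrite le_powR_nonpos//; first lra.
    by rewrite exprn_gt0//; lra.
  by rewrite lerDr sqr_ge0.
rewrite (_ : p / 2 - 1 = (p - 2) / 2); last by field.
rewrite powR_sqr gtr0_norm; last lra.
by rewrite le_powR_nonpos//; lra.
Qed.

End psi.

(** * A regularised integral summed as a cotangent series *)

Section cotangent_integral.
Context {R : realType}.
Notation leb := (@lebesgue_measure R).
Variable al : R.
Hypotheses (al1 : 1 < al) (al2 : al < 2).

(** The kernel (1/(1+s) - 1/(1-s)) s^-al is -2 s^(1-al)/(1 - s^2). Subtracting 1 from the power
    removes the pole at s = 1 and does not change the principal value, that of 1/(1 - s^2) over the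
    half-line being 0. *)
Definition cot_integrand (s : R) : R := (s `^ (1 - al) - 1) / (1 - s ^+ 2).

(** Geometric expansions of [cot_integrand], in powers of s^2 below 1 and of s^-2 above 1. On its
    own side each term is nonnegative, so that sum and integral commute. *)
Definition cot_term0 (n : nat) (s : R) : R := s ^+ n.*2 * (s `^ (1 - al) - 1).
Definition cot_term1 (n : nat) (s : R) : R := s `^ (- n.+1.*2%:R) * (1 - s `^ (1 - al)).

Lemma powRMX (s r : R) n : 0 < s -> s ^+ n * s `^ r = s `^ (n%:R + r).
Proof.
move=> s0; rewrite -powR_mulrn ?ltW// -powRD//.
by rewrite (gt_eqF s0) implybT.
Qed.

Lemma geometric_sqr_cvg (x y : R) : 0 <= x < 1 ->
  \sum_(0 <= n < N) x ^+ n.*2 * y @[N --> \oo] --> y / (1 - x ^+ 2).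
Proof.
move=> /andP[x0 x1].
have x2 : `|x ^+ 2| < 1 by rewrite ger0_norm ?exprn_ge0// expr_lt1.
have := @cvg_geometric_series _ y (x ^+ 2) x2.
rewrite /series/= /geometric/=.
rewrite (_ : (fun N => _) = (fun N => \sum_(0 <= n < N) x ^+ n.*2 * y))//.
apply/funext => N; apply: eq_bigr => n _.
by rewrite mulrC -exprM mul2n.
Qed.

Let one_powR : 1 `^ (1 - al) = 1 :> R. Proof. by rewrite powR1. Qed.

Let p0_ge1 (s : R) : 0 < s <= 1 -> 1 <= s `^ (1 - al).
Proof.
move=> /andP[s0 s1]; have := @le_powR_nonpos R (1 - al) s 1 _ s0 s1.
by rewrite one_powR; apply; rewrite subr_le0 ltW. 
Qed.

Lemma integral_cot_integrand0 :
  (\int[leb]_(s in `]0%R, 1%R[) (cot_integrand s)%:E =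
   \sum_(0 <= n <oo) ((n.*2%:R + 2 - al)^-1 - (n.*2.+1%:R)^-1)%:E)%E.
Proof.
have t0 n s : `]0, 1[%classic s -> 0 <= cot_term0 n s.
  rewrite /= in_itv/= => /andP[s0 s1].
  rewrite /cot_term0 mulr_ge0 ?exprn_ge0 ?(ltW s0)// subr_ge0 p0_ge1//.
  by rewrite s0 ltW.
transitivity (\int[leb]_(s in `]0%R, 1%R[) (\sum_(0 <= n <oo) (cot_term0 n s)%:E))%E.
  apply: eq_integral => s; rewrite inE => s01; have := s01; rewrite /= in_itv/= => /andP[s0 s1].
  apply/esym/cvg_lim => //.
  under eq_fun do rewrite sumEFin.
  apply: cvg_EFin; first exact: nearW.
  by apply: geometric_sqr_cvg; rewrite (ltW s0) s1.
rewrite integral_nneseries; last 3 first.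
- exact: measurable_itv.
- move=> n; apply/measurable_EFinP/measurable_funTS.
  apply: measurable_funM; first exact: measurable_funX.
  by apply: measurable_funB; [exact: measurable_powR|exact: measurable_cst].
- by move=> n s /t0 h; rewrite lee_fin.
apply: eq_eseriesr => n _.
have [h1 h2] := (al1, al2).
have e1 : (-1 : R) < n.*2%:R + (1 - al) by have : 0 <= n.*2%:R :> R by []; lra.
have e2 : (-1 : R) < n.*2%:R by have : 0 <= n.*2%:R :> R by []; lra.
have i1 := @integrable_powR_0 R _ 1 e1 ltr01.
have i2 := @integrable_powR_0 R _ 1 e2 ltr01.
transitivity (\int[leb]_(s in `]0%R, 1%R[) ((s `^ (n.*2%:R + (1 - al)))%:E - (s `^ n.*2%:R)%:E))%E.
  apply: eq_integral => s; rewrite inE /= in_itv/= => /andP[s0 s1].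
  by rewrite -EFinB /cot_term0 mulrBr mulr1 powRMX// powR_mulrn// ltW.
rewrite integralB_EFin// !integral_powR_0// !powR1 !div1r -EFinB.
by congr (_^-1 - _^-1)%:E; [ring|rewrite natr1].
Qed.

Lemma integral_cot_integrand1 :
  (\int[leb]_(s in `]1%R, +oo[) (cot_integrand s)%:E =
   \sum_(0 <= n <oo) ((n.*2.+1%:R)^-1 - (n.*2%:R + al)^-1)%:E)%E.
Proof.
have t0 n s : `]1, +oo[%classic s -> 0 <= cot_term1 n s.
  rewrite /= in_itv/= andbT => s1.
  rewrite /cot_term1 mulr_ge0 ?powR_ge0// subr_ge0.
  have := @le_powR_nonpos R (1 - al) 1 s _ ltr01 (ltW s1).
  by rewrite one_powR; apply; rewrite subr_le0 ltW.
transitivity (\int[leb]_(s in `]1%R, +oo[) (\sum_(0 <= n <oo) (cot_term1 n s)%:E))%E.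
  apply: eq_integral => s; rewrite inE /= in_itv/= andbT => s1.
  have s0 : 0 < s by lra.
  apply/esym/cvg_lim => //.
  under eq_fun do rewrite sumEFin.
  apply: cvg_EFin; first exact: nearW.
  have v01 : 0 <= s^-1 < 1 by rewrite invr_ge0 (ltW s0)/= invf_lt1.
  have := @geometric_sqr_cvg _ (s ^- 2 * (1 - s `^ (1 - al))) v01.
  rewrite (_ : _ / (1 - s^-1 ^+ 2) = cot_integrand s).
    rewrite (_ : (fun N => _) = (fun N => \sum_(0 <= n < N) cot_term1 n s))//.
    apply/funext => N; apply: eq_bigr => n _.
    rewrite /cot_term1 powR_invn ?(ltW s0)// doubleS mulrA exprVn -invfM -exprD.
    by rewrite addn2.
  rewrite /cot_integrand; field.
  by do ?[apply/andP; split]; rewrite ?(gt_eqF s0)//; nra.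
rewrite integral_nneseries; last 3 first.
- exact: measurable_itv.
- move=> n; apply/measurable_EFinP/measurable_funTS.
  apply: measurable_funM; first exact: measurable_powR.
  by apply: measurable_funB; [exact: measurable_cst|exact: measurable_powR].
- by move=> n s /t0 h; rewrite lee_fin.
apply: eq_eseriesr => n _.
have n0 : 0 <= n.*2%:R :> R by [].
have [h1 h2] := (al1, al2).
have e1 : - n.+1.*2%:R < -1 :> R by rewrite ltrN2 ltr1n.
have e2 : - n.+1.*2%:R + (1 - al) < -1 :> R by move: e1; lra.
have i1 := @integrable_powR_y R _ 1 e1 ltr01.
have i2 := @integrable_powR_y R _ 1 e2 ltr01.
transitivity (\int[leb]_(s in `]1%R, +oo[) ((s `^ (- n.+1.*2%:R))%:E - (s `^ (- n.+1.*2%:R + (1 - al)))%:E))%E.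
  apply: eq_integral => s; rewrite inE /= in_itv/= andbT => s1.
  rewrite -EFinB /cot_term1 mulrBr mulr1 -powRD//.
  by rewrite (gt_eqF (lt_trans ltr01 s1)) implybT.
rewrite integralB_EFin// !integral_powR_y// !powR1 !div1r -EFinB.
have -> : n.+1.*2%:R = n.*2%:R + 2 :> R by rewrite doubleS -addn2 natrD.
rewrite -!invrN; congr (_^-1 + _^-1)%:E; last by ring.
by rewrite -natr1; ring.
Qed.

(** The reciprocals of the odd integers cancel between the two halves, which leaves -1/2 times the
    series [cot_sum (al / 2)]. *)
Lemma integral_cot_integrand :
  (\int[leb]_(s in `]0%R, 1%R[) (cot_integrand s)%:E +
   \int[leb]_(s in `]1%R, +oo[) (cot_integrand s)%:E = (- (cotpi (al / 2) / 2))%:E)%E.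
Proof.
have [h1 h2] := (al1, al2).
have hal : 0 < al / 2 < 1 by apply/andP; split; lra.
have g0 n : 0 <= (n.*2%:R + 2 - al)^-1 - (n.*2.+1%:R)^-1 :> R.
  have n0 : 0 <= n.*2%:R :> R by [].
  rewrite -(natr1 n.*2); move: (n.*2%:R) n0 => x x0.
  by rewrite subr_ge0 lef_pV2 ?posrE; lra.
have g1 n : 0 <= (n.*2.+1%:R)^-1 - (n.*2%:R + al)^-1 :> R.
  have n0 : 0 <= n.*2%:R :> R by [].
  rewrite -(natr1 n.*2); move: (n.*2%:R) n0 => x x0.
  by rewrite subr_ge0 lef_pV2 ?posrE; lra.
rewrite integral_cot_integrand0 integral_cot_integrand1 -nneseriesD//; last first.
- by move=> n _ _; rewrite lee_fin.
- by move=> n _ _; rewrite lee_fin.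
pose u n : \bar R := (((n.*2%:R + 2 - al)^-1 - (n.*2.+1%:R)^-1)%:E +
    ((n.*2.+1%:R)^-1 - (n.*2%:R + al)^-1)%:E)%E.
have uE n : u n = (- (cot_term (al / 2) n / 2))%:E.
  rewrite /u -EFinD /cot_term -(natr1 n.*2) -(natr1 n) -muln2 natrM; congr _%:E.
  have n0 : 0 <= n%:R :> R by [].
  move: (n%:R) n0 => x x0.
  by field; do ?[apply/andP; split]; rewrite gt_eqF//; lra.
have cu : cvgn (fun N => \sum_(0 <= n < N) u n)%E.
  by apply: is_cvg_nneseries => n _ _; rewrite /u -EFinD lee_fin addr_ge0.
(* [cot_sum] is known to converge only along the indices 2 ^ k. The terms u n being nonnegative, the
   whole series converges and may be evaluated along them. *)
have sub : (\sum_(0 <= n < 2 ^ k) u n)%E @[k --> \oo] -->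
    limn (fun N => \sum_(0 <= n < N) u n)%E.
  apply: (@cvg_comp _ _ _ (fun k => 2 ^ k)%N (fun N => \sum_(0 <= n < N) u n)%E _ \oo) cu.
  apply/cvgnyPge => A; near=> k; rewrite (@leq_trans k)//.
    by near: k; exact: nbhs_infty_ge.
  by rewrite ltnW// ltn_expl.
apply: (cvg_unique _ sub) => //.
rewrite (_ : (fun k => _) = (fun k => (- (cot_sum (al / 2) (2 ^ k) / 2))%:E)); last first.
  apply/funext => k; under eq_bigr do rewrite uE.
  by rewrite sumEFin sumrN -mulr_suml.
apply: cvg_EFin; first exact: nearW.
by apply: cvgN; apply: cvgMl; exact: cot_sum_cvg.
Unshelve. all: by end_near. Qed.

End cotangent_integral.

(** * Domination near the singularity s = 1 *)

Section J.
Context {R : realType}.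
Notation leb := (@lebesgue_measure R).
Variable al : R.
Hypotheses (al1 : 1 < al) (al2 : al < 2).

(* As p and h tend to 0, psi p h v tends to 1/v, which is not integrable at
   v = 0, i.e. at s = 1. Subtracting chi from s^-al removes the singularity: Phi
   is dominated by domi, uniformly in p and h, and converges to Phi0, and what
   is subtracted integrates exactly to (phi p h 3 - phi p h 1) / p. *)
Definition kern p h (s : R) : R := (psi p h (1 + s) - psi p h (1 - s)) * s `^ (- al).
Definition Jint p h : R := \int[leb]_(s in `]0, +oo[) kern p h s.
Definition chi (s : R) : R := if s < 2 then 1 else 0.
Definition Phi p h (s : R) : R :=
  (psi p h (1 + s) - psi p h (1 - s)) * (s `^ (- al) - chi s).
Definition Phi0 (s : R) : R := ((1 + s)^-1 - (1 - s)^-1) * (s `^ (- al) - chi s).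
(** Near s = 1 the bound |1 - s|^(p-1) on [psi p h (1 - s)] meets the zero of s^-al - 1; for |p| <=
    1/2 and |1 - s| <= 1 the product |1 - s|^p is at most |1 - s|^(-1/2). *)
Definition sing (s : R) : R := `|1 - s| `^ (- 2^-1) * chi s.
Definition domi (s : R) : R := 256 * weight (1 - al) (- al) s + 256 * sing s.

Lemma measurable_chi : measurable_fun setT chi.
Proof.
apply: measurable_fun_ifT; [|exact: measurable_cst|exact: measurable_cst].
by apply: measurable_fun_ltr => //; exact: measurable_cst.
Qed.

Lemma measurable_sing : measurable_fun setT sing.
Proof.
apply: measurable_funM; last exact: measurable_chi.
have m1 : measurable_fun setT (fun s : R => `|1 - s|).
  apply: measurableT_comp => //.
  by apply: measurable_funB => //; exact: measurable_cst.
exact: (measurableT_comp (measurable_powR (- 2^-1)) m1).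
Qed.

Lemma measurable_psi1 p h : 0 < h ->
  measurable_fun setT (fun s : R => psi p h (1 + s) - psi p h (1 - s)).
Proof.
move=> h0; have mp : measurable_fun setT (psi p h).
  by apply: continuous_measurable_fun; exact: continuous_psi.
apply: measurable_funB; apply: measurableT_comp => //.
  by apply: measurable_funD => //; exact: measurable_cst.
by apply: measurable_funB => //; exact: measurable_cst.
Qed.

Lemma measurable_Phi p h : 0 < h -> measurable_fun setT (Phi p h).
Proof.
move=> h0; apply: measurable_funM; first exact: measurable_psi1.
by apply: measurable_funB; [exact: measurable_powR|exact: measurable_chi].
Qed.

Lemma integrable_sing : leb.-integrable `]0, +oo[ (EFin \o sing).
Proof.
have i1 : leb.-integrable `]0, 1[ (EFin \o sing).
  apply/integrableP; split.
    by apply/measurable_EFinP/measurable_funTS; exact: measurable_sing.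
  rewrite [ltLHS](_ : _ = \int[leb]_(s in `]0%R, 1%R[) ((1 - s) `^ (- 2^-1))%:E)%E; last first.
    apply: eq_integral => s; rewrite inE/= in_itv/= => /andP[s0 s1].
    rewrite ger0_norm; last by rewrite mulr_ge0 ?powR_ge0// /chi; case: ifP.
    rewrite /sing /chi (_ : s < 2) ?mulr1 ?gtr0_norm ?subr_gt0//; lra.
  suff -> : (\int[leb]_(s in `]0%R, 1%R[) ((1 - s) `^ (- 2^-1))%:E = (0 - (- 2))%:E)%E by rewrite ltry.
  apply: (@ge0_FTC2_oo _ _ (fun s : R => - 2 * (1 - s) `^ (2^-1))).
  - exact: ltr01.
  - move=> x /andP[x0 x1].
    have x1' : 0 < 1 - x by lra.
    have d1 := is_derive1_powR (2^-1) x1'.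
    have d2 : is_derive x 1 (fun x : R => 1 - x) (-1) by apply: is_derive_eq; ring.
    have := @is_derive1_comp _ (fun y : R => y `^ (2^-1)) (fun x : R => 1 - x) x _ _ d1 d2.
    move=> d3; have := is_deriveZ (-2 : R) d3.
    move/is_derive_eq; apply; rewrite /GRing.scale/=.
    by rewrite (_ : 2^-1 - 1 = - 2^-1 :> R); field.
  - move=> x /andP[x0 x1]; apply: (@continuous_comp _ _ _ (fun x : R => 1 - x) (fun y : R => y `^ (- 2^-1))).
      by apply: cvgB => //; exact: cvg_cst.
    by apply: continuous_powR; lra.
  - by move=> x _; exact: powR_ge0.
  - rewrite -[X in _ --> X](mulr1 (-2)); apply: cvgMr.
    rewrite [X in _ --> X](_ : 1 = (1 - 0) `^ (2^-1)); last by rewrite subr0 powR1.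
    apply: cvg_at_right_filter.
    apply: (@continuous_comp _ _ _ (fun x : R => 1 - x) (fun y : R => y `^ (2^-1))).
      by apply: cvgB => //; exact: cvg_cst.
    by apply: continuous_powR; lra.
  - rewrite -[X in _ --> X](mulr0 (-2)); apply: cvgMr.
    apply/cvg_at_leftP => u [u1 uc].
    have h12 : 0 < 2^-1 :> R by [].
    have /cvg_at_rightP H := powR_cvg0 h12; apply: H; split.
      by move=> n; rewrite subr_gt0.
    rewrite -[X in _ --> X](subrr (1 : R)); apply: cvgB => //; exact: cvg_cst.
have i2 : leb.-integrable `]1, 2[ (EFin \o sing).
  apply/integrableP; split.
    by apply/measurable_EFinP/measurable_funTS; exact: measurable_sing.
  rewrite [ltLHS](_ : _ = \int[leb]_(s in `]1%R, 2%R[) ((s - 1) `^ (- 2^-1))%:E)%E; last first.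
    apply: eq_integral => s; rewrite inE/= in_itv/= => /andP[s0 s1].
    rewrite ger0_norm; last by rewrite mulr_ge0 ?powR_ge0// /chi; case: ifP.
    by rewrite /sing /chi s1 mulr1 distrC gtr0_norm// subr_gt0.
  suff -> : (\int[leb]_(s in `]1%R, 2%R[) ((s - 1) `^ (- 2^-1))%:E = (2 - 0)%:E)%E by rewrite ltry.
  apply: (@ge0_FTC2_oo _ _ (fun s : R => 2 * (s - 1) `^ (2^-1))).
  - by lra.
  - move=> x /andP[x0 x1].
    have x1' : 0 < x - 1 by lra.
    have d1 := is_derive1_powR (2^-1) x1'.
    have d2 : is_derive x 1 (fun x : R => x - 1) 1 by apply: is_derive_eq; ring.
    have := @is_derive1_comp _ (fun y : R => y `^ (2^-1)) (fun x : R => x - 1) x _ _ d1 d2.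
    move=> d3; have := is_deriveZ (2 : R) d3.
    move/is_derive_eq; apply; rewrite /GRing.scale/=.
    by rewrite (_ : 2^-1 - 1 = - 2^-1 :> R); field.
  - move=> x /andP[x0 x1]; apply: (@continuous_comp _ _ _ (fun x : R => x - 1) (fun y : R => y `^ (- 2^-1))).
      by apply: cvgB => //; exact: cvg_cst.
    by apply: continuous_powR; lra.
  - by move=> x _; exact: powR_ge0.
  - rewrite -[X in _ --> X](mulr0 2); apply: cvgMr.
    apply/cvg_at_rightP => u [u1 uc].
    have h12 : 0 < 2^-1 :> R by [].
    have /cvg_at_rightP H := powR_cvg0 h12; apply: H; split.
      by move=> n; rewrite subr_gt0.
    rewrite -[X in _ --> X](subrr (1 : R)); apply: cvgB => //; exact: cvg_cst.
  - rewrite -[X in _ --> X](mulr1 2); apply: cvgMr.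
    rewrite [X in _ --> X](_ : 1 = (2 - 1) `^ (2^-1)); last first.
      by rewrite (_ : 2 - 1 = 1) ?powR1//; ring.
    apply: cvg_at_left_filter.
    apply: (@continuous_comp _ _ _ (fun x : R => x - 1) (fun y : R => y `^ (2^-1))).
      by apply: cvgB => //; exact: cvg_cst.
    by apply: continuous_powR; lra.
apply: (@integrable_split _ 0 1) => //; first exact: measurable_sing.
apply: (@integrable_split _ 1 2) => //; first by lra.
  exact: measurable_sing.
apply: (@eq_integrable _ _ _ _ _ _ (cst 0%E)) => //; last exact: integrable0.
move=> s; rewrite inE/= in_itv/= andbT => s2.
by rewrite /sing /chi ltNge (ltW s2) mulr0.
Qed.

End J.

Section J.
Context {R : realType}.
Notation leb := (@lebesgue_measure R).
Implicit Types (al p h s : R).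

(** The exponent p - 2 is above -3, whence (3 + 1/2) 2^3 = 28; this is the 28 of all later bounds
    with |p| <= 1/2. *)
Lemma Kpsi_le p : `|p| <= 2^-1 -> Kpsi p <= 28.
Proof.
move=> ph; rewrite /Kpsi.
have : 2^-1 `^ (p - 2) <= (2^-1 : R) `^ (- 3).
  apply: ger_powR; first by apply/andP; split; lra.
  by have := ler_norm (- p); rewrite normrN; lra.
rewrite powRN powR_mulrn// exprVn invrK (_ : 2 ^+ 3 = 8); last by rewrite !exprS expr0; ring.
have := powR_ge0 (2^-1 : R) (p - 2); move: (2^-1 `^ _) => q q0 q8.
by have := normr_ge0 p; move: `|p| ph => y *; nra.
Qed.

Lemma integrable_domi al : 1 < al -> al < 2 ->
  leb.-integrable `]0, +oo[ (EFin \o domi al).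
Proof.
move=> al1 al2.
have i1 : leb.-integrable `]0, +oo[ (fun s => 256%:E * (EFin \o weight (1 - al) (- al)) s)%E.
  by apply: integrableZl => //; apply: integrable_weight; lra.
have i2 : leb.-integrable `]0, +oo[ (fun s => 256%:E * (EFin \o sing) s)%E.
  by apply: integrableZl => //; exact: integrable_sing.
by have := integrableD _ i1 i2; apply.
Qed.

Lemma sing_ge0 s : 0 <= sing s.
Proof. by rewrite /sing mulr_ge0 ?powR_ge0// /chi; case: ifP. Qed.

(** On ]1/4, 3[ the derivative is at most al 4^(al+1) <= 2 * 4^3 = 128 in absolute value. *)
Lemma powRN_lipschitz1 al s : 1 < al -> al < 2 -> 2^-1 <= s < 2 ->
  `|s `^ (- al) - 1| <= 128 * `|1 - s|.
Proof.
move=> al1 al2 /andP[hs s2].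
have := @MVT_lipschitz R (fun s => s `^ (- al)) (fun s => - al * s `^ (- al - 1)) (4^-1) 3 128.
move=> /(_ _ _ s 1); rewrite powR1 (distrC s); apply; last 2 first.
- by apply/andP; split; lra.
- by apply/andP; split; lra.
- by move=> x /andP[x0 _]; apply: is_derive1_powR; lra.
move=> x /andP[x0 _]; rewrite normrM normrN !ger0_norm ?powR_ge0//; last lra.
have : x `^ (- al - 1) <= 64.
  apply: (@le_trans _ _ (4^-1 `^ (- al - 1))); first by apply: le_powR_nonpos; lra.
  apply: (@le_trans _ _ (4^-1 `^ (- 3))).
    by apply: ger_powR; [apply/andP; split|]; lra.
  rewrite powRN powR_mulrn// exprVn invrK (_ : 4 ^+ 3 = 64)//.
  by rewrite !exprS expr0; ring.
by have := powR_ge0 x (- al - 1); move: (x `^ _) => q; nra.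
Qed.

(** Three regimes. Below 1/2 the difference of [psi] is of order s by the Lipschitz bound. Between
    1/2 and 2 the factor s^-al - 1 vanishes at s = 1 and absorbs one power of the singularity; 256
    is twice its Lipschitz constant 128. Beyond 2 both values of [psi] are at most 1. *)
Lemma Phi_domi al p h s : 1 < al -> al < 2 -> `|p| <= 2^-1 -> 0 < h -> 0 < s ->
  `|Phi al p h s| <= domi al s.
Proof.
move=> al1 al2 p2 h0 s0; rewrite /Phi /domi normrM.
have pr : - 2^-1 <= p <= 2^-1 by rewrite -ler_norml.
have [p1 p3] := andP pr.
have psi_le1 v : 1 <= v -> `|psi p h v| <= 1.
  move=> v1; apply: (le_trans (psi_abs_le _ _ _)); [lra|by rewrite gt_eqF//; lra|].
  rewrite ger0_norm; last lra.
  have := @le_powR_nonpos R (p - 1) 1 v _ ltr01 v1; rewrite powR1; apply; lra.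
have [s12|s12] := ltP s 2^-1.
  have := @psi_lipschitz R p h (1 + s) (1 - s) _ h0.
  have -> : 1 + s - (1 - s) = 2 * s by ring.
  rewrite (@ger0_norm _ (2 * s)); last lra.
  move=> /(_ _ _ _); have K := Kpsi_le p2.
  have q1 : 1 <= s `^ (- al).
    have := @le_powR_nonpos R (- al) s 1 _ s0; rewrite powR1; apply; lra.
  rewrite /chi (_ : s < 2) ?(@ger0_norm _ (_ - 1)) ?subr_ge0//; last lra.
  rewrite /weight s12.
  have -> : s `^ (1 - al) = s * s `^ (- al).
    by rewrite powRD ?powRr1 ?(gt_eqF s0) ?implybT// ltW.
  move=> H; have {}H : `|psi p h (1 + s) - psi p h (1 - s)| <= Kpsi p * (2 * s).
    by apply: H; lra.
  apply: (@le_trans _ _ ((28 * (2 * s)) * s `^ (- al))).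
    apply: ler_pM => //; first by rewrite subr_ge0.
      by apply: (le_trans H); rewrite ler_wpM2r//; lra.
    by rewrite gerBl.
  have := sing_ge0 s; have : 0 <= s * s `^ (- al) by rewrite mulr_ge0 ?powR_ge0// ltW.
  by rewrite -!mulrA; move: (s * _) (sing s) => x y; lra.
have [s2|s2] := ltP s 2.
  rewrite /sing /chi s2 mulr1.
  have [->|s1] := eqVneq s 1.
    rewrite powR1 subrr normr0 mulr0.
    by apply: addr_ge0; apply: mulr_ge0; rewrite ?ler0n ?weight_ge0 ?powR_ge0.
  have L := @powRN_lipschitz1 al s al1 al2 _.
  have n1 : 0 < `|1 - s| by rewrite normr_gt0 subr_eq0 eq_sym.
  have n2 : `|1 - s| <= 1 by rewrite ler_norml; apply/andP; split; lra.
  have b1 : `|1 - s| * `|psi p h (1 - s)| <= `|1 - s| `^ (- 2^-1).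
    apply: (@le_trans _ _ (`|1 - s| * `|1 - s| `^ (p - 1))).
      rewrite ler_wpM2l//; apply: psi_abs_le; first lra.
      by rewrite subr_eq0 eq_sym.
    rewrite -{1}[`|1 - s|]powRr1// -powRD; last by rewrite (gt_eqF n1) implybT.
    by apply: ger_powR; [rewrite n1 n2|lra].
  have b2 : 1 <= `|1 - s| `^ (- 2^-1).
    have := @le_powR_nonpos R (- 2^-1) `|1 - s| 1 _ n1 n2; rewrite powR1; apply; lra.
  have b3 : `|psi p h (1 + s)| <= 1 by apply: psi_le1; lra.
  have {}L : `|s `^ (- al) - 1| <= 128 * `|1 - s| by apply: L; rewrite s12 s2.
  have b4 := ler_normB (psi p h (1 + s)) (psi p h (1 - s)).
  apply: (@le_trans _ _ ((`|psi p h (1 + s)| + `|psi p h (1 - s)|) * (128 * `|1 - s|))).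
    by apply: ler_pM.
  have := weight_ge0 (1 - al) (- al) s.
  move: b1 b2 b3 n1 n2 (normr_ge0 (psi p h (1 - s))) (normr_ge0 (psi p h (1 + s))).
  move: `|psi p h (1 - s)| `|psi p h (1 + s)| `|1 - s| (_ `^ _) (weight _ _ _) => A B n q w *.
  by nra.
have q0 := powR_ge0 s (- al).
rewrite /sing /chi ltNge s2/= subr0 mulr0 mulr0 addr0 /weight (_ : (s < 2^-1) = false); last first.
  by apply/negbTE; rewrite -leNgt.
rewrite (ger0_norm q0) ler_wpM2r//.
apply: (le_trans (ler_normB _ _)).
have b3 : `|psi p h (1 + s)| <= 1 by apply: psi_le1; lra.
have b4 : `|psi p h (1 - s)| <= 1 by rewrite -opprB psiN normrN; apply: psi_le1; lra.
by move: b3 b4; move: `|_| `|_| => x y; lra.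
Qed.

(** The subtracted part lives on ]0, 2[ and has the primitive (phi(1 + s) + phi(1 - s))/p. At s = 2
    its second argument is -1, so by evenness one of the two copies of phi(1) taken off at s = 0 is
    given back. *)
Lemma integrable_kern al p h : 1 < al -> al < 2 -> `|p| <= 2^-1 -> p != 0 -> 0 < h ->
  leb.-integrable `]0, +oo[ (EFin \o kern al p h) /\
  Jint al p h = \int[leb]_(s in `]0, +oo[) Phi al p h s + (phi p h 3 - phi p h 1) / p.
Proof.
move=> al1 al2 p2 p0 h0.
have mphi := @measurable_Phi R al p h h0.
have hb s : `]0, +oo[%classic s -> `|Phi al p h s| <= domi al s.
  by rewrite /= in_itv/= andbT; exact: Phi_domi.
have iPhi : leb.-integrable `]0, +oo[ (EFin \o Phi al p h).
  by have [] := @dominated_Rintegral R _ _ leb `]0, +oo[%classic (Phi al p h) (domi al)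
    (measurable_itv _) (measurable_funTS mphi) (integrable_domi al1 al2) hb.
pose g s := psi p h (1 + s) - psi p h (1 - s).
have mg : measurable_fun setT g by exact: measurable_psi1.
have cg : continuous g.
  move=> s; apply: cvgB.
    apply: (@continuous_comp _ _ _ (fun s : R => 1 + s) (psi p h)); last exact: continuous_psi.
    by apply: cvgD => //; exact: cvg_cst.
  apply: (@continuous_comp _ _ _ (fun s : R => 1 - s) (psi p h)); last exact: continuous_psi.
  by apply: cvgB => //; exact: cvg_cst.
have dg s : is_derive s 1 (fun s : R => p^-1 * (phi p h (1 + s) + phi p h (1 - s))) (g s).
  have d1 : is_derive s 1 (fun s : R => 1 + s) 1 by apply: is_derive_eq; ring.
  have d2 : is_derive s 1 (fun s : R => 1 - s) (-1) by apply: is_derive_eq; ring.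
  have d3 := @is_derive1_comp _ (phi p h) (fun s => 1 + s) s _ _ (is_derive_phi p _ h0) d1.
  have d4 := @is_derive1_comp _ (phi p h) (fun s => 1 - s) s _ _ (is_derive_phi p _ h0) d2.
  have d5 := is_deriveZ p^-1 (is_deriveD d3 d4).
  by apply: (is_derive_eq d5); rewrite /GRing.scale/= /g; field.
have [ig Eg] := continuous_FTC2_oo (ler0n R 2) dg cg.
have ig2 : leb.-integrable `]0, 2[ (EFin \o (fun s => g s * chi s)).
  apply: eq_integrable ig => // s; rewrite inE/= in_itv/= => /andP[_ s2].
  by rewrite /chi s2 mulr1.
have ig3 : leb.-integrable `]2, +oo[ (EFin \o (fun s => g s * chi s)).
  apply: (@eq_integrable _ _ _ _ _ _ (cst 0%E)) => //; last exact: integrable0.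
  by move=> s; rewrite inE/= in_itv/= andbT => s2; rewrite /chi ltNge (ltW s2) mulr0.
have igc : leb.-integrable `]0, +oo[ (EFin \o (fun s => g s * chi s)).
  apply: (@integrable_split _ 0 2) => //.
  by apply: measurable_funM => //; exact: measurable_chi.
have E : \int[leb]_(s in `]0, +oo[) (g s * chi s) = (phi p h 3 - phi p h 1) / p.
  rewrite (@Rintegral_split _ 0 2)//.
  rewrite [X in _ + X](_ : _ = 0) ?addr0; last first.
    transitivity (\int[leb]_(s in `]2, +oo[) (0 * 0 : R)).
      apply: eq_Rintegral => s; rewrite inE/= in_itv/= andbT => s2.
      by rewrite /chi ltNge (ltW s2) mulr0 mul0r.
    by rewrite mul0r /Rintegral integral0.
  rewrite -[LHS](_ : \int[leb]_(s in `]0, 2[) g s = _); last first.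
    apply: eq_Rintegral => s; rewrite inE/= in_itv/= => /andP[_ s2].
    by rewrite /chi s2 mulr1.
  rewrite Eg addr0 subr0 (_ : 1 + 2 = 3); last by ring.
  by rewrite (_ : 1 - 2 = - 1) ?phiN; [field|ring].
have ik0 : leb.-integrable `]0, +oo[ ((EFin \o Phi al p h) \+ (EFin \o (fun s => (g s * chi s)%R)))%E.
  exact: integrableD.
have kE s : kern al p h s = Phi al p h s + g s * chi s.
  by rewrite /kern /Phi /g -mulrDr subrK.
split.
  apply: eq_integrable ik0 => // s _; by rewrite /= kE EFinD.
rewrite /Jint -E -RintegralD//; apply: eq_Rintegral => s _; exact: kE.
Qed.

End J.

(** * The limiting integral *)

Section Phi0.
Context {R : realType}.
Notation leb := (@lebesgue_measure R).
Implicit Types (al p h s : R).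

Lemma cot_integrand_ge0 al s : 1 < al -> 0 < s -> 0 <= cot_integrand al s.
Proof.
move=> al1 s0; rewrite /cot_integrand.
have [s1|s1] := leP s 1.
  have := @le_powR_nonpos R (1 - al) s 1 _ s0 s1; rewrite powR1 => h.
  by rewrite divr_ge0 ?subr_ge0 ?expr_le1 ?(ltW s0)// h// subr_le0 ltW.
have := @le_powR_nonpos R (1 - al) 1 s _ ltr01 (ltW s1); rewrite powR1 => h.
rewrite -mulrNN -invrN mulr_ge0 ?invr_ge0 ?oppr_ge0 ?subr_le0//.
  by rewrite h// subr_le0 ltW.
by rewrite expr_ge1// ltW.
Qed.

Lemma measurable_inv : measurable_fun setT (fun x : R => x^-1).
Proof.
rewrite (_ : (fun x : R => _) =
    fun x => if 0 <= x then x `^ (- 1) else - ((- x) `^ (- 1))); last first.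
  apply/funext => x; case: ifPn => x0; first by rewrite powR_inv1.
  by rewrite powR_inv1 ?invrN ?opprK// oppr_ge0 ltW// ltNge.
apply: measurable_fun_ifT.
- by apply: measurable_fun_ler => //; exact: measurable_cst.
- exact: measurable_powR.
- apply: measurableT_comp => //.
  exact: (measurableT_comp (measurable_powR (- 1))).
Qed.

Lemma measurable_funV (f : R -> R) : measurable_fun setT f ->
  measurable_fun setT (fun x => (f x)^-1).
Proof. by move=> mf; exact: (measurableT_comp measurable_inv). Qed.

Lemma measurable_cot_integrand al : measurable_fun setT (cot_integrand al).
Proof.
apply: measurable_funM.
  by apply: measurable_funB; [exact: measurable_powR|exact: measurable_cst].
apply: measurable_funV; apply: measurable_funB; first exact: measurable_cst.
exact: measurable_funX.
Qed.

(** [Phi0] is, off s = 1, -2 times the sum of [cot_integrand] and (1 - s chi s)/(1 - s^2), and the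
    latter is [r1 s - r2 s]. Their integrals ln 3 and ln 3 / 2 produce the term - ln 3, which the
    limit of (phi p h 3 - phi p h 1)/p cancels. *)
Let r1 (s : R) := chi s / (1 + s).
Let r2 (s : R) := (1 - chi s) / (s ^+ 2 - 1).

Lemma Rintegral_cot_integrand al : 1 < al -> al < 2 ->
  leb.-integrable `]0, +oo[ (EFin \o cot_integrand al) /\
  \int[leb]_(s in `]0, +oo[) cot_integrand al s = - (cotpi (al / 2) / 2).
Proof.
move=> al1 al2; have E := integral_cot_integrand al1 al2.
have mw := @measurable_cot_integrand al.
have g0 : (0 <= \int[leb]_(s in `]0%R, 1%R[) (cot_integrand al s)%:E)%E.
  apply: integral_ge0 => s; rewrite /= in_itv/= => /andP[s0 _].
  by rewrite lee_fin cot_integrand_ge0.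
have g1 : (0 <= \int[leb]_(s in `]1%R, +oo[) (cot_integrand al s)%:E)%E.
  apply: integral_ge0 => s; rewrite /= in_itv/= andbT => s1.
  by rewrite lee_fin cot_integrand_ge0// (lt_trans ltr01).
have f0 : (\int[leb]_(s in `]0%R, 1%R[) (cot_integrand al s)%:E < +oo)%E.
  by apply: (@le_lt_trans _ _ (- (cotpi (al / 2) / 2))%:E); rewrite ?ltry// -E leeDl.
have f1 : (\int[leb]_(s in `]1%R, +oo[) (cot_integrand al s)%:E < +oo)%E.
  by apply: (@le_lt_trans _ _ (- (cotpi (al / 2) / 2))%:E); rewrite ?ltry// -E leeDr.
have i0 : leb.-integrable `]0, 1[ (EFin \o cot_integrand al).
  apply/integrableP; split; first exact/measurable_EFinP/measurable_funTS.
  apply: le_lt_trans f0; rewrite le_eqVlt; apply/orP; left; apply/eqP.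
  apply: eq_integral => s; rewrite inE/= in_itv/= => /andP[s0 _].
  by rewrite ger0_norm// cot_integrand_ge0.
have i1 : leb.-integrable `]1, +oo[ (EFin \o cot_integrand al).
  apply/integrableP; split; first exact/measurable_EFinP/measurable_funTS.
  apply: le_lt_trans f1; rewrite le_eqVlt; apply/orP; left; apply/eqP.
  apply: eq_integral => s; rewrite inE/= in_itv/= andbT => s1.
  by rewrite ger0_norm// cot_integrand_ge0// (lt_trans ltr01).
have ii : leb.-integrable `]0, +oo[ (EFin \o cot_integrand al).
  exact: (@integrable_split _ 0 1).
split => //; rewrite (@Rintegral_split _ 0 1)// /Rintegral.
by rewrite -fineD ?E//; exact: integrable_fin_num.
Qed.

Lemma measurable_r1 : measurable_fun setT r1.
Proof.
apply: measurable_funM; first exact: measurable_chi.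
apply: measurable_funV; apply: measurable_funD => //; exact: measurable_cst.
Qed.

Lemma measurable_r2 : measurable_fun setT r2.
Proof.
apply: measurable_funM.
  by apply: measurable_funB; [exact: measurable_cst|exact: measurable_chi].
apply: measurable_funV; apply: measurable_funB; last exact: measurable_cst.
exact: measurable_funX.
Qed.

Lemma Rintegral_r1 :
  leb.-integrable `]0, +oo[ (EFin \o r1) /\ \int[leb]_(s in `]0, +oo[) r1 s = ln 3.
Proof.
have E : (\int[leb]_(s in `]0%R, 2%R[) ((1 + s)^-1)%:E = (ln 3 - ln 1)%:E)%E.
  apply: (@ge0_FTC2_oo _ _ (fun s : R => ln (1 + s))) => //.
  - move=> x /andP[x0 x1].
    have x1' : 0 < 1 + x by lra.
    have d1 := is_derive1_ln x1'.
    have d2 : is_derive x 1 (fun x : R => 1 + x) 1 by apply: is_derive_eq; ring.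
    have := @is_derive1_comp _ (@ln R) (fun x : R => 1 + x) x _ _ d1 d2.
    by rewrite mulr1.
  - move=> x /andP[x0 x1]; apply: cvgV; first by rewrite gt_eqF//; lra.
    by apply: cvgD => //; exact: cvg_cst.
  - by move=> x /andP[x0 x1]; rewrite invr_ge0; lra.
  - apply: cvg_at_right_filter; rewrite -[X in _ --> ln X](addr0 1).
    apply: (@continuous_comp _ _ _ (fun x : R => 1 + x) (@ln R)).
      by apply: cvgD => //; exact: cvg_cst.
    by apply: continuous_ln; lra.
  - apply: cvg_at_left_filter; rewrite [X in _ --> ln X](_ : 3 = 1 + 2); last by ring.
    apply: (@continuous_comp _ _ _ (fun x : R => 1 + x) (@ln R)).
      by apply: cvgD => //; exact: cvg_cst.
    by apply: continuous_ln; lra.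
have E2 : (\int[leb]_(s in `]0%R, 2%R[) (r1 s)%:E = (ln 3)%:E)%E.
  rewrite -[ln 3]subr0 -{2}(@ln1 R) -E; apply: eq_integral => s.
  by rewrite inE/= in_itv/= => /andP[_ s2]; rewrite /r1 /chi s2 mul1r.
have i0 : leb.-integrable `]0, 2[ (EFin \o r1).
  apply/integrableP; split; first by apply/measurable_EFinP/measurable_funTS; exact: measurable_r1.
  apply: (@le_lt_trans _ _ (ln 3)%:E); rewrite ?ltry// -E2.
  rewrite le_eqVlt; apply/orP; left; apply/eqP.
  apply: eq_integral => s; rewrite inE/= in_itv/= => /andP[s0 s2].
  by rewrite ger0_norm// /r1 /chi s2 mul1r invr_ge0; lra.
have z s : s \in `]2, +oo[%classic -> r1 s = 0.
  by rewrite inE/= in_itv/= andbT => s2; rewrite /r1 /chi ltNge (ltW s2) mul0r.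
have i1 : leb.-integrable `]2, +oo[ (EFin \o r1).
  apply: (@eq_integrable _ _ _ _ _ _ (cst 0%E)) => //; last exact: integrable0.
  by move=> s /z /= ->.
have ii : leb.-integrable `]0, +oo[ (EFin \o r1).
  by apply: (@integrable_split _ 0 2) => //; exact: measurable_r1.
split => //; rewrite (@Rintegral_split _ 0 2)// /Rintegral E2.
rewrite [X in _ + fine X](_ : _ = 0%E) ?addr0//.
by apply: integral0_eq => s hs; rewrite z// inE.
Qed.

Lemma Rintegral_r2 :
  leb.-integrable `]0, +oo[ (EFin \o r2) /\ \int[leb]_(s in `]0, +oo[) r2 s = ln 3 / 2.
Proof.
have E : (\int[leb]_(s in `]2%R, +oo[) ((s ^+ 2 - 1)^-1)%:E = (ln 1 / 2 - (- ln 3 / 2))%:E)%E.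
  (* The primitive 1/2 ln((s - 1)/(s + 1)), written so that its limit 0 at infinity can be read
     off. *)
  apply: (@ge0_FTC2_oy _ _ (fun s : R => 2^-1 * ln (1 - 2 * (1 + s)^-1))).
  - move=> x x2.
    have x1' : 1 + x != 0 by rewrite gt_eqF//; lra.
    have x3 : 0 < 1 - 2 * (1 + x)^-1.
      by rewrite subr_gt0 ltr_pdivrMr ?mul1r; lra.
    have d1 := is_derive1_ln x3.
    have d2 : is_derive x 1 (fun x : R => 1 + x) 1 by apply: is_derive_eq; ring.
    have d3 := is_deriveV x1' d2.
    have d4 : is_derive x 1 (fun x : R => 1 - 2 * (1 + x)^-1) (2 * (1 + x) ^- 2).
      have d5 := is_deriveB (is_derive_cst (1 : R) x 1) (is_deriveZ (2 : R) d3).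
      by apply: (is_derive_eq d5); rewrite /GRing.scale/=; field.
    have d6 := @is_derive1_comp _ (@ln R) (fun x : R => 1 - 2 * (1 + x)^-1) x _ _ d1 d4.
    have d7 := is_deriveZ (2^-1 : R) d6.
    apply: (is_derive_eq d7); rewrite /GRing.scale/=; field.
    by do ?[apply/andP; split]; rewrite ?(gt_eqF x3)//; nra.
  - move=> x x2; apply: cvgV; first by rewrite gt_eqF//; nra.
    apply: cvgB; last exact: cvg_cst.
    by apply: cvgM => //; exact: cvg_id.
  - by move=> x x2; rewrite invr_ge0; nra.
  - apply: cvg_at_right_filter.
    have -> : - ln 3 / 2 = 2^-1 * ln (1 - 2 * (1 + 2)^-1) :> R.
      have -> : 1 - 2 * (1 + 2)^-1 = 3^-1 :> R by field.
      by rewrite lnV ?posrE// mulrC.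
    apply: cvgMr.
    apply: (@continuous_comp _ _ _ (fun x : R => 1 - 2 * (1 + x)^-1) (@ln R)).
      apply: cvgB; first exact: cvg_cst.
      apply: cvgMr; apply: cvgV => //; apply: cvgD => //; exact: cvg_cst.
    by apply: continuous_ln; rewrite subr_gt0 ltr_pdivrMr ?mul1r; lra.
  - rewrite [X in _ --> X]mulrC; apply: cvgMr.
    have h1 : 1 - 2 * (1 + x)^-1 @[x --> +oo%R] --> (1 : R).
      rewrite -[X in _ --> X]subr0; apply: cvgB; first exact: cvg_cst.
      rewrite -[X in _ --> X](mulr0 2); apply: cvgMr.
      apply/cvgrPdist_le => e e0; near=> x.
      have x0 : 0 < x by near: x; exact: nbhs_pinfty_gt.
      rewrite sub0r normrN ger0_norm ?invr_ge0; last lra.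
      rewrite -[leRHS]invrK lef_pV2 ?posrE ?invr_gt0//; last lra.
      have : e^-1 <= x by near: x; apply: nbhs_pinfty_ge; rewrite num_real.
      by lra.
    by apply: (cvg_comp _ _ h1); apply: continuous_ln.
have E2 : (\int[leb]_(s in `]2%R, +oo[) (r2 s)%:E = (ln 3 / 2)%:E)%E.
  rewrite (_ : ln 3 / 2 = ln 1 / 2 - (- ln 3 / 2)) -?E.
    apply: eq_integral => s.
    by rewrite inE/= in_itv/= andbT => s2; rewrite /r2 /chi ltNge (ltW s2) subr0 mul1r.
  by rewrite ln1 mul0r sub0r mulNr opprK.
have i1 : leb.-integrable `]2, +oo[ (EFin \o r2).
  apply/integrableP; split; first by apply/measurable_EFinP/measurable_funTS; exact: measurable_r2.
  apply: (@le_lt_trans _ _ (ln 3 / 2)%:E); rewrite ?ltry// -E2.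
  rewrite le_eqVlt; apply/orP; left; apply/eqP.
  apply: eq_integral => s; rewrite inE/= in_itv/= andbT => s2.
  by rewrite ger0_norm// /r2 /chi ltNge (ltW s2) subr0 mul1r invr_ge0; nra.
have z s : s \in `]0, 2[%classic -> r2 s = 0.
  by rewrite inE/= in_itv/= => /andP[_ s2]; rewrite /r2 /chi s2 subrr mul0r.
have i0 : leb.-integrable `]0, 2[ (EFin \o r2).
  apply: (@eq_integrable _ _ _ _ _ _ (cst 0%E)) => //; last exact: integrable0.
  by move=> s /z /= ->.
have ii : leb.-integrable `]0, +oo[ (EFin \o r2).
  by apply: (@integrable_split _ 0 2) => //; exact: measurable_r2.
split => //; rewrite (@Rintegral_split _ 0 2)// /Rintegral E2.
rewrite [X in fine X + _](_ : _ = 0%E) ?add0r//.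
by apply: integral0_eq => s hs; rewrite z// inE.
Unshelve. all: by end_near. Qed.

Lemma measurable_Phi0 al : measurable_fun setT (Phi0 al).
Proof.
apply: measurable_funM; last first.
  by apply: measurable_funB; [exact: measurable_powR|exact: measurable_chi].
apply: measurable_funB; apply: measurable_funV.
  by apply: measurable_funD => //; exact: measurable_cst.
by apply: measurable_funB => //; exact: measurable_cst.
Qed.

Lemma Rintegral_Phi0 al : 1 < al -> al < 2 ->
  \int[leb]_(s in `]0, +oo[) Phi0 al s = cotpi (al / 2) - ln 3.
Proof.
move=> al1 al2.
have [iw Ew] := Rintegral_cot_integrand al1 al2.
have [i1 E1] := Rintegral_r1.
have [i2 E2] := Rintegral_r2.
pose f s := -2 * (cot_integrand al s + (r1 s - r2 s)).
have -> : \int[leb]_(s in `]0, +oo[) Phi0 al s = \int[leb]_(s in `]0, +oo[) f s.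
  congr fine; apply: ae_eq_integral => //.
  - by apply/measurable_EFinP/measurable_funTS; exact: measurable_Phi0.
  - apply/measurable_EFinP/measurable_funTS; apply: measurable_funM; first exact: measurable_cst.
    apply: measurable_funD; first exact: measurable_cot_integrand.
    by apply: measurable_funB; [exact: measurable_r1|exact: measurable_r2].
  (* At s = 1 the inverses of 0 are 0 and the two integrands differ (0 against -1), which is a null
     set. *)
  exists [set (1 : R)]; split => //.
    exact: lebesgue_measure_set1.
  move=> s /=; apply: contra_notP => s1; rewrite in_itv/= andbT => s0.
  congr EFin; rewrite /f.
  have n1 : s != 1 by apply/eqP.
  have e : s * s `^ (- al) = s `^ (1 - al).
    by rewrite powRD ?powRr1 ?(gt_eqF s0) ?implybT// ltW.
  rewrite /Phi0 /r1 /r2 /cot_integrand -e /chi.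
  have z1 : 1 - s != 0 by rewrite subr_eq0 eq_sym.
  have z2 : 1 + s != 0 by rewrite gt_eqF// addr_gt0.
  have z3 : 1 - s ^+ 2 != 0.
    by rewrite (_ : 1 - s ^+ 2 = (1 - s) * (1 + s)) ?mulf_neq0//; ring.
  have z4 : s ^+ 2 - 1 != 0 by rewrite -opprB oppr_eq0.
  by case: ifP => _; field; do ?[apply/andP; split].
have i3 : leb.-integrable `]0, +oo[ (EFin \o (fun s => r1 s - r2 s)).
  exact: (integrableB _ i1 i2).
have i4 : leb.-integrable `]0, +oo[ (EFin \o (fun s => cot_integrand al s + (r1 s - r2 s))).
  exact: (integrableD _ iw i3).
rewrite /f RintegralZl// RintegralD// RintegralB// Ew E1 E2.
by field.
Qed.

End Phi0.

(** * Passing to the limit in p and h *)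

Section Jlim.
Context {R : realType}.
Notation leb := (@lebesgue_measure R).
Implicit Types (al p h s : R).

Lemma expR_sub1_le (x : R) : `|x| <= 2^-1 -> `|expR x - 1 - x| <= 2 * x ^+ 2.
Proof.
move=> hx; have /andP[h1 h2] : - 2^-1 <= x <= 2^-1 by rewrite -ler_norml.
have e1 := expR_ge1Dx x; have e2 := expR_ge1Dx (- x).
rewrite ger0_norm; last by lra.
have : expR x <= (1 - x)^-1.
  rewrite -[leLHS]invrK lef_pV2 ?posrE ?invr_gt0 ?expR_gt0//; last lra.
  by rewrite -expRN.
move=> e3; apply: (@le_trans _ _ ((1 - x)^-1 - 1 - x)); first by lra.
rewrite (_ : (1 - x)^-1 - 1 - x = x ^+ 2 / (1 - x)); last by field; lra.
rewrite ler_pdivrMr; last lra.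
by have := sqr_ge0 x; move: (x ^+ 2) => y; nra.
Qed.

Section sequence.
Variables (al : R) (p_ h_ : nat -> R).
Hypotheses (al1 : 1 < al) (al2 : al < 2).
Hypotheses (p2 : forall n, `|p_ n| <= 2^-1) (p0 : forall n, p_ n != 0)
  (h0 : forall n, 0 < h_ n).
Hypotheses (pc : p_ n @[n --> \oo] --> 0) (hc : h_ n @[n --> \oo] --> 0).

Lemma base_cvg (v : R) : h_ n ^+ 2 + v ^+ 2 @[n --> \oo] --> v ^+ 2.
Proof.
rewrite (_ : (fun n => _) = (fun n => h_ n * h_ n + v ^+ 2)); last first.
  by apply/funext => n; rewrite expr2.
rewrite -[X in _ --> X]add0r -[X in _ --> X + _](mulr0 0).
by apply: cvgD; [exact: cvgM|exact: cvg_cst].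
Qed.

Lemma lnbase_cvg (v : R) : v != 0 -> ln (h_ n ^+ 2 + v ^+ 2) @[n --> \oo] --> ln (v ^+ 2).
Proof.
move=> v0; apply: (cvg_comp _ _ (@base_cvg v)).
by apply: continuous_ln; rewrite exprn_even_gt0.
Qed.

Let base_gt0 n v : 0 < h_ n ^+ 2 + v ^+ 2.
Proof. by rewrite ltr_pwDl ?exprn_gt0 ?sqr_ge0. Qed.

Lemma psi_cvg (v : R) : v != 0 -> psi (p_ n) (h_ n) v @[n --> \oo] --> v^-1.
Proof.
move=> v0; have v2 : 0 < v ^+ 2 by rewrite exprn_even_gt0.
have -> : v^-1 = v * expR ((0 / 2 - 1) * ln (v ^+ 2)).
  rewrite mul0r sub0r mulN1r -lnV ?posrE// lnK ?posrE ?invr_gt0//.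
  by rewrite expr2 invfM mulrA divff// mul1r.
apply: cvgMr.
have c1 : (p_ n / 2 - 1) * ln (h_ n ^+ 2 + v ^+ 2) @[n --> \oo] --> (0 / 2 - 1) * ln (v ^+ 2).
  apply: cvgM; last exact: lnbase_cvg.
  by apply: cvgB; [exact: cvgMl|exact: cvg_cst].
have := cvg_comp _ _ c1 (@continuous_expR R _); apply: cvg_trans.
apply: near_eq_cvg; apply: nearW => n /=.
by rewrite /powR gt_eqF.
Qed.

(** [phi p h v] is the exponential of p ln(h^2 + v^2)/2, so its increment from 1 divided by p tends
    to ln |v|; v = 3 and v = 1 give ln 3. *)
Lemma phi_diff_cvg :
  (phi (p_ n) (h_ n) 3 - phi (p_ n) (h_ n) 1) / p_ n @[n --> \oo] --> ln 3.
Proof.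
pose A v n := ln (h_ n ^+ 2 + v ^+ 2) / 2.
have Ac v : v != 0 -> A v n @[n --> \oo] --> ln (v ^+ 2) / 2.
  by move=> v0; apply: cvgMl; exact: lnbase_cvg.
have pA v : v != 0 -> (phi (p_ n) (h_ n) v - 1) / p_ n @[n --> \oo] --> ln (v ^+ 2) / 2.
  move=> v0; have pAc : p_ n * A v n @[n --> \oo] --> 0.
    by rewrite -[X in _ --> X](mul0r (ln (v ^+ 2) / 2)); apply: cvgM => //; exact: Ac.
  have bc : 2 * `|p_ n * A v n| * `|A v n| @[n --> \oo] --> 0.
    rewrite -[X in _ --> X](mul0r `|ln (v ^+ 2) / 2|) -[X in X * _](mulr0 2).
    rewrite -[X in 2 * X](@normr0 _ R).
    apply: cvgM; last by apply: cvg_norm; exact: Ac.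
    by apply: cvgMr; exact: cvg_norm.
  have dc : (phi (p_ n) (h_ n) v - 1) / p_ n - A v n @[n --> \oo] --> 0.
    apply/cvgr0Pnorm_le => e e0; near=> n.
    have small : `|p_ n * A v n| <= 2^-1.
      by near: n; move/cvgr0Pnorm_le : pAc; apply; rewrite invr_gt0.
    have E : phi (p_ n) (h_ n) v = expR (p_ n * A v n).
      by rewrite /phi /powR gt_eqF// /A; congr expR; field.
    have -> : (phi (p_ n) (h_ n) v - 1) / p_ n - A v n =
        (expR (p_ n * A v n) - 1 - p_ n * A v n) / p_ n.
      by rewrite E; field.
    rewrite normrM normfV ler_pdivrMr ?normr_gt0//.
    apply: (le_trans (expR_sub1_le small)).
    apply: (@le_trans _ _ ((2 * `|p_ n * A v n| * `|A v n|) * `|p_ n|)).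
      rewrite -(real_normK (num_real (_ * _))) expr2 {2}normrM.
      by rewrite le_eqVlt; apply/orP; left; apply/eqP; ring.
    rewrite ler_wpM2r//; apply: le_trans (ler_norm _) _.
    by near: n; move/cvgr0Pnorm_le : bc; apply.
  rewrite (_ : (fun n => _) = (fun n =>
      (phi (p_ n) (h_ n) v - 1) / p_ n - A v n + A v n)); last first.
    by apply/funext => n; rewrite subrK.
  by rewrite -[X in _ --> X]add0r; apply: cvgD => //; exact: Ac.
rewrite (_ : (fun n => _) = (fun n =>
    (phi (p_ n) (h_ n) 3 - 1) / p_ n - (phi (p_ n) (h_ n) 1 - 1) / p_ n)); last first.
  by apply/funext => n; rewrite -mulrBl opprB addrA subrK.
rewrite [X in _ --> X](_ : _ = ln (3 ^+ 2) / 2 - ln (1 ^+ 2) / 2); last first.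
  by rewrite expr1n ln1 lnXn//; field.
by apply: cvgB; apply: pA.
Unshelve. all: by end_near. Qed.

Lemma Phi_Rintegral_cvg :
  \int[leb]_(s in `]0, +oo[) Phi al (p_ n) (h_ n) s @[n --> \oo] -->
  \int[leb]_(s in `]0, +oo[) Phi0 al s.
Proof.
have [h1 h2] := (al1, al2).
have [i0 _ c] : [/\ leb.-integrable `]0, +oo[ (fun s => (Phi0 al s)%:E),
    [sequence \int[leb]_(s in `]0%R, +oo[) `|(Phi al (p_ n) (h_ n) s)%:E - (Phi0 al s)%:E|]_n%E @ \oo --> 0%E &
    [sequence \int[leb]_(s in `]0%R, +oo[) (Phi al (p_ n) (h_ n) s)%:E]_n%E @ \oo -->
    (\int[leb]_(s in `]0%R, +oo[) (Phi0 al s)%:E)%E].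
  apply: (@dominated_convergence _ _ R leb _ _ _ _ (fun s => (domi al s)%:E)).
  - by [].
  - by move=> n; apply/measurable_EFinP/measurable_funTS; exact: measurable_Phi.
  - by apply/measurable_EFinP/measurable_funTS; exact: measurable_Phi0.
  - exists [set (1 : R)]; split => //.
      exact: lebesgue_measure_set1.
    move=> s /=; apply: contra_notP => s1; rewrite in_itv/= andbT => s0.
    have n1 : s != 1 by apply/eqP.
    apply: cvg_EFin; first exact: nearW.
    apply: cvgMl; apply: cvgB; apply: psi_cvg.
      by rewrite gt_eqF// addr_gt0.
    by rewrite subr_eq0 eq_sym.
  - exact: integrable_domi.
  - apply: aeW => s n; rewrite /= in_itv/= andbT => s0.
    by rewrite lee_fin; exact: Phi_domi.
by apply: fine_cvg; rewrite /Rintegral fineK//; exact: integrable_fin_num.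
Qed.

Lemma Jint_cvg : Jint al (p_ n) (h_ n) @[n --> \oo] --> cotpi (al / 2).
Proof.
rewrite (_ : (fun n => _) = (fun n =>
    \int[leb]_(s in `]0, +oo[) Phi al (p_ n) (h_ n) s +
    (phi (p_ n) (h_ n) 3 - phi (p_ n) (h_ n) 1) / p_ n)); last first.
  by apply/funext => n; have [_ ->] := integrable_kern al1 al2 (p2 n) (p0 n) (h0 n).
rewrite [X in _ --> X](_ : _ = \int[leb]_(s in `]0, +oo[) Phi0 al s + ln 3); last first.
  by rewrite Rintegral_Phi0// subrK.
by apply: cvgD; [exact: Phi_Rintegral_cvg|exact: phi_diff_cvg].
Qed.

End sequence.

(** Dominated convergence speaks of sequences. If no e worked, e = 1/(n+2) would yield for each n a
    pair (p, h) that violates the bound, and the sequence of these pairs contradicts [Jint_cvg]. *)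
Lemma Jint_lim al (k : R) : 1 < al -> al < 2 -> 0 < k ->
  exists e : R, [/\ 0 < e, e <= 2^-1 & forall p h, p != 0 -> `|p| <= e -> 0 < h -> h <= e ->
    `|Jint al p h - cotpi (al / 2)| <= k].
Proof.
move=> al1 al2 k0; apply: contrapT => /forallNP H.
have {}H n : exists ph : R * R, [/\ ph.1 != 0, `|ph.1| <= n.+2%:R^-1, 0 < ph.2,
    ph.2 <= n.+2%:R^-1 & k < `|Jint al ph.1 ph.2 - cotpi (al / 2)|].
  have := H n.+2%:R^-1; apply: contra_notP => /forallNP H'; split.
  - by rewrite invr_gt0.
  - by rewrite lef_pV2 ?posrE// ler_nat.
  move=> p h p0 pe h0 he; rewrite leNgt; apply/negP => kJ.
  exact: (H' (p, h)).
have [ph Hph] := choice H.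
have inv_cvg : (n.+2%:R^-1 : R) @[n --> \oo] --> (0 : R).
  by rewrite (cvg_shiftS (fun n => n.+1%:R^-1 : R)); exact: cvg_harmonic.
have pc : (ph n).1 @[n --> \oo] --> 0.
  apply/cvgr0Pnorm_le => e e0; near=> n.
  have [_ h1 _ _ _] := Hph n; apply: (le_trans h1).
  rewrite -[leLHS]ger0_norm ?invr_ge0//.
  by near: n; move/cvgr0Pnorm_le : inv_cvg; apply.
have hc : (ph n).2 @[n --> \oo] --> 0.
  apply/cvgr0Pnorm_le => e e0; near=> n.
  have [_ _ h1 h2 _] := Hph n; rewrite gtr0_norm//; apply: (le_trans h2).
  rewrite -[leLHS]ger0_norm ?invr_ge0//.
  by near: n; move/cvgr0Pnorm_le : inv_cvg; apply.
have c : Jint al (ph n).1 (ph n).2 @[n --> \oo] --> cotpi (al / 2).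
  apply: (Jint_cvg al1 al2 _ _ _ pc hc) => n; have [h1 h2 h3 h4 h5] := Hph n => //.
  by apply: (le_trans h2); rewrite lef_pV2 ?posrE// ler_nat.
move/cvgrPdist_le : c => /(_ k k0) [N _ /(_ N (leqnn N))] /=.
by rewrite distrC leNgt; have [_ _ _ _ ->] := Hph N.
Unshelve. all: by end_near. Qed.

End Jlim.

(** * Excessive functions of the transition kernel *)

Section kernel.
Context {R : realType} (X : set R) (k : R.-pker R ~> R).
Hypotheses (mX : measurable X) (kX : forall x, X x -> k x X = 1%E).
Local Open Scope ereal_scope.

Definition kop (f : R -> \bar R) (x : R) : \bar R := \int[k x]_y f y.

Lemma kop_ge0 f x : (forall y, 0 <= f y) -> 0 <= kop f x.
Proof. by move=> f0; exact: integral_ge0. Qed.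

Lemma measurable_kop f : (forall y, 0 <= f y) -> measurable_fun setT f ->
  measurable_fun setT (kop f).
Proof.
move=> f0 mf; apply: measurable_fun_integral_kernel => // U mU.
exact: measurable_kernel.
Qed.

Lemma kop_cst (r : R) x : kop (cst r%:E) x = r%:E.
Proof. by rewrite /kop integral_cst// prob_kernel mule1. Qed.

(** Drift inequalities are available on X only; from a point of X the kernel does not leave X, so
    they may be integrated. *)
Lemma ae_kernel (Q : R -> Prop) x : X x -> (forall y, X y -> Q y) ->
  {ae k x, forall y, Q y}.
Proof.
move=> Xx h; exists (~` X); split.
- exact: measurableC.
- rewrite -setTD measureD//; last first.
    apply: le_lt_trans (ltry 1); rewrite le_eqVlt; apply/orP; left; apply/eqP.
    exact: prob_kernel.
  transitivity (1 - 1 : \bar R); last by rewrite subee.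
  by congr (_ - _); [exact: prob_kernel|rewrite setTI; exact: kX].
- by move=> y /=; apply: contra_not; exact: h.
Qed.

Lemma le_kop f g x : X x -> (forall y, 0 <= f y) -> (forall y, 0 <= g y) ->
  measurable_fun setT f -> measurable_fun setT g ->
  (forall y, X y -> f y <= g y) -> kop f x <= kop g x.
Proof.
move=> Xx f0 g0 mf mg fg; apply: ae_ge0_le_integral => //.
by apply: ae_kernel => // y Xy _; exact: fg.
Qed.

Lemma kopD f g x : (forall y, 0 <= f y) -> (forall y, 0 <= g y) ->
  measurable_fun setT f -> measurable_fun setT g ->
  kop (fun y => f y + g y) x = kop f x + kop g x.
Proof. by move=> f0 g0 mf mg; rewrite /kop ge0_integralD. Qed.

Lemma measurable_iter_kop n f : (forall y, 0 <= f y) -> measurable_fun setT f ->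
  (forall y, 0 <= iter n kop f y) /\ measurable_fun setT (iter n kop f).
Proof.
move=> f0 mf; elim: n => // n [h1 h2] /=; split; last exact: measurable_kop.
by move=> y; exact: kop_ge0.
Qed.

(* stay A n x is the probability that xi_0, ..., xi_(n-1) are all in A, so that
   P_x[tau > n] is stay A n.+1 x for A the complement of [-a, a]. *)
Definition stay (A : set R) n : R -> \bar R := fdd k (nseq n A).

Lemma stayS A n x : stay A n.+1 x = (\1_A x)%:E * kop (stay A n) x.
Proof. by []. Qed.

Lemma stay_ge0 A n x : 0 <= stay A n x.
Proof.
elim: n x => [|n IH] x; first by rewrite /stay/= lee01.
by rewrite stayS mule_ge0 ?lee_fin ?kop_ge0.
Qed.

Lemma measurable_stay A n : measurable A -> measurable_fun setT (stay A n).
Proof.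
move=> mA; elim: n => [|n IH]; first exact: measurable_cst.
apply: emeasurable_funM; first by apply/measurable_EFinP; exact: measurable_indic.
by apply: measurable_kop => //; exact: stay_ge0.
Qed.

Lemma staySin A n x : A x -> stay A n.+1 x = kop (stay A n) x.
Proof. by move=> Ax; rewrite stayS indicE mem_set// mul1e. Qed.

Lemma staySout A n x : ~ A x -> stay A n.+1 x = 0.
Proof. by move=> Ax; rewrite stayS indicE memNset// mul0e. Qed.

Lemma stay_le1 A n x : measurable A -> stay A n x <= 1.
Proof.
move=> mA; elim: n x => [|n IH] x; first by rewrite /stay.
have [Ax|Ax] := pselect (A x); last by rewrite staySout.
rewrite staySin// -(kop_cst 1 x); apply: ge0_le_integral => //.
- by move=> y _; exact: stay_ge0.
- exact: measurable_stay.
Qed.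

(** The Markov property at the deterministic time m, when nothing is asked of the first m
    positions. *)
Lemma fdd_shift m (As : seq (set R)) x :
  fdd k (nseq m setT ++ As) x = iter m kop (fdd k As) x.
Proof.
elim: m x => // m IH x /=; rewrite indicE in_setT mul1e.
by congr (integral _ _ _); apply/funext => y; exact: IH.
Qed.

(** Stands for the maximal inequality of the stopped supermartingale: V exceeds M before A is left
    with probability at most V x / M. In the induction a point with V > M is trivial, the last
    summand being at least 1. *)
Lemma stay_level_le (A : set R) (V : R -> R) (M : R) n x : measurable A ->
  measurable_fun setT V -> (forall y, 0 <= V y)%R -> (0 < M)%R ->
  (forall y, X y -> A y -> kop (EFin \o V) y <= (V y)%:E) -> X x ->
  stay A n x <= stay (A `&` [set y | V y <= M]%R) n x + (V x / M)%:E.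
Proof.
move=> mA mV V0 M0 VA; set D := A `&` _.
have mD : measurable D.
  apply: measurableI => //; rewrite -[X in measurable X]setTI.
  by have := measurable_fun_ler mV (measurable_cst M); apply.
have V0' y : (0 <= (V y / M)%:E) by rewrite lee_fin divr_ge0// ltW.
have mVM : measurable_fun setT (fun y => (V y / M)%:E).
  by apply/measurable_EFinP; apply: measurable_funM => //; exact: measurable_cst.
elim: n x => [|n IH] x Xx.
  by rewrite /stay/= leeDl.
have [Ax|Ax] := pselect (A x); last first.
  by rewrite staySout// adde_ge0// stay_ge0.
have [VM|VM] := leP (V x) M; last first.
  apply: (le_trans (stay_le1 _ _ mA)).
  rewrite -[leLHS]add0e leeD ?stay_ge0// lee_fin ler_pdivlMr// mul1r ltW//.
rewrite !staySin//.
apply: (@le_trans _ _ (kop (fun y => stay D n y + (V y / M)%:E) x)).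
  apply: le_kop => //.
  - by move=> y; exact: stay_ge0.
  - by move=> y; rewrite adde_ge0// stay_ge0.
  - exact: measurable_stay.
  - by apply: emeasurable_funD => //; exact: measurable_stay.
rewrite kopD//; [|by move=> y; exact: stay_ge0|exact: measurable_stay].
apply: leeD => //.
rewrite /kop; under eq_integral do rewrite mulrC EFinM.
rewrite ge0_integralZl//; last 3 first.
- exact/measurable_EFinP.
- by move=> y _; rewrite lee_fin.
- by rewrite lee_fin invr_ge0 ltW.
by rewrite mulrC EFinM lee_pmul2l ?lte_fin ?invr_gt0//; exact: VA.
Qed.

(** Supplied by (N') through [stay_bounded_cvg0]. *)
Hypothesis stay_bounded : forall (D : set R) (L : R), measurable D ->
  (forall y, D y -> `|y| <= L)%R -> forall x, X x ->
  forall e : R, (0 < e)%R -> exists N, forall n, (N <= n)%N -> stay D n x <= e%:E.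

(** V reaches a high level with small probability only, and below that level the chain moves in a
    bounded set, which is left. *)
Lemma stay_cvg0 (A : set R) (V : R -> R) x : measurable A ->
  measurable_fun setT V -> (forall y, 0 <= V y)%R ->
  (forall y, X y -> A y -> kop (EFin \o V) y <= (V y)%:E) ->
  (forall M : R, exists L : R, forall y, A y -> V y <= M -> `|y| <= L)%R -> X x ->
  forall e : R, (0 < e)%R -> exists N, forall n, (N <= n)%N -> stay A n x <= e%:E.
Proof.
move=> mA mV V0 VA VL Xx e e0.
(* Chosen so that V x / M <= e / 2; the added 1 keeps M positive when V x = 0. *)
pose M := (2 * (V x + 1) / e)%R.
have Vx0 := V0 x.
have M0 : (0 < M)%R by rewrite /M divr_gt0// mulr_gt0//; lra.
have [L HL] := VL M.
have mD : measurable (A `&` [set y | V y <= M]%R).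
  apply: measurableI => //; rewrite -[X in measurable X]setTI.
  by have := measurable_fun_ler mV (measurable_cst M); apply.
have e20 : (0 < e / 2)%R by lra.
have [|N HN] := stay_bounded mD (L := L) _ Xx e20.
  by move=> y [Ay Vy]; exact: HL.
exists N => n Nn; apply: (le_trans (stay_level_le n mA mV V0 M0 VA Xx)).
have -> : e = (e / 2 + e / 2)%R by field.
rewrite EFinD leeD ?HN// lee_fin ler_pdivrMr// /M mulrA.
rewrite (_ : _ / 2 * _ / e = V x + 1)%R; first lra.
by field; rewrite gt_eqF.
Qed.

Lemma kop_cvg0 (g : nat -> R -> \bar R) x : X x -> (forall n y, 0 <= g n y <= 1) ->
  (forall n, measurable_fun setT (g n)) ->
  (forall y, X y -> g n y @[n --> \oo] --> 0) ->
  kop (g n) x @[n --> \oo] --> 0.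
Proof.
move=> Xx g01 mg gc.
have [_ _ c] : [/\ (k x).-integrable setT (cst 0),
    [sequence \int[k x]_y `|g n y - 0|]_n @ \oo --> 0 &
    [sequence \int[k x]_y g n y]_n @ \oo --> \int[k x]_y (cst 0 y)].
  apply: (@dominated_convergence _ _ R (k x) _ _ _ _ (cst 1)) => //.
  - by apply: ae_kernel => // y Xy _; exact: gc.
  - apply/integrableP; split; first exact: measurable_cst.
    by under eq_integral do rewrite /= normr1; rewrite [ltLHS](kop_cst 1) ltry.
  - apply: aeW => y n _; have /andP[g0 g1] := g01 n y.
    by rewrite gee0_abs.
by move: c; rewrite integral0.
Qed.

Lemma iter_kop_cvg0 m (g : nat -> R -> \bar R) x : X x ->
  (forall n y, 0 <= g n y <= 1) -> (forall n, measurable_fun setT (g n)) ->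
  (forall y, X y -> g n y @[n --> \oo] --> 0) ->
  iter m kop (g n) x @[n --> \oo] --> 0.
Proof.
move=> Xx g01 mg gc; elim: m x Xx => [|m IH] x Xx /=; first exact: gc.
apply: kop_cvg0 => //; last first.
  move=> n; have [] := @measurable_iter_kop m (g n); rewrite //.
  by move=> y; have /andP[] := g01 n y.
move=> n; elim: m {IH} => [|m IH] y /=; first exact: g01.
have g0 z : 0 <= iter m kop (g n) z by have /andP[] := IH z.
rewrite kop_ge0//= -(kop_cst 1 y); apply: ge0_le_integral => //.
  have [] := @measurable_iter_kop m (g n); rewrite //.
  by move=> z; have /andP[] := g01 n z.
by move=> z _; have /andP[] := IH z.
Qed.

(** Until the chain has left a large ball the loss is counted by [stay]; from then on the mean of g
    remains at most e / 2, since g is at most e / 2 outside the ball and superharmonic on X. *)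
Lemma superharmonic_cvg0 (g : R -> R) x : X x -> measurable_fun setT g ->
  (forall y, 0 <= g y <= 1)%R ->
  (forall y, X y -> kop (EFin \o g) y <= (g y)%:E) ->
  (forall e : R, 0 < e -> exists M : R, forall y, X y -> M <= `|y| -> g y <= e)%R ->
  forall e : R, (0 < e)%R -> exists N, forall n, (N <= n)%N ->
    iter n kop (EFin \o g) x <= e%:E.
Proof.
move=> Xx mg g01 kg ginf e e0.
have g0 y : (0 <= g y)%R by have /andP[] := g01 y.
have g0' y : 0 <= (EFin \o g) y by rewrite lee_fin.
have mg' : measurable_fun setT (EFin \o g) by exact/measurable_EFinP.
have [M HM] := ginf (e / 2)%R ltac:(lra).
pose A := [set y : R | `|y| < M]%R.
have mA : measurable A.
  rewrite /A -[X in measurable X]setTI.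
  have mn : measurable_fun setT (fun y : R => `|y|%R) by exact: measurableT_comp.
  by have := measurable_fun_ltr mn (measurable_cst M); apply.
have mono n y : X y -> iter n kop (EFin \o g) y <= (g y)%:E.
  elim: n y => [|n IH] y Xy //=; apply: (le_trans _ (kg _ Xy)).
  have [h1 h2] := measurable_iter_kop n g0' mg'.
  by apply: le_kop.
have key n y : X y -> iter n kop (EFin \o g) y <= (e / 2)%:E + stay A n y.
  elim: n y => [|n IH] y Xy /=.
    rewrite /stay/=; apply: (@le_trans _ _ 1); last by rewrite leeDr// lee_fin; lra.
    by rewrite lee_fin; have /andP[] := g01 y.
  have [Ay|Ay] := pselect (A y).
    rewrite staySin//; have [h1 h2] := measurable_iter_kop n g0' mg'.
    apply: (@le_trans _ _ (kop (fun y => cst (e / 2)%:E y + stay A n y) y)).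
      apply: le_kop => //.
        by move=> z; rewrite adde_ge0 ?stay_ge0// lee_fin; lra.
      by apply: emeasurable_funD; [exact: measurable_cst|exact: measurable_stay].
    rewrite kopD ?kop_cst//.
    - by move=> z; rewrite lee_fin; lra.
    - by move=> z; exact: stay_ge0.
    - exact: measurable_stay.
  rewrite staySout// adde0; apply: (le_trans (mono n.+1 y Xy)).
  by rewrite lee_fin HM// leNgt; apply/negP.
have e20 : (0 < e / 2)%R by lra.
have [|N HN] := stay_bounded mA (L := M) _ Xx e20.
  by move=> y; rewrite /A/= => /ltW.
exists N => n Nn; apply: (le_trans (key n x Xx)).
have {2}-> : e = (e / 2 + e / 2)%R by field.
by rewrite EFinD leeD// HN.
Qed.

(** Stopped on leaving A, where it is at least 1, the function g keeps a mean of at most g x, which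
    therefore bounds the probability of having left A. *)
Lemma hit_le (A : set R) (g : R -> R) n x : X x -> measurable A ->
  measurable_fun setT g -> (forall y, 0 <= g y)%R ->
  (forall y, X y -> kop (EFin \o g) y <= (g y)%:E) ->
  (forall y, ~ A y -> 1 <= g y)%R ->
  1 <= (g x)%:E + stay A n x.
Proof.
move=> Xx mA mg g0 kg gA; elim: n x Xx => [|n IH] x Xx.
  by rewrite /stay/= leeDr// lee_fin.
have [Ax|Ax] := pselect (A x); last by rewrite staySout// adde0 lee_fin gA.
rewrite staySin// -(kop_cst 1 x).
apply: (@le_trans _ _ (kop (fun y => (EFin \o g) y + stay A n y) x)).
  apply: le_kop => //.
  - by move=> y; rewrite adde_ge0 ?stay_ge0// lee_fin.
  - by apply: emeasurable_funD; [exact/measurable_EFinP|exact: measurable_stay].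
rewrite kopD//; [by rewrite leeD2r// kg| | |exact: measurable_stay].
- by move=> y; exact: stay_ge0.
- exact/measurable_EFinP.
Qed.

(** Foster's criterion: each step spent in A before the first exit costs e of the mean of V, which
    starts at V x and remains nonnegative. *)
Lemma occupation_le (A : set R) (V : R -> R) (e : R) n x : X x -> measurable A ->
  measurable_fun setT V -> (forall y, 0 <= V y)%R -> (0 < e)%R ->
  (forall y, X y -> A y -> kop (EFin \o V) y + e%:E <= (V y)%:E) ->
  \sum_(0 <= i < n) stay A i.+1 x <= (V x / e)%:E.
Proof.
move=> Xx mA mV V0 e0 VA; elim: n x Xx => [|n IH] x Xx.
  by rewrite big_geq// lee_fin divr_ge0// ltW.
have [Ax|Ax] := pselect (A x); last first.
  by rewrite big1 ?lee_fin ?divr_ge0 ?(ltW e0)// => i _; rewrite staySout.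
rewrite big_nat_recl// staySin//.
under eq_bigr do rewrite staySin//.
have s0 i y : 0 <= stay A i y by exact: stay_ge0.
have ms i : measurable_fun setT (stay A i) by exact: measurable_stay.
have -> : kop (stay A 0) x = 1 by rewrite (kop_cst 1).
rewrite /kop -ge0_integral_sum//=.
have : \int[k x]_y (\sum_(0 <= i < n) stay A i.+1 y) <= (e^-1)%:E * kop (EFin \o V) x.
  rewrite /kop -ge0_integralZl//; last 3 first.
  - exact/measurable_EFinP.
  - by move=> y _; rewrite lee_fin.
  - by rewrite lee_fin invr_ge0 ltW.
  apply: ae_ge0_le_integral => //.
  - by move=> y _; exact: sume_ge0.
  - by apply: emeasurable_sum => i; exact: ms.
  - by move=> y _; rewrite mule_ge0 ?lee_fin// invr_ge0 ltW.
  - by apply/measurable_EFinP; apply: measurable_funM => //; exact: measurable_cst.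
  - apply: ae_kernel => // y Xy _; apply: (le_trans (IH y Xy)).
    by rewrite -EFinM mulrC.
move=> h; apply: (@le_trans _ _ (1 + (e^-1)%:E * kop (EFin \o V) x)).
  by rewrite leeD2l.
have := VA x Xx Ax.
have : 0 <= kop (EFin \o V) x by apply: kop_ge0 => y; rewrite lee_fin.
case: (kop _ x) => [r||]//= r0; rewrite -!EFinM -!EFinD !lee_fin => h'.
rewrite ler_pdivlMr// mulrDl mul1r mulrAC mulVf ?mul1r ?gt_eqF//; lra.
Qed.

(** Each step spent in A lets g gain at most e in mean, so the exit probability of [hit_le]
    increases by at most n e. With g small at x this bounds from below the time needed to leave
    A. *)
Lemma exit_slow (A : set R) (g : R -> R) (e : R) n x : X x -> measurable A ->
  measurable_fun setT g -> (forall y, 0 <= g y)%R -> (0 <= e)%R ->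
  (forall y, X y -> A y -> kop (EFin \o g) y <= (g y + e)%:E) ->
  (forall y, ~ A y -> 1 <= g y)%R ->
  1 <= (g x + n%:R * e)%:E + stay A n x.
Proof.
move=> Xx mA mg g0 e0 kg gA; elim: n x Xx => [|n IH] x Xx.
  by rewrite mul0r addr0 /stay/= leeDr// lee_fin.
have ne0 m : (0 <= m%:R * e)%R by rewrite mulr_ge0.
have [Ax|Ax] := pselect (A x); last first.
  rewrite staySout// adde0 lee_fin (le_trans (gA x Ax))// lerDl//.
rewrite staySin// -(kop_cst 1 x).
apply: (@le_trans _ _ (kop (fun y => (g y + n%:R * e)%:E + stay A n y) x)).
  apply: le_kop => //.
  - by move=> y; rewrite adde_ge0 ?stay_ge0// lee_fin addr_ge0.
  - apply: emeasurable_funD; last exact: measurable_stay.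
    by apply/measurable_EFinP; apply: measurable_funD => //; exact: measurable_cst.
rewrite kopD//; last 4 first.
- by move=> y; rewrite lee_fin addr_ge0.
- by move=> y; exact: stay_ge0.
- by apply/measurable_EFinP; apply: measurable_funD => //; exact: measurable_cst.
- exact: measurable_stay.
rewrite leeD2r//.
apply: (@le_trans _ _ (kop (fun y => (EFin \o g) y + cst (n%:R * e)%:E y) x)).
  by [].
rewrite kopD//; last 2 first.
- by move=> y; rewrite lee_fin.
- exact/measurable_EFinP.
rewrite kop_cst -natr1 mulrDl mul1r.
apply: (le_trans (leeD2r _ (kg x Xx Ax))).
by rewrite -EFinD lee_fin; lra.
Qed.

End kernel.

(** * From finite-dimensional distributions to path events *)

Section chain.
Context {R : realType} (X : set R) (k : R.-pker R ~> R)
  {d : measure_display} {T : measurableType d}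
  (P : R -> probability T R) (xi : nat -> T -> R).
Hypothesis mc : markov_chain X k P xi.
Local Open Scope ereal_scope.

Definition path_stay (A : set R) m n : set T :=
  [set w | forall i, (i < n)%N -> A (xi (m + i) w)].
Definition path_in (A : set R) m : set T := [set w | forall i, A (xi (m + i) w)].

Let mxi n : measurable_fun setT (xi n). Proof. by have [_ _ h _] := mc. Qed.

Lemma measurable_visit A n : measurable A -> measurable [set w | A (xi n w)].
Proof. by move=> mA; rewrite -[X in measurable X]setTI; exact: mxi. Qed.

Lemma path_stayE A m n :
  path_stay A m n = \bigcap_i [set w | (i < n)%N -> A (xi (m + i) w)].
Proof. by apply/seteqP; split => w /= h i; [move=> _|]; exact: h. Qed.

Lemma path_inE A m : path_in A m = \bigcap_n path_stay A m n.
Proof.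
apply/seteqP; split => w h.
  by move=> n _ i _; exact: h.
by move=> i; apply: (h i.+1 I); exact: ltnSn.
Qed.

Lemma measurable_path_stay A m n : measurable A -> measurable (path_stay A m n).
Proof.
move=> mA; rewrite path_stayE; apply: bigcapT_measurable => i.
have [i_n|i_n] := boolP (i < n)%N.
  rewrite (_ : mkset _ = [set w | A (xi (m + i) w)]); first exact: measurable_visit.
  by apply/seteqP; split => w /= h; [exact: h|move=> _].
by rewrite (_ : mkset _ = setT)//; apply/seteqP; split.
Qed.

Lemma measurable_path_in A m : measurable A -> measurable (path_in A m).
Proof.
move=> mA; rewrite path_inE; apply: bigcapT_measurable => i.
exact: measurable_path_stay.
Qed.

Lemma path_stay_prob A m n x : measurable A -> X x ->
  P x (path_stay A m n) = iter m (kop k) (stay k A n) x.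
Proof.
move=> mA Xx; rewrite -fdd_shift; have [_ _ _ <-//] := mc.
  congr (P x _); apply/seteqP; split => w h i.
    rewrite size_cat !size_nseq nth_cat size_nseq => ilt.
    case: ltnP => im; first by rewrite nth_nseq im.
    rewrite nth_nseq ltn_subLR// ilt; have := h (i - m)%N; rewrite subnKC//; apply.
    by rewrite ltn_subLR.
  move=> i_n; have := h (m + i)%N.
  rewrite size_cat !size_nseq nth_cat size_nseq (ltnNge (m + i) m) leq_addr/= addKn nth_nseq i_n.
  by apply; rewrite ltn_add2l.
move=> i; rewrite size_cat !size_nseq nth_cat size_nseq => ilt.
case: ltnP => im; first by rewrite nth_nseq im.
by rewrite nth_nseq ltn_subLR// ilt.
Qed.

Lemma path_in_cvg A m x : measurable A ->
  P x (path_stay A m n) @[n --> \oo] --> P x (path_in A m).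
Proof.
move=> mA; rewrite path_inE; apply: nonincreasing_cvg_mu.
- by rewrite (le_lt_trans (probability_le1 _ _)) ?ltry//; exact: measurable_path_stay.
- by move=> n; exact: measurable_path_stay.
- by apply: bigcapT_measurable => n; exact: measurable_path_stay.
- move=> n n' nn'; apply/subsetPset => w h i i_n.
  by apply: h; exact: leq_trans nn'.
Qed.

(** Staying in D forever contradicts (N'), and the probability of staying n steps decreases to that
    of staying forever. *)
Lemma stay_bounded_cvg0 : cond_N' X P xi ->
  forall (D : set R) (L : R), measurable D ->
  (forall y, D y -> `|y| <= L)%R -> forall x, X x ->
  forall e : R, (0 < e)%R -> exists N, forall n, (N <= n)%N -> stay k D n x <= e%:E.
Proof.
move=> hN D L mD DL x Xx e e0.
have c := @path_in_cvg D 0 x mD.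
have z : P x (path_in D 0) = 0.
  apply/(measure_negligible (measurable_path_in _ _)) => //.
  have [N [mN N0 sub]] := hN x Xx; exists N; split => //.
  apply: subset_trans sub => w Dw /= /(_ L 0%N)[n _].
  by apply/negP; rewrite -leNgt; apply: DL; exact: (Dw n).
rewrite z in c; have /fine_cvgP[_ /cvgr0Pnorm_le/(_ e e0)[N _ HN]] := c.
exists N => n Nn; have := HN n Nn; rewrite /= path_stay_prob//=.
have s0 : 0 <= stay k D n x by exact: stay_ge0.
have s1 : stay k D n x <= 1 by exact: stay_le1.
rewrite ger0_norm ?fine_ge0// -lee_fin fineK//.
by rewrite ge0_fin_numE// (le_lt_trans s1) ?ltry.
Qed.

Lemma path_in_null A m x : measurable A -> X x ->
  (forall y, X y -> forall e : R, (0 < e)%R ->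
    exists N, forall n, (N <= n)%N -> stay k A n y <= e%:E) ->
  P x (path_in A m) = 0.
Proof.
have [mX kX _ _] := mc.
move=> mA Xx h; have c := @path_in_cvg A m x mA.
have e : (fun n => P x (path_stay A m n)) = (fun n => iter m (kop k) (stay k A n) x).
  by apply/funext => n; exact: path_stay_prob.
rewrite e in c; apply: (cvg_unique _ c) => //.
apply: (iter_kop_cvg0 mX kX) => //.
- by move=> n y; rewrite stay_ge0 stay_le1.
- by move=> n; exact: measurable_stay.
move=> y Xy; apply/fine_cvgP; split.
  apply: nearW => n; rewrite ge0_fin_numE ?stay_ge0//.
  by rewrite (le_lt_trans (@stay_le1 _ _ _ _ _ mA)) ?ltry.
apply/cvgr0Pnorm_le => eps e0; have [N HN] := h y Xy eps e0.
exists N => // n Nn /=; have := HN n Nn.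
rewrite ger0_norm ?fine_ge0 ?stay_ge0// => h1.
rewrite -lee_fin fineK// ge0_fin_numE ?stay_ge0//.
by rewrite (le_lt_trans (@stay_le1 _ _ _ _ _ mA)) ?ltry.
Qed.

(** For each m, staying in A from time m on is a null event by [path_in_null]; the exceptional set
    is the union over m. *)
Lemma exits_io A x : measurable A -> X x ->
  (forall y, X y -> forall e : R, (0 < e)%R ->
    exists N, forall n, (N <= n)%N -> stay k A n y <= e%:E) ->
  {ae P x, forall w, forall N, exists2 n, (N <= n)%N & ~ A (xi n w)}.
Proof.
move=> mA Xx h; apply: (@negligibleS _ _ _ _ (\bigcup_m path_in A m)).
  move=> w /= /existsNP[N HN]; exists N => // i; apply: contrapT => nA.
  by apply: HN; exists (N + i)%N => //; exact: leq_addr.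
apply: negligible_bigcup => m.
apply/negligibleP; first exact: measurable_path_in.
exact: path_in_null.
Qed.

(** From y the chain fails to stay in A1 and fails to stay in A2 with probability at most g y, for
    every duration n. Restarted at time m, it thus remains forever in one of them up to an error of
    the mean of g (xi_m), which vanishes as m grows. *)
Lemma eventually_in (A1 A2 : set R) (g : R -> R) x : measurable A1 -> measurable A2 ->
  A1 `&` A2 = set0 -> measurable_fun setT g -> (forall y, 0 <= g y)%R ->
  (forall n y, X y -> 1 <= (g y)%:E + (stay k A1 n y + stay k A2 n y)) ->
  (forall e : R, (0 < e)%R -> exists N, forall n, (N <= n)%N ->
    iter n (kop k) (EFin \o g) x <= e%:E) -> X x ->
  {ae P x, forall w, (exists N, forall n, (N <= n)%N -> A1 (xi n w)) \/
                     (exists N, forall n, (N <= n)%N -> A2 (xi n w))}.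
Proof.
have [mX kX _ _] := mc.
move=> mA1 mA2 A12 mg g0 gA gc Xx.
have g0' y : 0 <= (EFin \o g) y by rewrite lee_fin.
have mg' : measurable_fun setT (EFin \o g) by exact/measurable_EFinP.
have it m n y : X y -> 1 <= iter m (kop k) (EFin \o g) y +
    (iter m (kop k) (stay k A1 n) y + iter m (kop k) (stay k A2 n) y).
  elim: m y => [|m IH] y Xy /=; first exact: gA.
  have [a1 a2] := measurable_iter_kop k m g0' mg'.
  have [b1 b2] := measurable_iter_kop k m (stay_ge0 k A1 n) (measurable_stay k n mA1).
  have [c1 c2] := measurable_iter_kop k m (stay_ge0 k A2 n) (measurable_stay k n mA2).
  rewrite -(kopD k y b1 c1 b2 c2) -kopD//; last 2 first.
  - by move=> z; rewrite adde_ge0.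
  - exact: emeasurable_funD.
  rewrite -(kop_cst k 1 y); apply: (le_kop mX kX) => //.
  - by move=> z; rewrite !adde_ge0.
  - by apply: emeasurable_funD => //; exact: emeasurable_funD.
pose E m := path_in A1 m `|` path_in A2 m.
have mE m : measurable (E m) by apply: measurableU; exact: measurable_path_in.
have PE (e : R) : (0 < e)%R -> exists m, 1 <= e%:E + P x (E m).
  move=> e0; have [m Hm] := gc e e0; exists m.
  have -> : P x (E m) = P x (path_in A1 m) + P x (path_in A2 m).
    rewrite /E measureU//; try exact: measurable_path_in.
    apply/seteqP; split => // w [h1 h2].
    have : (A1 `&` A2) (xi (m + 0) w) by split; [exact: (h1 0%N)|exact: (h2 0%N)].
    by rewrite A12.
  have c : e%:E + (P x (path_stay A1 m n) + P x (path_stay A2 m n)) @[n --> \oo] -->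
           e%:E + (P x (path_in A1 m) + P x (path_in A2 m)).
    apply: cvgeD; first by rewrite fin_num_adde_defr.
      exact: cvg_cst.
    apply: cvgeD; [|exact: path_in_cvg|exact: path_in_cvg].
    by rewrite fin_num_adde_defr// fin_num_measure//; exact: measurable_path_in.
  rewrite -(cvg_lim _ c)//; apply: lime_ge; first by apply/cvg_ex; eexists; exact: c.
  apply: nearW => n; rewrite !path_stay_prob//.
  by apply: (le_trans (it m n x Xx)); rewrite leeD2r// Hm.
have mU : measurable (\bigcup_m E m) by apply: bigcupT_measurable.
apply: (@negligibleS _ _ _ _ (~` (\bigcup_m E m))).
  move=> w /= h [m _ [Em|Em]]; apply: h; [left|right]; exists m => n mn;
  by rewrite -(subnKC mn); exact: Em.
apply/negligibleP; first exact: measurableC.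
transitivity (1 - P x (\bigcup_m E m)); first exact: probability_setC.
suff -> : P x (\bigcup_m E m) = 1 by rewrite subee.
apply/le_anti/andP; split; first exact: probability_le1.
apply/lee_addgt0Pr => e e0; have [m Hm] := PE e e0.
rewrite addeC; apply: (le_trans Hm); rewrite leeD2l//.
by apply: le_measure; rewrite ?inE//; exact: bigcup_sup.
Qed.

(** The time tau counts the n with tau > n, and tau > n means that the n.+1 positions xi_0, ...,
    xi_n all avoid [-a, a]. If [-a, a] is never visited, all terms are 1 and both sides are
    infinite. *)
Lemma tau_series (a : R) w :
  tau xi a w = \sum_(0 <= n <oo) (\1_(path_stay [set z | a < `|z|]%R 0 n.+1) w)%:E.
Proof.
rewrite /tau; case: pselect => [h|h].
  case: ex_minnP => m am hm.
  have E n : \1_(path_stay [set z | a < `|z|]%R 0 n.+1) w = (n < m)%:R :> R.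
    rewrite indicE; congr (nat_of_bool _)%:R; apply/idP/idP; rewrite inE.
      move=> H; rewrite ltnNge; apply/negP => mn.
      by have := H m; rewrite ltnS => /(_ mn) /=; rewrite ltNge am.
    move=> nm i; rewrite ltnS /= add0n => i_n; rewrite ltNge; apply/negP => ai.
    by have := hm i ai; rewrite leqNgt (leq_ltn_trans i_n nm).
  rewrite (nneseries_split 0 m); last by move=> n _; rewrite lee_fin.
  rewrite add0n eseries0 ?adde0; last by move=> n mn _; rewrite E ltnNge mn.
  under eq_bigr do rewrite E.
  rewrite big_mkord; under eq_bigr do rewrite ltn_ord.
  by rewrite sumEFin sumr_const card_ord.
apply/esym/eqyP => A A0; have [N _ /(_ N (leqnn N)) /= AN] := nbhs_infty_ger A.
apply: le_trans (@nneseries_lim_ge _ _ xpredT 0%N N _); last by move=> n _ _; rewrite lee_fin.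
rewrite (eq_bigr (fun=> 1%:E)); last first.
  move=> n _; rewrite indicE mem_set// => i _; rewrite /= add0n ltNge; apply/negP => ai.
  by apply: h; exists i.
by rewrite big_mkord sumEFin sumr_const card_ord lee_fin.
Qed.

Lemma expectation_tau (a : R) x : X x ->
  \int[P x]_w tau xi a w = \sum_(0 <= n <oo) stay k [set z | a < `|z|]%R n.+1 x.
Proof.
move=> Xx; have mA : measurable [set z : R | a < `|z|]%R.
  rewrite -[X in measurable X]setTI.
  have mn : measurable_fun setT (fun y : R => `|y|%R) by exact: measurableT_comp.
  by have := measurable_fun_ltr (measurable_cst a) mn; apply.
under eq_integral do rewrite tau_series.
rewrite integral_nneseries//.
- apply: eq_eseriesr => n _; rewrite integral_indic ?setIT//.
    exact: path_stay_prob.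
  exact: measurable_path_stay.
- by move=> n; apply/measurable_EFinP/measurable_indic; exact: measurable_path_stay.
Qed.

End chain.

(** * Drift estimates for one jump *)

Section drift_formula.
Context {R : realType} d (T : measurableType d) (Q : probability T R).
Notation leb := (@lebesgue_measure R).
Variables (u : T -> R) (al K : R).
Hypotheses (al1 : 1 < al) (mu_ : measurable_fun setT u).

Definition tails_le : Prop := forall s : R, 0 < s ->
  tail Q u s <= K * s `^ (- al) /\ tail Q (\- u) s <= K * s `^ (- al).
Hypothesis tK : tails_le.

Let mu_N : measurable_fun setT (\- u). Proof. exact: measurable_funN. Qed.

Lemma tail_ge0 (v : T -> R) s : 0 <= tail Q v s.
Proof. exact: fine_ge0. Qed.

Lemma tail_le1 (v : T -> R) s : measurable_fun setT v -> tail Q v s <= 1.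
Proof.
move=> mv; rewrite /tail -lee_fin fineK ?fin_num_measure//;
  try exact: measurable_set_ltr.
by apply: probability_le1; exact: measurable_set_ltr.
Qed.

Let K0 : 0 <= K.
Proof.
have [+ _] := tK ltr01; rewrite powR1 mulr1; apply: le_trans.
exact: tail_ge0.
Qed.

(** K s^-al is not integrable at 0 as al > 1; below 1/2 the trivial bound 1 takes over. *)
Lemma tail_weight (v : T -> R) s : measurable_fun setT v -> 0 < s ->
  tail Q v s <= K * s `^ (- al) -> `|tail Q v s| <= (1 + K) * weight 0 (- al) s.
Proof.
move=> mv s0 h; rewrite ger0_norm ?tail_ge0// /weight; case: ifP => _.
  by rewrite powRr0 mulr1 (le_trans (tail_le1 s mv))// lerDl.
by apply: (le_trans h); rewrite ler_wpM2r ?powR_ge0// lerDr.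
Qed.

Lemma integrable_tail :
  leb.-integrable `]0, +oo[ (EFin \o tail Q u) /\
  leb.-integrable `]0, +oo[ (EFin \o tail Q (\- u)).
Proof.
have iw : leb.-integrable `]0, +oo[ (fun s => (1 + K)%:E * (EFin \o weight 0 (- al)) s)%E.
  have := al1 => h.
  by apply: integrableZl => //; apply: integrable_weight; lra.
split.
  have [] // := @dominated_Rintegral R _ _ leb `]0, +oo[%classic (tail Q u)
    (fun s => (1 + K) * weight 0 (- al) s) (measurable_itv _) _ iw.
    by apply: measurable_funTS; exact: measurable_tail.
  move=> s; rewrite /= in_itv/= andbT => s0; apply: tail_weight => //.
  by have [] := tK s0.
have [] // := @dominated_Rintegral R _ _ leb `]0, +oo[%classic (tail Q (\- u))
  (fun s => (1 + K) * weight 0 (- al) s) (measurable_itv _) _ iw.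
  by apply: measurable_funTS; exact: measurable_tail.
move=> s; rewrite /= in_itv/= andbT => s0; apply: tail_weight => //.
by have [] := tK s0.
Qed.

Lemma integrable_rv : Q.-integrable setT (EFin \o u).
Proof.
have [i1 i2] := integrable_tail.
have di (x : R) : is_derive x 1 (fun x : R => x) 1 by exact: is_derive_id.
have cc : continuous (fun _ : R => (1 : R)) by move=> x; exact: cvg_cst.
have j1 : leb.-integrable `]0, +oo[ (EFin \o (fun s => 1 * tail Q u s)).
  by apply: eq_integrable i1 => // s _; rewrite /= mul1r.
have j2 : leb.-integrable `]0, +oo[ (EFin \o (fun s => 1 * tail Q (\- u) s)).
  by apply: eq_integrable i2 => // s _; rewrite /= mul1r.
have [h _] := @drift_identity R _ T Q u (fun x => x) (fun=> 1) 0 mu_ di cc j1 j2.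
by apply: eq_integrable h => // w _; rewrite /= add0r.
Qed.

Section formula.
Variables (F G : R -> R) (b : R).
Hypothesis dF : forall x : R, is_derive x 1 F (G x).
Hypothesis cG : continuous G.
Let Dp s := G (b + s) - G b.
Let Dn s := G (b - s) - G b.
Hypothesis ip : leb.-integrable `]0, +oo[ (EFin \o (fun s => `|Dp s| * s `^ (- al))).
Hypothesis in_ : leb.-integrable `]0, +oo[ (EFin \o (fun s => `|Dn s| * s `^ (- al))).

Let cDp : continuous Dp.
Proof.
move=> s; apply: cvgB; last exact: cvg_cst.
apply: (@continuous_comp _ _ _ (fun s : R => b + s) G); last exact: cG.
by apply: cvgD => //; exact: cvg_cst.
Qed.

Let cDn : continuous Dn.
Proof.
move=> s; apply: cvgB; last exact: cvg_cst.
apply: (@continuous_comp _ _ _ (fun s : R => b - s) G); last exact: cG.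
by apply: cvgB => //; exact: cvg_cst.
Qed.

Lemma measurable_increments : measurable_fun setT Dp /\ measurable_fun setT Dn.
Proof. by split; apply: continuous_measurable_fun. Qed.

Lemma integrable_increments :
  leb.-integrable `]0, +oo[ (EFin \o (fun s => Dp s * tail Q u s)) /\
  leb.-integrable `]0, +oo[ (EFin \o (fun s => Dn s * tail Q (\- u) s)).
Proof.
have [m1 m2] := measurable_increments.
have aux (D : R -> R) (v : T -> R) : measurable_fun setT D -> measurable_fun setT v ->
    (forall s, 0 < s -> tail Q v s <= K * s `^ (- al)) ->
    leb.-integrable `]0, +oo[ (EFin \o (fun s => `|D s| * s `^ (- al))) ->
    leb.-integrable `]0, +oo[ (EFin \o (fun s => D s * tail Q v s)).
  move=> mD mv hv iD.
  have iw : leb.-integrable `]0, +oo[ (fun s => K%:E * (EFin \o (fun s => (`|D s| * s `^ (- al))%R)) s)%E.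
    by apply: integrableZl.
  have [] // := @dominated_Rintegral R _ _ leb `]0, +oo[%classic (fun s => D s * tail Q v s)
    (fun s => K * (`|D s| * s `^ (- al))) (measurable_itv _) _ iw.
    by apply: measurable_funTS; apply: measurable_funM => //; exact: measurable_tail.
  move=> s; rewrite /= in_itv/= andbT => s0; rewrite normrM mulrCA ler_wpM2l//.
  by rewrite ger0_norm ?tail_ge0// hv.
split; apply: aux => //; by move=> s s0; have [] := tK s0.
Qed.

(** [drift_identity] for F(v) - G(b) v. Taking off the tangent makes the increments of G vanish at s
    = 0, so that they can be integrated against s^-al although al > 1, and the linear part returns
    the mean of u exactly. *)
Lemma drift_formula :
  Q.-integrable setT (EFin \o (fun w => F (b + u w))) /\
  \int[Q]_w F (b + u w) - F b - G b * \int[Q]_w u w =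
    \int[leb]_(s in `]0, +oo[) (Dp s * tail Q u s) -
    \int[leb]_(s in `]0, +oo[) (Dn s * tail Q (\- u) s).
Proof.
have [i1 i2] := integrable_increments.
have iu := integrable_rv.
pose F1 v := F v - G b * v.
have dF1 (x : R) : is_derive x 1 F1 (G x - G b).
  have d1 := is_deriveZ (G b) (is_derive_id x (1 : R)).
  have d2 := is_deriveB (dF x) d1.
  by apply: (is_derive_eq d2); rewrite /GRing.scale/= mulr1.
have cG1 : continuous (fun x => G x - G b).
  by move=> x; apply: cvgB; [exact: cG|exact: cvg_cst].
have [iF1 E1] := @drift_identity R _ T Q u F1 (fun x => G x - G b) b mu_ dF1 cG1 i1 i2.
have ic : Q.-integrable setT (EFin \o (fun=> G b * b)) by exact: finite_measure_integrable_cst.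
have iz : Q.-integrable setT (EFin \o (fun w => G b * u w)).
  by have := integrableZl measurableT (G b) iu; apply: eq_integrable.
have il : Q.-integrable setT (EFin \o (fun w => G b * b + G b * u w)).
  by have := integrableD measurableT ic iz; apply: eq_integrable.
have e w : F (b + u w) = F1 (b + u w) + (G b * b + G b * u w).
  by rewrite /F1; ring.
split.
  have := integrableD measurableT iF1 il; apply: eq_integrable => // w _.
  by rewrite /= [in RHS]e EFinD.
under eq_Rintegral do rewrite e.
have E2 : \int[Q]_w (G b * b + G b * u w) = G b * b + G b * \int[Q]_w u w.
  rewrite RintegralD// Rintegral_cst// RintegralZl//.
  by rewrite (_ : fine _ = 1) ?mulr1//; exact: (congr1 fine (probability_setT Q)).
have -> : \int[Q]_w (F1 (b + u w) + (G b * b + G b * u w)) =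
    \int[Q]_w F1 (b + u w) + \int[Q]_w (G b * b + G b * u w) by exact: RintegralD.
by rewrite E2 E1 /F1 /Dp /Dn; ring.
Qed.

End formula.
End drift_formula.

(** * Increments of the derivative of the test function *)

Section psi_bounds.
Context {R : realType}.
Notation leb := (@lebesgue_measure R).
Implicit Types (al p h s v : R).

Lemma weightM al q s : 0 < s -> weight 1 q s * s `^ (- al) = weight (1 - al) (q - al) s.
Proof.
move=> s0; rewrite /weight; case: ifP => _; rewrite -powRD//;
by rewrite (gt_eqF s0) implybT.
Qed.

Lemma psi_abs_le4 p h v : `|p| <= 2^-1 -> 2^-1 <= `|v| -> `|psi p h v| <= 4.
Proof.
rewrite ler_norml => /andP[p1 p2] v2.
have v0 : 0 < `|v| by apply: lt_le_trans v2.
apply: (le_trans (psi_abs_le _ _ _)); [lra|by rewrite -normr_gt0|].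
apply: (@le_trans _ _ (2^-1 `^ (p - 1))); first by apply: le_powR_nonpos; lra.
apply: (@le_trans _ _ (2^-1 `^ (- 2))).
  by apply: ger_powR; [apply/andP; split|]; lra.
rewrite powRN powR_mulrn// exprVn invrK expr2; lra.
Qed.

Lemma psi1_le1 p h : p <= 2 -> `|psi p h 1| <= 1.
Proof.
move=> p2; apply: (le_trans (psi_abs_le _ p2 _)); first exact: oner_neq0.
by rewrite normr1 powR1.
Qed.

Lemma psi_incr_le p h s : `|p| <= 2^-1 -> 0 < h -> 0 < s ->
  `|psi p h (1 + s) - psi p h 1| <= 28 * weight 1 0 s.
Proof.
move=> ph h0 s0; have := ph; rewrite ler_norml => /andP[p1 p2].
rewrite /weight; case: ltP => s12.
  have := @psi_lipschitz R p h (1 + s) 1 _ h0.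
  rewrite (_ : 1 + s - 1 = s); last by ring.
  rewrite powRr1 ?(ltW s0)// gtr0_norm// => /(_ _ _ _) H.
  apply: (@le_trans _ _ (Kpsi p * s)); first by apply: H; lra.
  by rewrite ler_wpM2r ?(ltW s0)// Kpsi_le.
rewrite powRr0; apply: (le_trans (ler_normB _ _)).
have h1 : `|psi p h (1 + s)| <= 4.
  by apply: psi_abs_le4 => //; rewrite ger0_norm; lra.
have h2 : `|psi p h 1| <= 1 by apply: psi1_le1; lra.
by move: h1 h2; move: `|_| `|_| => x y; lra.
Qed.

(* For s near 1 the derivative p * psi p h (1 - s) is not bounded uniformly in h;
   its integral there is, being the variation of phi p h over [-1/2, 1/2]. *)
Definition gvar p h s : R := `|p * psi p h (1 - s)| *
  (if 2^-1 < s then if s < 3 / 2 then 1 else 0 else 0).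

Lemma gvar_ge0 p h s : 0 <= gvar p h s.
Proof. by rewrite /gvar mulr_ge0//; case: ifP => // _; case: ifP. Qed.

Lemma psi_decr_le p h s : `|p| <= 2^-1 -> 0 < h -> 0 < s ->
  `|p * (psi p h (1 - s) - psi p h 1)| <= `|p| * 28 * weight 1 0 s + gvar p h s.
Proof.
move=> ph h0 s0; have := ph; rewrite ler_norml => /andP[p1 p2].
rewrite /weight /gvar; case: ltP => s12.
  have := @psi_lipschitz R p h (1 - s) 1 _ h0.
  rewrite (_ : 1 - s - 1 = - s); last by ring.
  rewrite normrN powRr1 ?(ltW s0)// (gtr0_norm s0) => /(_ _ _ _) H.
  rewrite normrM -mulrA -[leLHS]addr0 lerD ?mulr_ge0//; last by case: ifP => // _; case: ifP.
  rewrite ler_wpM2l//.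
  apply: (@le_trans _ _ (Kpsi p * s)); first by apply: H; lra.
  by rewrite ler_wpM2r ?(ltW s0)// Kpsi_le.
have h2 : `|psi p h 1| <= 1 by apply: psi1_le1; lra.
have h3 := ler_normB (psi p h (1 - s)) (psi p h 1).
have P0 := normr_ge0 p.
rewrite powRr0 mulr1 2!normrM.
have big : 2^-1 <= `|1 - s| -> `|p| * `|psi p h (1 - s) - psi p h 1| <= `|p| * 28.
  move=> /(psi_abs_le4 h ph) h1; rewrite ler_wpM2l//; apply: (le_trans h3).
  by move: h1 h2; move: `|_| `|_| => x y; lra.
case: ifP => [s1|s1]; last first.
  rewrite mulr0 addr0; apply: big.
  by rewrite ger0_norm; move/negbT: s1; rewrite -leNgt; lra.
case: ltP => s3; last first.
  by rewrite mulr0 addr0; apply: big; rewrite ler0_norm; lra.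
rewrite mulr1 -mulrDr ler_wpM2l//; apply: (le_trans h3).
by move: h2; move: `|psi p h 1| `|_| => x y; lra.
Qed.

Lemma measurable_gvar p h : 0 < h -> measurable_fun setT (gvar p h).
Proof.
move=> h0; apply: measurable_funM.
  apply: measurableT_comp => //; apply: measurable_funM; first exact: measurable_cst.
  have mp : measurable_fun setT (psi p h).
    by apply: continuous_measurable_fun; exact: continuous_psi.
  apply: measurableT_comp => //.
  by apply: measurable_funB => //; exact: measurable_cst.
apply: measurable_fun_ifT; last exact: measurable_cst.
  by apply: measurable_fun_ltr => //; exact: measurable_cst.
apply: measurable_fun_ifT; last exact: measurable_cst.
  by apply: measurable_fun_ltr => //; exact: measurable_cst.
exact: measurable_cst.
Qed.

(** For p >= 0 the value at 1/2 is at most 2; for p < 0 the function is largest at 0, where it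
    equals h^p. With h = 1/r this is the r^-p that later has to be compensated. *)
Lemma phi_half_diff_le p h : `|p| <= 2^-1 -> 0 < h -> h <= 1 ->
  `|phi p h 2^-1 - phi p h 0| <= 2 + h `^ p.
Proof.
move=> ph h0 h1.
have e0 : phi p h 0 = h `^ p by rewrite /phi expr0n/= addr0 powR_sqr gtr0_norm.
have hp0 := powR_ge0 h p.
have f0 := phi_ge0 p h 2^-1.
have : phi p h 2^-1 <= 2 + h `^ p.
  have [p0|p0] := leP 0 p.
    apply: (@le_trans _ _ 2); last by rewrite lerDl.
    rewrite /phi; apply: (@le_trans _ _ (2 `^ (p / 2))).
      apply: ge0_ler_powR; rewrite ?nnegrE; try lra.
        by rewrite addr_ge0 ?sqr_ge0.
      have : h ^+ 2 <= 1 by rewrite expr_le1// ltW.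
      by rewrite (expr2 2^-1); lra.
    apply: (@le_trans _ _ (2 `^ 1)); last by rewrite powRr1.
    by move: ph; rewrite ler_norml => /andP[_ p2]; apply: ler_powR; lra.
  rewrite -[leLHS]add0r lerD//.
  rewrite -e0 /phi; apply: le_powR_nonpos; first lra.
    by rewrite expr0n/= addr0 exprn_gt0.
  by rewrite lerD2l expr0n/= sqr_ge0.
by rewrite e0 => f1; rewrite ler_norml; apply/andP; split; lra.
Qed.

Lemma Rintegral_psi_half p h : p != 0 -> 0 < h ->
  leb.-integrable `]2^-1, 1[ (EFin \o (fun s => psi p h (1 - s))) /\
  \int[leb]_(s in `]2^-1, 1[) psi p h (1 - s) = (phi p h 2^-1 - phi p h 0) / p.
Proof.
move=> p0 h0.
have cg : continuous (fun s => psi p h (1 - s)).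
  move=> s; apply: (@continuous_comp _ _ _ (fun s : R => 1 - s) (psi p h)); last exact: continuous_psi.
  by apply: cvgB => //; exact: cvg_cst.
have dg s : is_derive s 1 (fun s : R => (- p^-1) * phi p h (1 - s)) (psi p h (1 - s)).
  have d2 : is_derive s 1 (fun s : R => 1 - s) (-1) by apply: is_derive_eq; ring.
  have d4 := @is_derive1_comp _ (phi p h) (fun s => 1 - s) s _ _ (is_derive_phi p _ h0) d2.
  have d5 := is_deriveZ (- p^-1) d4.
  by apply: (is_derive_eq d5); rewrite /GRing.scale/=; field.
have h12 : 2^-1 <= 1 :> R by lra.
have [ig Eg] := continuous_FTC2_oo h12 dg cg.
split; first exact: ig.
rewrite Eg subrr (_ : 1 - 2^-1 = 2^-1); last by lra.
by field.
Qed.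

Lemma Rintegral_psi_half' p h : p != 0 -> 0 < h ->
  leb.-integrable `]1, 3 / 2[ (EFin \o (fun s => psi p h (1 - s))) /\
  \int[leb]_(s in `]1, 3 / 2[) psi p h (1 - s) = - ((phi p h 2^-1 - phi p h 0) / p).
Proof.
move=> p0 h0.
have cg : continuous (fun s => psi p h (1 - s)).
  move=> s; apply: (@continuous_comp _ _ _ (fun s : R => 1 - s) (psi p h)); last exact: continuous_psi.
  by apply: cvgB => //; exact: cvg_cst.
have dg s : is_derive s 1 (fun s : R => (- p^-1) * phi p h (1 - s)) (psi p h (1 - s)).
  have d2 : is_derive s 1 (fun s : R => 1 - s) (-1) by apply: is_derive_eq; ring.
  have d4 := @is_derive1_comp _ (phi p h) (fun s => 1 - s) s _ _ (is_derive_phi p _ h0) d2.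
  have d5 := is_deriveZ (- p^-1) d4.
  by apply: (is_derive_eq d5); rewrite /GRing.scale/=; field.
have h12 : 1 <= 3 / 2 :> R by lra.
have [ig Eg] := continuous_FTC2_oo h12 dg cg.
split; first exact: ig.
rewrite Eg subrr (_ : 1 - 3 / 2 = - 2^-1) ?phiN; last by lra.
by field.
Qed.

Lemma gvar_out p h s : s <= 2^-1 \/ 3 / 2 <= s -> gvar p h s = 0.
Proof.
by rewrite /gvar => -[s1|s1]; [rewrite ltNge s1|rewrite (ltNge s) s1/= if_same]; rewrite mulr0.
Qed.

Lemma psi_ge0 p h v : 0 <= v -> 0 <= psi p h v.
Proof. by move=> v0; rewrite mulr_ge0 ?powR_ge0. Qed.

Lemma Rintegral_gvar p h : `|p| <= 2^-1 -> p != 0 -> 0 < h -> h <= 1 ->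
  leb.-integrable `]0, +oo[ (EFin \o gvar p h) /\
  \int[leb]_(s in `]0, +oo[) gvar p h s <= 2 * (2 + h `^ p).
Proof.
move=> ph p0 h0 h1.
have [i1 E1] := Rintegral_psi_half p0 h0.
have [i2 E2] := Rintegral_psi_half' p0 h0.
have mg := @measurable_gvar p h h0.
have g1 s : s \in `]2^-1, 1[%classic -> gvar p h s = `|p| * psi p h (1 - s).
  rewrite inE/= in_itv/= => /andP[s1 s2].
  rewrite /gvar s1 (_ : s < 3 / 2) ?mulr1; last lra.
  by rewrite normrM (@ger0_norm _ (psi _ _ _))// psi_ge0//; lra.
have g2 s : s \in `]1, 3 / 2[%classic -> gvar p h s = - `|p| * psi p h (1 - s).
  rewrite inE/= in_itv/= => /andP[s1 s2].
  rewrite /gvar s2 (_ : 2^-1 < s) ?mulr1; last lra.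
  rewrite normrM -opprB psiN normrN (@ger0_norm _ (psi _ _ _)) ?psi_ge0//; last lra.
  by rewrite mulNr mulrN opprK.
have g0 (D : interval R) : (forall s, s \in D -> s <= 2^-1 \/ 3 / 2 <= s) ->
    leb.-integrable [set` D] (EFin \o gvar p h) /\ \int[leb]_(s in [set` D]) gvar p h s = 0.
  move=> hD; split.
    apply: (@eq_integrable _ _ _ _ _ _ (cst 0%E)) => //; last exact: integrable0.
    by move=> s; rewrite inE/= => /hD Ds; rewrite gvar_out.
  rewrite /Rintegral (_ : (\int[_]_(s in _) _)%E = 0%E)//.
  by apply: integral0_eq => s /= /hD Ds; rewrite gvar_out.
have j1 : leb.-integrable `]2^-1, 1[ (EFin \o gvar p h).
  have : leb.-integrable `]2^-1, 1[ (fun s => (`|p|)%:E * (EFin \o (fun s => psi p h (1 - s))) s)%E.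
    exact: integrableZl.
  by apply: eq_integrable => // s hs; rewrite /= (g1 _ hs) EFinM.
have j2 : leb.-integrable `]1, 3 / 2[ (EFin \o gvar p h).
  have : leb.-integrable `]1, 3 / 2[ (fun s => (- `|p|)%:E * (EFin \o (fun s => psi p h (1 - s))) s)%E.
    exact: integrableZl.
  by apply: eq_integrable => // s hs; rewrite /= (g2 _ hs) EFinM.
have [k0 e0] : leb.-integrable `]0, 2^-1[ (EFin \o gvar p h) /\
    \int[leb]_(s in `]0, 2^-1[) gvar p h s = 0.
  by apply: g0 => s; rewrite in_itv/= => /andP[_ /ltW]; left.
have [k3 e3] : leb.-integrable `]3 / 2, +oo[ (EFin \o gvar p h) /\
    \int[leb]_(s in `]3 / 2, +oo[) gvar p h s = 0.
  by apply: g0 => s; rewrite in_itv/= andbT => /ltW; right.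
have l12 : 2^-1 < 1 :> R by lra.
have l23 : 1 < 3 / 2 :> R by lra.
have l01 : 0 < 2^-1 :> R by lra.
have k2 := @integrable_split R 1 (3 / 2) +oo%O (gvar p h) l23 erefl mg j2 k3.
have k1 := @integrable_split R 2^-1 1 +oo%O (gvar p h) l12 erefl mg j1 k2.
have kk := @integrable_split R 0 2^-1 +oo%O (gvar p h) l01 erefl mg k0 k1.
split; first exact: kk.
rewrite (@Rintegral_split R 0 2^-1)// e0 add0r (@Rintegral_split R 2^-1 1)//.
rewrite (@Rintegral_split R 1 (3 / 2))// e3 addr0.
have -> : \int[leb]_(s in `]2^-1, 1[) gvar p h s = `|p| * ((phi p h 2^-1 - phi p h 0) / p).
  by rewrite -E1 -RintegralZl//; apply: eq_Rintegral => s hs; exact: g1.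
have -> : \int[leb]_(s in `]1, 3 / 2[) gvar p h s = `|p| * ((phi p h 2^-1 - phi p h 0) / p).
  rewrite -[_ / p]opprK -E2 mulrN -mulNr -RintegralZl//.
  by apply: eq_Rintegral => s hs; exact: g2.
rewrite -[leLHS]mulr2n -[leLHS]mulr_natl ler_pM2l//.
apply: le_trans (phi_half_diff_le ph h0 h1).
apply: (le_trans (ler_norm _)); rewrite normrM normr_id normrM normfV.
by rewrite mulrCA divff ?mulr1// normr_eq0.
Qed.

End psi_bounds.

(** * General drift estimates *)

Section drift_bounds.
Context {R : realType}.
Notation leb := (@lebesgue_measure R).

Definition Cweight (al q : R) : R :=
  \int[leb]_(s in `]0, +oo[) weight (1 - al) (q - al) s.

Lemma Cweight_ge0 al q : 0 <= Cweight al q.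
Proof. by apply: Rintegral_ge0 => s _; exact: weight_ge0. Qed.

Lemma powRN_half_le4 (al s : R) : 1 < al -> al < 2 -> 2^-1 < s -> s `^ (- al) <= 4.
Proof.
move=> al1 al2 s1.
apply: (@le_trans _ _ (2^-1 `^ (- al))); first by apply: le_powR_nonpos; lra.
apply: (@le_trans _ _ (2^-1 `^ (- 2))).
  by apply: ger_powR; [apply/andP; split|]; lra.
by rewrite powRN powR_mulrn// exprVn invrK expr2; lra.
Qed.

Lemma weight10_le1 (s : R) : 0 <= s -> weight 1 0 s <= 1.
Proof. by move=> s0; rewrite /weight; case: ltP => s1; rewrite ?powRr0// powRr1; lra. Qed.

(** The irregular part g vanishes up to 1/2, beyond which s^-al <= 4, so only its integral
    enters. *)
Lemma integrable_incr (al A q : R) (D g : R -> R) : 1 < al -> al < 2 -> q < al - 1 ->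
  measurable_fun setT D -> measurable_fun setT g ->
  leb.-integrable `]0, +oo[ (EFin \o g) ->
  (forall s, s <= 2^-1 -> g s = 0) -> (forall s, 0 <= g s) ->
  (forall s, 0 < s -> `|D s| <= A * weight 1 q s + g s) ->
  leb.-integrable `]0, +oo[ (EFin \o (fun s => `|D s| * s `^ (- al))) /\
  \int[leb]_(s in `]0, +oo[) (`|D s| * s `^ (- al)) <=
    A * Cweight al q + 4 * \int[leb]_(s in `]0, +oo[) g s.
Proof.
move=> al1 al2 qal mD mg ig gz g0 hD.
have iw : leb.-integrable `]0, +oo[ (EFin \o weight (1 - al) (q - al)).
  by apply: integrable_weight; lra.
have iAw : leb.-integrable `]0, +oo[ (EFin \o (fun s => A * weight (1 - al) (q - al) s)).
  by have := @integrableZl _ _ _ leb `]0, +oo[%classic (measurable_itv _) A _ iw; apply: eq_integrable.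
have i4g : leb.-integrable `]0, +oo[ (EFin \o (fun s => 4 * g s)).
  by have := @integrableZl _ _ _ leb `]0, +oo[%classic (measurable_itv _) 4 _ ig; apply: eq_integrable.
have ib : leb.-integrable `]0, +oo[
    (EFin \o (fun s => A * weight (1 - al) (q - al) s + 4 * g s)).
  by have := @integrableD _ _ _ leb `]0, +oo[%classic (measurable_itv _) _ _ iAw i4g; apply: eq_integrable.
have key s : 0 < s -> `| `|D s| * s `^ (- al)| <=
    A * weight (1 - al) (q - al) s + 4 * g s.
  move=> s0; have q0 := powR_ge0 s (- al).
  rewrite ger0_norm ?mulr_ge0//.
  apply: (@le_trans _ _ ((A * weight 1 q s + g s) * s `^ (- al))).
    by rewrite ler_wpM2r// hD.
  rewrite mulrDl -mulrA weightM// lerD2l.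
  have [s1|s1] := leP s 2^-1; first by rewrite gz// mul0r mulr0.
  rewrite mulrC ler_wpM2r//.
  exact: powRN_half_le4.
have key' s : `]0, +oo[%classic s -> `| `|D s| * s `^ (- al)| <=
    A * weight (1 - al) (q - al) s + 4 * g s.
  by rewrite /= in_itv/= andbT; exact: key.
have mDs : measurable_fun setT (fun s => `|D s| * s `^ (- al)).
  by apply: measurable_funM; [exact: measurableT_comp|exact: measurable_powR].
have [i1 e1] := @dominated_Rintegral R _ _ leb `]0, +oo[%classic
   (fun s => `|D s| * s `^ (- al)) (fun s => A * weight (1 - al) (q - al) s + 4 * g s)
   (measurable_itv _) (measurable_funTS mDs) ib key'.
split; first exact: i1.
apply: (le_trans (ler_norm _)); apply: (le_trans e1).
rewrite RintegralD// RintegralZl// RintegralZl//.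
Qed.

Section bounds.
Context d (T : measurableType d) (Q : probability T R) (u : T -> R) (al K : R).
Hypotheses (al1 : 1 < al) (al2 : al < 2).
Hypothesis mu_ : measurable_fun setT u.
Hypothesis tK : tails_le Q u al K.

Let mu_N : measurable_fun setT (\- u). Proof. exact: measurable_funN. Qed.

Lemma tails_le_ge0 : 0 <= K.
Proof.
have [+ _] := tK ltr01; rewrite powR1 mulr1; apply: le_trans.
exact: tail_ge0.
Qed.

Lemma Rintegral_tail_le (D : R -> R) (v : T -> R) : measurable_fun setT D ->
  measurable_fun setT v -> (forall s, 0 < s -> tail Q v s <= K * s `^ (- al)) ->
  leb.-integrable `]0, +oo[ (EFin \o (fun s => `|D s| * s `^ (- al))) ->
  `|\int[leb]_(s in `]0, +oo[) (D s * tail Q v s)| <=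
    K * \int[leb]_(s in `]0, +oo[) (`|D s| * s `^ (- al)).
Proof.
move=> mD mv hv iD; have K0 := tails_le_ge0.
have iKD : leb.-integrable `]0, +oo[ (EFin \o (fun s => K * (`|D s| * s `^ (- al)))).
  by have := @integrableZl _ _ _ leb `]0, +oo[%classic (measurable_itv _) K _ iD; apply: eq_integrable.
have mDt : measurable_fun setT (fun s => D s * tail Q v s).
  by apply: measurable_funM => //; exact: measurable_tail.
have key s : `]0, +oo[%classic s -> `|D s * tail Q v s| <= K * (`|D s| * s `^ (- al)).
  rewrite /= in_itv/= andbT => s0; rewrite normrM mulrCA ler_wpM2l//.
  by rewrite ger0_norm ?tail_ge0// hv.
have [_ ] := @dominated_Rintegral R _ _ leb `]0, +oo[%classic
   _ _ (measurable_itv _) (measurable_funTS mDt) iKD key.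
by rewrite RintegralZl.
Qed.

Lemma drift_crude (F G : R -> R) (b A q : R) (g : R -> R) :
  (forall x : R, is_derive x 1 F (G x)) -> continuous G -> q < al - 1 ->
  measurable_fun setT g -> leb.-integrable `]0, +oo[ (EFin \o g) ->
  (forall s, s <= 2^-1 -> g s = 0) -> (forall s, 0 <= g s) ->
  (forall s, 0 < s -> `|G (b + s) - G b| <= A * weight 1 q s + g s) ->
  (forall s, 0 < s -> `|G (b - s) - G b| <= A * weight 1 q s + g s) ->
  Q.-integrable setT (EFin \o (fun w => F (b + u w))) /\
  `|\int[Q]_w F (b + u w) - F b - G b * \int[Q]_w u w| <=
    2 * K * (A * Cweight al q + 4 * \int[leb]_(s in `]0, +oo[) g s).
Proof.
move=> dF cG qal mg ig gz g0 hp hn; have K0 := tails_le_ge0.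
have [m1 m2] := @measurable_increments R G b cG.
have [i1 e1] := integrable_incr al1 al2 qal m1 mg ig gz g0 hp.
have [i2 e2] := integrable_incr al1 al2 qal m2 mg ig gz g0 hn.
have [iF ->] := drift_formula al1 mu_ tK dF cG i1 i2.
split => //; apply: (le_trans (ler_normB _ _)).
rewrite -mulrA mulr2n mulrDl mul1r; apply: lerD.
  apply: (le_trans (Rintegral_tail_le m1 mu_ _ i1)); last by rewrite ler_wpM2l.
  by move=> s s0; have [] := tK s0.
apply: (le_trans (Rintegral_tail_le m2 mu_N _ i2)); last by rewrite ler_wpM2l.
by move=> s s0; have [] := tK s0.
Qed.

(** If both tails were c' s^-al, the two integrals of [drift_formula] would combine to c' p [Jint],
    the values of G at 1 cancelling. Below s0 the tails are only bounded, but the increments are of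
    order s, which leaves s0^(2-al); beyond s0 the relative error e is multiplied by the increments
    and by the variation of [phi] near 0. *)
Lemma drift_precise (p h c' e s0 : R) : `|p| <= 2^-1 -> p != 0 -> 0 < h -> h <= 1 ->
  0 < s0 -> s0 <= 2^-1 -> 0 <= c' -> 0 <= e ->
  (forall s, s0 <= s -> `|tail Q u s - c' * s `^ (- al)| <= e * s `^ (- al) /\
     `|tail Q (\- u) s - c' * s `^ (- al)| <= e * s `^ (- al)) ->
  Q.-integrable setT (EFin \o (fun w => phi p h (1 + u w))) /\
  `|\int[Q]_w phi p h (1 + u w) - phi p h 1 - p * psi p h 1 * \int[Q]_w u w -
    c' * (p * Jint al p h)| <=
  2 * (`|p| * 28 * (K + c') * (s0 `^ (2 - al) / (2 - al)) +
    e * (`|p| * 28 * (s0 `^ (1 - al) / (al - 1)) + 8 * (2 + h `^ p))).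
Proof.
have [h1 h2] := (al1, al2).
have l1 : -1 < 1 - al by lra.
have l2 : - al < -1 by lra.
have q0 : 0 < al - 1 by lra.
have ea : - (- al + 1) = al - 1 by ring.
have eb : - al + 1 = 1 - al by ring.
have ec : 1 - al + 1 = 2 - al by ring.
have sal s : 2^-1 < s -> s `^ (- al) <= 4 by exact: powRN_half_le4.
move=> ph p0 h0 h1' s00 s01 c0 e0 hs; have K0 := tails_le_ge0.
pose G v := p * psi p h v.
have cG : continuous G.
  by move=> x; apply: cvgMr; exact: continuous_psi.
have [m1 m2] := @measurable_increments R G 1 cG.
have [ig eg] := Rintegral_gvar ph p0 h0 h1'.
have mg := @measurable_gvar R p h h0.
have gz s : s <= 2^-1 -> gvar p h s = 0 by move=> ?; apply: gvar_out; left.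
have hp s : 0 < s -> `|G (1 + s) - G 1| <= `|p| * 28 * weight 1 0 s + gvar p h s.
  move=> sp; rewrite /G -mulrBr normrM -mulrA -[leLHS]addr0 lerD ?gvar_ge0//.
  by rewrite ler_wpM2l// psi_incr_le.
have hn s : 0 < s -> `|G (1 - s) - G 1| <= `|p| * 28 * weight 1 0 s + gvar p h s.
  by move=> sp; rewrite /G -mulrBr psi_decr_le.
have [i1 e1] := integrable_incr al1 al2 q0 m1 mg ig gz (@gvar_ge0 R p h) hp.
have [i2 e2] := integrable_incr al1 al2 q0 m2 mg ig gz (@gvar_ge0 R p h) hn.
have [iF ->] := drift_formula al1 mu_ tK (fun x => is_derive_phi p x h0) cG i1 i2.
split; first exact: iF.
have [j1 j2] := integrable_increments mu_ tK cG i1 i2.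
have [ik _] := integrable_kern al1 al2 ph p0 h0.
pose Bd s := if s < s0 then `|p| * 28 * (K + c') * s `^ (1 - al) else
   e * (`|p| * 28 * s `^ (- al) + 4 * gvar p h s).
have mBd : measurable_fun setT Bd.
  apply: measurable_fun_ifT.
  - by apply: measurable_fun_ltr => //; exact: measurable_cst.
  - by apply: measurable_funM; [exact: measurable_cst|exact: measurable_powR].
  - apply: measurable_funM; first exact: measurable_cst.
    apply: measurable_funD; apply: measurable_funM; try exact: measurable_cst; try exact: mg.
    exact: measurable_powR.
pose f1 s := `|p| * 28 * (K + c') * s `^ (1 - al).
pose f2 s := e * (`|p| * 28 * s `^ (- al) + 4 * gvar p h s).
have ip1 := @integrable_powR_0 R _ _ l1 s00.
have ip2 := @integrable_powR_y R _ _ l2 s00.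
have igs : leb.-integrable `]s0, +oo[ (EFin \o gvar p h).
  apply: integrableS ig => //; apply: subset_itvr; by rewrite bnd_simp ltW.
have if1 : leb.-integrable `]0, s0[ (EFin \o f1).
  by have := @integrableZl _ _ _ leb _ (measurable_itv _) (`|p| * 28 * (K + c')) _ ip1; apply: eq_integrable.
have if2a : leb.-integrable `]s0, +oo[ (EFin \o (fun s => `|p| * 28 * s `^ (- al))).
  by have := @integrableZl _ _ _ leb _ (measurable_itv _) (`|p| * 28) _ ip2; apply: eq_integrable.
have if2b : leb.-integrable `]s0, +oo[ (EFin \o (fun s => 4 * gvar p h s)).
  by have := @integrableZl _ _ _ leb _ (measurable_itv _) 4 _ igs; apply: eq_integrable.
have if2c : leb.-integrable `]s0, +oo[ (EFin \o (fun s => `|p| * 28 * s `^ (- al) + 4 * gvar p h s)).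
  by have := @integrableD _ _ _ leb _ (measurable_itv _) _ _ if2a if2b; apply: eq_integrable.
have if2 : leb.-integrable `]s0, +oo[ (EFin \o f2).
  by have := @integrableZl _ _ _ leb _ (measurable_itv _) e _ if2c; apply: eq_integrable.
have B1 : {in `]0, s0[%classic, f1 =1 Bd}.
  by move=> s; rewrite inE/= in_itv/= => /andP[_ ss]; rewrite /Bd ss.
have B2 : {in `]s0, +oo[%classic, f2 =1 Bd}.
  by move=> s; rewrite inE/= in_itv/= andbT => ss; rewrite /Bd ltNge (ltW ss).
have iB1 : leb.-integrable `]0, s0[ (EFin \o Bd).
  by apply: eq_integrable if1 => // s hs'; rewrite /= B1.
have iB2 : leb.-integrable `]s0, +oo[ (EFin \o Bd).
  by apply: eq_integrable if2 => // s hs'; rewrite /= B2.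
have iBd := @integrable_split R 0 s0 +oo%O Bd s00 erefl mBd iB1 iB2.
have EBd : \int[leb]_(s in `]0, +oo[) Bd s <=
    `|p| * 28 * (K + c') * (s0 `^ (2 - al) / (2 - al)) +
    e * (`|p| * 28 * (s0 `^ (1 - al) / (al - 1)) + 8 * (2 + h `^ p)).
  rewrite (@Rintegral_split R 0 s0)//.
  have <- : \int[leb]_(s in `]0, s0[) f1 s = \int[leb]_(s in `]0, s0[) Bd s.
    exact: eq_Rintegral.
  have <- : \int[leb]_(s in `]s0, +oo[) f2 s = \int[leb]_(s in `]s0, +oo[) Bd s.
    exact: eq_Rintegral.
  rewrite /f1 /f2 RintegralZl// RintegralZl// RintegralD// RintegralZl// RintegralZl//.
  have -> : \int[leb]_(s in `]0, s0[) s `^ (1 - al) = s0 `^ (2 - al) / (2 - al).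
    by rewrite /Rintegral integral_powR_0//= ec.
  have -> : \int[leb]_(s in `]s0, +oo[) s `^ (- al) = s0 `^ (1 - al) / (al - 1).
    by rewrite /Rintegral integral_powR_y//= -mulrN -invrN ea eb.
  rewrite lerD2l ler_wpM2l// lerD2l.
  have -> : 8 * (2 + h `^ p) = 4 * (2 * (2 + h `^ p)) by rewrite mulrA -natrM.
  rewrite ler_wpM2l//.
    apply: le_trans eg; rewrite (@Rintegral_split R 0 s0 +oo%O)// lerDr.
    by apply: Rintegral_ge0 => s _; exact: gvar_ge0.
have dom (D : R -> R) (v : T -> R) s : measurable_fun setT v -> 0 < s ->
    tail Q v s <= K * s `^ (- al) ->
    (s0 <= s -> `|tail Q v s - c' * s `^ (- al)| <= e * s `^ (- al)) ->
    `|D s| <= `|p| * 28 * weight 1 0 s + gvar p h s ->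
    `|D s * (tail Q v s - c' * s `^ (- al))| <= Bd s.
  move=> mv sp tv hv hD; have sal0 := powR_ge0 s (- al).
  rewrite normrM /Bd; case: ltP => ss.
    have tD : `|tail Q v s - c' * s `^ (- al)| <= (K + c') * s `^ (- al).
      apply: (le_trans (ler_normB _ _)); rewrite ger0_norm ?tail_ge0//.
      by rewrite ger0_norm ?mulr_ge0// mulrDl lerD2r.
    apply: (le_trans (ler_pM _ _ hD tD)) => //.
    have s12 : s < 2^-1 := lt_le_trans ss s01.
    rewrite gz ?addr0 ?(ltW s12)// /weight s12 powRr1 ?(ltW sp)//.
    rewrite (_ : s `^ (1 - al) = s * s `^ (- al)); last first.
      by rewrite powRD ?powRr1 ?(gt_eqF sp) ?implybT// ltW.
    by rewrite le_eqVlt; apply/orP; left; apply/eqP; ring.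
  apply: (le_trans (ler_pM _ _ hD (hv ss))) => //.
  rewrite mulrCA ler_wpM2l// mulrDl; apply: lerD.
    rewrite ler_wpM2r// -[leRHS]mulr1 ler_wpM2l ?mulr_ge0//.
    by rewrite weight10_le1// ltW.
  have [s1|s1] := leP s 2^-1; first by rewrite gz// mul0r mulr0.
  by rewrite mulrC ler_wpM2r ?gvar_ge0// sal.
have int_dom (D : R -> R) (v : T -> R) : measurable_fun setT D -> measurable_fun setT v ->
    (forall s, 0 < s -> tail Q v s <= K * s `^ (- al)) ->
    (forall s, s0 <= s -> `|tail Q v s - c' * s `^ (- al)| <= e * s `^ (- al)) ->
    (forall s, 0 < s -> `|D s| <= `|p| * 28 * weight 1 0 s + gvar p h s) ->
    leb.-integrable `]0, +oo[ (EFin \o (fun s => D s * (tail Q v s - c' * s `^ (- al)))) /\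
    `|\int[leb]_(s in `]0, +oo[) (D s * (tail Q v s - c' * s `^ (- al)))| <=
    \int[leb]_(s in `]0, +oo[) Bd s.
  move=> mD mv tv hv hD.
  have mDv : measurable_fun setT (fun s => D s * (tail Q v s - c' * s `^ (- al))).
    apply: measurable_funM => //; apply: measurable_funB; first exact: measurable_tail.
    by apply: measurable_funM; [exact: measurable_cst|exact: measurable_powR].
  have key s : `]0, +oo[%classic s -> `|D s * (tail Q v s - c' * s `^ (- al))| <= Bd s.
    rewrite /= in_itv/= andbT => sp; apply: dom => //; [exact: tv|exact: hv|exact: hD].
  exact: (@dominated_Rintegral R _ _ leb `]0, +oo[%classic
     _ _ (measurable_itv _) (measurable_funTS mDv) iBd key).
have [a1 b1] := int_dom _ u m1 mu_ (fun s sp => (tK sp).1) (fun s ss => (hs s ss).1) hp.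
have [a2 b2] := int_dom _ (\- u) m2 mu_N (fun s sp => (tK sp).2) (fun s ss => (hs s ss).2) hn.
have ikc : leb.-integrable `]0, +oo[ (EFin \o (fun s => (c' * p) * kern al p h s)).
  by have := @integrableZl _ _ _ leb _ (measurable_itv _) (c' * p) _ ik; apply: eq_integrable.
have j12 : leb.-integrable `]0, +oo[ (EFin \o (fun s =>
   (G (1 + s) - G 1) * tail Q u s - (G (1 - s) - G 1) * tail Q (\- u) s)).
  by have := @integrableB _ _ _ leb _ (measurable_itv _) _ _ j1 j2; apply: eq_integrable.
rewrite mulrA /Jint -RintegralZl// -RintegralB// -RintegralB//.
rewrite (@eq_Rintegral _ _ _ leb _ (fun s =>
  (G (1 + s) - G 1) * (tail Q u s - c' * s `^ (- al)) -
  (G (1 - s) - G 1) * (tail Q (\- u) s - c' * s `^ (- al)))); last first.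
  by move=> s _; rewrite /kern /G; ring.
rewrite RintegralB//; apply: (le_trans (ler_normB _ _)).
rewrite mulr2n mulrDl mul1r; apply: lerD.
  exact: le_trans b1 EBd.
exact: le_trans b2 EBd.
Qed.

End bounds.
End drift_bounds.

(** * One-sided test functions *)

Section onesided.
Context {R : realType}.
Implicit Types (p h v x : R).

Definition ppart v : R := Num.max v 0.
(** Differentiable in spite of the kink of [ppart], as [phi] depends on the square of its
    argument. *)
Definition phip p h v : R := phi p h (ppart v).
Definition psip p h v : R := psi p h (ppart v).

Lemma ppart_ge0 v : 0 <= ppart v. Proof. by rewrite /ppart le_max lexx orbT. Qed.
Lemma ppart_pos v : 0 <= v -> ppart v = v. Proof. by move=> v0; exact/max_idPl. Qed.
Lemma ppart_neg v : v <= 0 -> ppart v = 0. Proof. by move=> v0; exact/max_idPr. Qed.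

Lemma continuous_ppart : continuous ppart.
Proof.
move=> x; apply: (@continuous_max _ _ (fun x : R => x) (fun _ => 0)).
  exact: cvg_id.
exact: cvg_cst.
Qed.

Lemma is_derive_ppart_sqr x : is_derive x 1 (fun v => ppart v ^+ 2) (2 * ppart x).
Proof.
have [x0|x0|x0] := ltgtP x 0.
- rewrite (ppart_neg (ltW x0)) mulr0.
  have d0 := is_derive_cst (0 : R) x 1.
  apply: (@near_eq_is_derive _ _ _ (cst 0)) => //.
  near=> z; rewrite ppart_neg ?expr0n//=.
  by near: z; apply: filterS (lt_nbhsl x0) => z /ltW.
- rewrite (ppart_pos (ltW x0)).
  have d0 : is_derive x 1 (fun v : R => v ^+ 2) (2 * x).
    by apply: is_derive_eq; rewrite /GRing.scale/=; ring.
  apply: (@near_eq_is_derive _ _ _ (fun v : R => v ^+ 2)) => //.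
  near=> z; rewrite ppart_pos//.
  by near: z; apply: filterS (lt_nbhsr x0) => z /ltW.
- rewrite x0 ppart_pos// mulr0.
  apply/is_derive1_caratheodory; exists ppart; split.
  + move=> z; rewrite (ppart_pos (lexx 0)) expr0n/= !subr0.
    have [z0|z0] := leP 0 z; first by rewrite ppart_pos// expr2.
    by rewrite ppart_neg ?ltW// expr0n/= mul0r.
  + exact: continuous_ppart.
  + by rewrite ppart_pos.
Unshelve. all: by end_near. Qed.

Lemma is_derive_phip p h x : 0 < h -> is_derive x 1 (phip p h) (p * psip p h x).
Proof.
move=> h0; have B0 : 0 < h ^+ 2 + ppart x ^+ 2 by rewrite ltr_pwDl ?exprn_gt0 ?sqr_ge0.
have d1 := is_derive1_powR (p / 2) B0.
have d2 := is_deriveD (is_derive_cst (h ^+ 2) x 1) (is_derive_ppart_sqr x).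
have := @is_derive1_comp _ (fun y : R => y `^ (p / 2)) (fun v : R => h ^+ 2 + ppart v ^+ 2) x _ _ d1 d2.
rewrite (_ : _ * _ * _ = p * psip p h x)//.
by rewrite /psip /psi add0r; field.
Qed.

Lemma continuous_psip p h : 0 < h -> continuous (psip p h).
Proof.
move=> h0 x; apply: (@continuous_comp _ _ _ ppart (psi p h)); first exact: continuous_ppart.
exact: continuous_psi.
Qed.

Lemma psip_incr_le p h s : `|p| <= 2^-1 -> 0 < h -> 0 < s ->
  `|p * psip p h (1 + s) - p * psip p h 1| <= `|p| * 28 * weight 1 0 s + gvar p h s.
Proof.
move=> ph h0 s0; rewrite /psip !ppart_pos ?addr_ge0 ?(ltW s0)//.
rewrite -mulrBr normrM -mulrA -[leLHS]addr0 lerD ?gvar_ge0//.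
by rewrite ler_wpM2l// psi_incr_le.
Qed.

Lemma psip_decr_le p h s : `|p| <= 2^-1 -> 0 < h -> 0 < s ->
  `|p * psip p h (1 - s) - p * psip p h 1| <= `|p| * 28 * weight 1 0 s + gvar p h s.
Proof.
move=> ph h0 s0; rewrite /psip [ppart 1]ppart_pos// -mulrBr.
have [s1|s1] := leP s 1; first by rewrite ppart_pos ?subr_ge0//; exact: psi_decr_le.
rewrite ppart_neg; last by lra.
have -> : psi p h 0 = 0 by rewrite /psi mul0r.
rewrite sub0r normrM normrN -[leLHS]addr0 lerD ?gvar_ge0// -mulrA ler_wpM2l//.
rewrite /weight ltNge (_ : 2^-1 <= s)/=; last by lra.
rewrite powRr0 mulr1; have : `|psi p h 1| <= 1.
  by apply: psi1_le1; move: ph; rewrite ler_norml => /andP[_]; lra.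
by move: `|psi p h 1| => y; lra.
Qed.

End onesided.

(** * Drifts of the individual test functions *)

Section test_function_drifts.
Context {R : realType}.
Notation leb := (@lebesgue_measure R).
Context d (T : measurableType d) (Q : probability T R) (u : T -> R) (al K : R).
Hypotheses (al1 : 1 < al) (al2 : al < 2).
Hypothesis mu_ : measurable_fun setT u.
Hypothesis tK : tails_le Q u al K.

Let g0i : leb.-integrable `]0, +oo[ (EFin \o (fun _ : R => 0 : R)).
Proof. exact: integrable0. Qed.

Lemma drift_crude0 (F G : R -> R) (b A q : R) :
  (forall x : R, is_derive x 1 F (G x)) -> continuous G -> q < al - 1 ->
  (forall s, 0 < s -> `|G (b + s) - G b| <= A * weight 1 q s) ->
  (forall s, 0 < s -> `|G (b - s) - G b| <= A * weight 1 q s) ->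
  Q.-integrable setT (EFin \o (fun w => F (b + u w))) /\
  `|\int[Q]_w F (b + u w) - F b - G b * \int[Q]_w u w| <= 2 * K * (A * Cweight al q).
Proof.
move=> dF cG qal hp hn.
have mz : measurable_fun setT (fun _ : R => 0 : R) by exact: measurable_cst.
have [] := @drift_crude R d T Q u al K al1 al2 mu_ tK F G b A q (fun=> 0) dF cG qal mz g0i
  (fun _ _ => erefl) (fun _ => lexx 0).
- by move=> s s0; rewrite addr0; exact: hp.
- by move=> s s0; rewrite addr0; exact: hn.
- move=> iF; rewrite (_ : \int[leb]_(s in `]0, +oo[) 0 = 0); last by rewrite /Rintegral integral0.
  by rewrite mulr0 addr0.
Qed.

(** Over large jumps the increments of [psi] grow like s^(p-1), integrable against s^-al because p <
    al. [Kpsi p] serves s < 1/2, and 5 = 3 + 2 the other s, for which both 1 + s and |1 - s| are at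
    most 3 s. *)
Lemma drift_phi_ge1 p h : 1 <= p -> p < al -> 0 < h ->
  Q.-integrable setT (EFin \o (fun w => phi p h (1 + u w))) /\
  `|\int[Q]_w phi p h (1 + u w) - phi p h 1 - p * psi p h 1 * \int[Q]_w u w| <=
    2 * K * (p * (Kpsi p + 5) * Cweight al (p - 1)).
Proof.
move=> p1 pal h0; have [h1 h2] := (al1, al2).
have cG : continuous (fun v => p * psi p h v).
  by move=> x; apply: cvgMr; exact: continuous_psi.
have p0 : 0 <= p by lra.
have p2 : p <= 2 by lra.
have Kp : 0 <= Kpsi p by rewrite /Kpsi mulr_ge0 ?addr_ge0 ?powR_ge0.
have big v s : 2^-1 <= s -> `|v| <= 3 * s -> `|psi p h v - psi p h 1| <= 5 * s `^ (p - 1).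
  move=> s12 vs; have sp : 0 <= s by lra.
  have q1 : `|psi p h v| <= 3 * s `^ (p - 1).
    have [->|v0] := eqVneq v 0; first by rewrite /psi mul0r normr0 mulr_ge0 ?powR_ge0.
    apply: (le_trans (psi_abs_le _ p2 v0)).
    apply: (@le_trans _ _ ((3 * s) `^ (p - 1))).
      by apply: ge0_ler_powR; rewrite ?nnegrE//; lra.
    rewrite powRM// ler_wpM2r ?powR_ge0//.
    by apply: (@le_trans _ _ (3 `^ 1)); [apply: ler_powR; lra|rewrite powRr1].
  have q2 : `|psi p h 1| <= 2 * s `^ (p - 1).
    apply: (le_trans (psi1_le1 h p2)).
    apply: (@le_trans _ _ ((2 * s) `^ (p - 1))).
      apply: (@le_trans _ _ (1 `^ (p - 1))); first by rewrite powR1.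
      by apply: ge0_ler_powR; rewrite ?nnegrE//; lra.
    rewrite powRM// ler_wpM2r ?powR_ge0//.
    by apply: (@le_trans _ _ (2 `^ 1)); [apply: ler_powR; lra|rewrite powRr1].
  apply: (le_trans (ler_normB _ _)).
  by move: q1 q2; move: `|_| `|_| (_ `^ _) => x y z; lra.
have small v s : 0 < s -> s < 2^-1 -> 2^-1 < v -> `|v - 1| = s ->
    `|psi p h v - psi p h 1| <= Kpsi p * s.
  by move=> s0 s12 v12 <-; apply: psi_lipschitz => //; lra.
have fin (x : R) s : 0 <= s -> 0 <= x -> x <= Kpsi p * s -> p * x <= p * (Kpsi p + 5) * s.
  move=> s0 x0 xs; rewrite -mulrA ler_wpM2l//; apply: (le_trans xs).
  by rewrite ler_wpM2r// lerDl.
have fin2 (x y : R) : 0 <= y -> x <= 5 * y -> p * x <= p * (Kpsi p + 5) * y.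
  move=> y0 xs; rewrite -mulrA ler_wpM2l//; apply: (le_trans xs).
  by rewrite ler_wpM2r// lerDr.
apply: (@drift_crude0 (phi p h) (fun v => p * psi p h v) 1 (p * (Kpsi p + 5)) (p - 1)) => //.
- by move=> x; exact: is_derive_phi.
- by lra.
- move=> s s0; rewrite -mulrBr normrM (ger0_norm p0) /weight; case: ltP => s12.
    rewrite powRr1 ?(ltW s0)//; apply: fin; rewrite ?(ltW s0)//.
    by apply: small => //; [lra|rewrite (_ : 1 + s - 1 = s) ?gtr0_norm//; ring].
  by apply: fin2; rewrite ?powR_ge0//; apply: big => //; rewrite ger0_norm; lra.
- move=> s s0; rewrite -mulrBr normrM (ger0_norm p0) /weight; case: ltP => s12.
    rewrite powRr1 ?(ltW s0)//; apply: fin; rewrite ?(ltW s0)//.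
    by apply: small => //; [lra|rewrite (_ : 1 - s - 1 = - s) ?normrN ?gtr0_norm//; ring].
  apply: fin2; rewrite ?powR_ge0//; apply: big => //.
  by rewrite ler_norml; apply/andP; split; lra.
Qed.

(** For p = -2 and h = 1 the function [psi] is bounded by 1 and 5-Lipschitz on the whole line, so
    that the estimate holds at every base point b; 10 is |p| times 5. *)
Lemma drift_null b :
  Q.-integrable setT (EFin \o (fun w => phi (-2) 1 (b + u w))) /\
  `|\int[Q]_w phi (-2) 1 (b + u w) - phi (-2) 1 b - -2 * psi (-2) 1 b * \int[Q]_w u w| <=
    2 * K * (10 * Cweight al 0).
Proof.
have [h1 h2] := (al1, al2).
have cG : continuous (fun v => -2 * psi (-2) 1 v : R).
  by move=> x; apply: cvgMr; exact: continuous_psi.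
have ex : -2 / 2 - 1 = - 2%:R :> R by lra.
have B1 (v : R) : 1 <= 1 ^+ 2 + v ^+ 2 by rewrite expr1n lerDl sqr_ge0.
have Bpos (v : R) : 0 < 1 ^+ 2 + v ^+ 2 by apply: lt_le_trans (B1 v).
have Ble (v : R) : (1 ^+ 2 + v ^+ 2) `^ (-2 / 2 - 1) <= 1.
  rewrite ex powRN powR_mulrn ?(ltW (Bpos v))//.
  by rewrite invf_le1 ?exprn_gt0 ?Bpos// exprn_ege1// B1.
have psi_le (v : R) : `|psi (-2) 1 v| <= 1.
  rewrite /psi ex powRN powR_mulrn ?(ltW (Bpos v))// normrM normfV.
  rewrite [X in _ / X]ger0_norm ?exprn_ge0 ?(ltW (Bpos v))//.
  rewrite ler_pdivrMr ?exprn_gt0 ?Bpos// mul1r expr1n.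
  have n0 := normr_ge0 v.
  rewrite -[v ^+ 2]ger0_norm ?sqr_ge0// normrX; move: `|v| n0 => y y0.
  by have := sqr_ge0 (y - 1); rewrite !expr2; nra.
have lip (x y : R) : `|psi (-2) 1 x - psi (-2) 1 y| <= 5 * `|x - y|.
  pose m := `|x| + `|y| + 1.
  have hx : - m < x < m.
    by rewrite -ltr_norml /m; have := normr_ge0 y; move: `|x| `|y| => *; lra.
  have hy : - m < y < m.
    by rewrite -ltr_norml /m; have := normr_ge0 x; move: `|x| `|y| => *; lra.
  apply: (@MVT_lipschitz _ (psi (-2) 1) (dpsi (-2) 1) (- m) m) => //.
    by move=> z _; exact: is_derive_psi.
  move=> z _; apply: (le_trans (dpsi_abs_le _ _ _)) => //.
  rewrite normrN ger0_norm// (_ : 3 + 2 = 5); last by lra.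
  by rewrite -[leRHS]mulr1 ler_wpM2l// Ble.
have key (v : R) s : 0 < s -> `|v - b| = s ->
   `|-2 * psi (-2) 1 v - -2 * psi (-2) 1 b| <= 10 * weight 1 0 s.
  have n2 : `|-2| = 2 :> R by rewrite normrN ger0_norm.
  move=> s0 vs; rewrite -mulrBr normrM n2 /weight; case: ltP => s12.
    rewrite powRr1 ?(ltW s0)// (_ : 10 = 2 * 5); last by rewrite -natrM.
    by rewrite -mulrA ler_wpM2l// -vs lip.
  have le4 : `|psi (-2) 1 v - psi (-2) 1 b| <= 1 + 1.
    by apply: (le_trans (ler_normB _ _)); rewrite lerD.
  rewrite powRr0 mulr1; apply: (@le_trans _ _ (2 * (1 + 1))); first by rewrite ler_wpM2l.
  by lra.
apply: (@drift_crude0 (phi (-2) 1) (fun v => -2 * psi (-2) 1 v) b 10 0) => //.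
- by move=> x; exact: is_derive_phi.
- by lra.
- by move=> s s0; apply: key => //; rewrite addrC addKr gtr0_norm.
- by move=> s s0; apply: key => //; rewrite addrC addKr normrN gtr0_norm.
Qed.

Lemma drift_onesided_crude p h : `|p| <= 2^-1 -> p != 0 -> 0 < h -> h <= 1 ->
  Q.-integrable setT (EFin \o (fun w => phip p h (1 + u w))) /\
  `|\int[Q]_w phip p h (1 + u w) - phi p h 1 - p * psi p h 1 * \int[Q]_w u w| <=
    2 * K * (`|p| * 28 * Cweight al 0 + 8 * (2 + h `^ p)).
Proof.
move=> ph p0 h0 h1; have [a1 a2] := (al1, al2).
have K0 := tails_le_ge0 tK.
have q0 : 0 < al - 1 by lra.
have cG : continuous (fun v => p * psip p h v).
  by move=> x; apply: cvgMr; exact: continuous_psip.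
have [ig eg] := Rintegral_gvar ph p0 h0 h1.
have mg := @measurable_gvar R p h h0.
have gz s : s <= 2^-1 -> gvar p h s = 0 by move=> ?; apply: gvar_out; left.
have [iF B] := @drift_crude R d T Q u al K al1 al2 mu_ tK (phip p h) (fun v => p * psip p h v)
  1 (`|p| * 28) 0 (gvar p h) (fun x => is_derive_phip p x h0) cG q0 mg ig gz (@gvar_ge0 R p h)
  (fun s => @psip_incr_le R p h s ph h0) (fun s => @psip_decr_le R p h s ph h0).
split; first exact: iF.
move: B; rewrite /phip /psip ppart_pos// => B; apply: (le_trans B).
rewrite ler_wpM2l ?mulr_ge0// lerD2l.
have -> : 8 * (2 + h `^ p) = 4 * (2 * (2 + h `^ p)) by rewrite mulrA -natrM.
by rewrite ler_wpM2l.
Qed.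

End test_function_drifts.

Section onesided_drift.
Context {R : realType}.

Lemma onesided_bounds_combine (x y z t : R) : x <= z -> - z + t <= y -> x - y <= 2 * z - t.
Proof. lra. Qed.

Notation leb := (@lebesgue_measure R).
Context d (T : measurableType d) (Q : probability T R) (u : T -> R) (al K : R).
Hypotheses (al1 : 1 < al) (al2 : al < 2).
Hypothesis mu_ : measurable_fun setT u.
Hypothesis tK : tails_le Q u al K.

Lemma tail_noninc (v : T -> R) s t : measurable_fun setT v -> s <= t -> tail Q v t <= tail Q v s.
Proof.
move=> mv st; have m r : measurable [set w | r < v w] by exact: measurable_set_ltr.
rewrite /tail fine_le ?fin_num_measure// le_measure ?inE//.
by move=> w /=; exact: le_lt_trans.
Qed.

(* Jumps from 1 to the negative half-line cross the region where phip decreases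
   to its minimum: they contribute the last term, which is of order 1, whereas
   all other contributions are of order p. *)
Lemma drift_onesided_pos p h : 0 < p -> p <= 2^-1 -> 0 < h -> h <= 1 ->
  \int[Q]_w phip p h (1 + u w) - phi p h 1 - p * psi p h 1 * \int[Q]_w u w <=
    2 * (K * (p * 28 * Cweight al 0)) - tail Q (\- u) 1 * (phi p h 2^-1 - phi p h 0).
Proof.
move=> p0 ph h0 h1; have [a1 a2] := (al1, al2).
have K0 := tails_le_ge0 tK.
have q0 : 0 < al - 1 by lra.
have w1a : -1 < 1 - al by lra.
have w2a : 0 - al < -1 by lra.
have half0 : 0 < 2^-1 :> R by lra.
have pn0 : p != 0 by rewrite gt_eqF.
have pa : `|p| = p by rewrite gtr0_norm.
have pha : `|p| <= 2^-1 by rewrite pa.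
have cG : continuous (fun v => p * psip p h v).
  by move=> x; apply: cvgMr; exact: continuous_psip.
have mz : measurable_fun setT (fun _ : R => 0 : R) by exact: measurable_cst.
have iz : leb.-integrable `]0, +oo[ (EFin \o (fun _ : R => 0 : R)) by exact: integrable0.
have [ig eg] := Rintegral_gvar pha pn0 h0 h1.
have mg := @measurable_gvar R p h h0.
have gz s : s <= 2^-1 -> gvar p h s = 0 by move=> ?; apply: gvar_out; left.
have mv : measurable_fun setT (\- u) by exact: measurable_funN.
have psi11 : `|p * psi p h 1| <= p * 28.
  rewrite normrM pa ler_wpM2l ?(ltW p0)// (le_trans (psi1_le1 _ _))//; last by rewrite ler1n.
  lra.
pose Dn s := p * psip p h (1 - s) - p * psip p h 1.
pose Dp s := p * psip p h (1 + s) - p * psip p h 1.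
have hp s : 0 < s -> `|Dp s| <= p * 28 * weight 1 0 s + 0.
  move=> s0; rewrite addr0 /Dp /psip !ppart_pos ?addr_ge0 ?(ltW s0)//.
  rewrite -mulrBr normrM pa -mulrA ler_wpM2l ?(ltW p0)//.
  exact: psi_incr_le.
have hn s : 0 < s -> `|Dn s| <= p * 28 * weight 1 0 s + gvar p h s.
  by move=> s0; have := @psip_decr_le R p h s pha h0 s0; rewrite pa.
have [m1 m2] := @measurable_increments R (fun v => p * psip p h v) 1 cG.
have [i1 e1] := integrable_incr al1 al2 q0 m1 mz iz (fun _ _ => erefl) (fun _ => lexx 0) hp.
have [i2 _] := integrable_incr al1 al2 q0 m2 mg ig gz (@gvar_ge0 R p h) hn.
have [iF] := drift_formula al1 mu_ tK (fun x => is_derive_phip p x h0) cG i1 i2.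
have -> : phi p h 1 = phip p h 1 by rewrite /phip ppart_pos.
have -> : psi p h 1 = psip p h 1 by rewrite /psip ppart_pos.
move=> ->.
have [j1 j2] := integrable_increments mu_ tK cG i1 i2.
have B1 : \int[leb]_(s in `]0, +oo[) (Dp s * tail Q u s) <= K * (p * 28 * Cweight al 0).
  apply: (le_trans (ler_norm _)).
  apply: (le_trans (Rintegral_tail_le tK m1 mu_ (fun s s0 => (tK s0).1) i1)).
  rewrite ler_wpM2l//; apply: (le_trans e1).
  by rewrite (_ : \int[leb]_(s in `]0, +oo[) 0 = 0) ?mulr0 ?addr0//; rewrite /Rintegral integral0.
(* On this interval [psi p h (1 - s)] is nonnegative and the tail is at least its value at 1; the
   integral of [psi] there is the fall of [phi] from 1/2 to 0, divided by p. Everywhere else the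
   increments are of order p. *)
pose E : set R := `]2^-1, 1[%classic.
pose w2 : R -> R := (fun s => psi p h (1 - s)) \_ E.
have [k1 E1] := Rintegral_psi_half pn0 h0.
have iw2 : leb.-integrable `]0, +oo[ (EFin \o w2).
  apply: (@integrableS _ _ _ leb setT) => //.
  have := (@integrable_mkcond _ _ _ leb E (EFin \o (fun s => psi p h (1 - s))) (measurable_itv _)).1 k1.
  by rewrite restrict_EFin.
have Ew2 : \int[leb]_(s in `]0, +oo[) w2 s = (phi p h 2^-1 - phi p h 0) / p.
  rewrite -E1 -Rintegral_mkcondr; congr (Rintegral _ _ _).
  apply/setIidPr => s; rewrite /E /= !in_itv/= andbT => /andP[+ _].
  exact: lt_trans.
have iw : leb.-integrable `]0, +oo[ (EFin \o weight (1 - al) (0 - al)).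
  exact: integrable_weight.
pose T1 := tail Q (\- u) 1.
have T10 : 0 <= T1 by exact: tail_ge0.
have iL1 : leb.-integrable `]0, +oo[ (EFin \o (fun s => - (p * 28 * K) * weight (1 - al) (0 - al) s)).
  by have := @integrableZl _ _ _ leb _ (measurable_itv _) (- (p * 28 * K)) _ iw; apply: eq_integrable.
have iL2 : leb.-integrable `]0, +oo[ (EFin \o (fun s => T1 * p * w2 s)).
  by have := @integrableZl _ _ _ leb _ (measurable_itv _) (T1 * p) _ iw2; apply: eq_integrable.
have iL : leb.-integrable `]0, +oo[ (EFin \o (fun s =>
    - (p * 28 * K) * weight (1 - al) (0 - al) s + T1 * p * w2 s)).
  by have := @integrableD _ _ _ leb _ (measurable_itv _) _ _ iL1 iL2; apply: eq_integrable.
have bnd x s : 0 < s -> `|x| <= p * 28 * weight 1 0 s ->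
    - (p * 28 * K) * weight (1 - al) (0 - al) s <= x * tail Q (\- u) s.
  move=> s0 hx; rewrite mulNr lerNl -mulNr.
  apply: (le_trans (ler_norm _)); rewrite normrM normrN (ger0_norm (tail_ge0 _ _ _)).
  apply: (le_trans (ler_pM (normr_ge0 _) (tail_ge0 _ _ _) hx (tK s0).2)).
  by rewrite -weightM// le_eqVlt; apply/orP; left; apply/eqP; ring.
have low s : `]0, +oo[%classic s -> - (p * 28 * K) * weight (1 - al) (0 - al) s + T1 * p * w2 s <=
    Dn s * tail Q (\- u) s.
  rewrite /= in_itv/= andbT => s0.
  have w1 : 2^-1 <= s -> weight 1 0 s = 1 by rewrite /weight leNgt powRr0 => /negbTE ->.
  rewrite /w2 patchE; case: ifPn => sE.
    have /andP[sa sb] : 2^-1 < s < 1 by move: sE; rewrite inE /E /= in_itv.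
    have -> : Dn s = p * psi p h (1 - s) + - (p * psi p h 1).
      by rewrite /Dn /psip !ppart_pos// subr_ge0 ltW.
    rewrite mulrDl addrC lerD//.
      have tT : T1 <= tail Q (\- u) s := tail_noninc mv (ltW sb).
      rewrite -mulrA [leLHS]mulrC; apply: ler_wpM2l tT.
      by rewrite mulr_ge0 ?psi_ge0 ?subr_ge0 ?(ltW sb) ?(ltW p0).
    by apply: bnd => //; rewrite normrN w1 ?mulr1// ltW.
  rewrite mulr0 addr0; apply: bnd => //.
  have [s1|s1] := leP s 2^-1; first by have := hn s s0; rewrite gz// addr0.
  have s2 : 1 <= s.
    by rewrite leNgt; apply: contra sE => s2; rewrite inE /E /= in_itv/= s1 s2.
  rewrite /Dn /psip (@ppart_neg _ (1 - s)) ?subr_le0// /psi mul0r mulr0 sub0r normrN.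
  by rewrite -/(psi _ _ _) ppart_pos// w1 ?mulr1// ltW.
have B2 : - (K * (p * 28 * Cweight al 0)) + T1 * (phi p h 2^-1 - phi p h 0) <=
    \int[leb]_(s in `]0, +oo[) (Dn s * tail Q (\- u) s).
  have := @le_Rintegral _ _ _ leb _ _ _ (measurable_itv _) iL j2 low.
  apply: le_trans; rewrite RintegralD// RintegralZl// RintegralZl// Ew2.
  have -> : T1 * p * ((phi p h 2^-1 - phi p h 0) / p) = T1 * (phi p h 2^-1 - phi p h 0).
    by field.
  rewrite lerD2r /Cweight mulNr lerN2.
  by rewrite mulrCA !mulrA.
move: B1 B2; rewrite -/T1.
move: (\int[leb]_(s in _) _) (\int[leb]_(s in _) _) => x y.
exact: onesided_bounds_combine.
Qed.

End onesided_drift.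

(** * Test functions along the chain *)

Section one_step.
Context {R : realType} (X : set R) (k : R.-pker R ~> R)
  {d : measure_display} {T : measurableType d}
  (P : R -> probability T R) (xi : nat -> T -> R).
Hypothesis mc : markov_chain X k P xi.

Lemma measurable_theta : measurable_fun setT (theta xi).
Proof. by have [_ _ h _] := mc; apply: measurable_funB. Qed.

Lemma law_xi1 x A : X x -> measurable A -> P x (xi 1%N @^-1` A) = k x A.
Proof.
move=> Xx mA; have [_ _ _ h] := mc.
have := h x Xx [:: setT; A]; rewrite /= => H.
transitivity (P x [set w | forall i, (i < 2)%N -> nth set0 [:: setT; A] i (xi i w)]).
  congr (P x _); apply/seteqP; split => w /= hw; last exact: (hw 1%N).
  by move=> [|[|i]].
rewrite H; last by move=> [_|[_|//]] /=; [exact: measurableT|exact: mA].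
rewrite indicE in_setT mul1e.
transitivity (\int[k x]_y (\1_A y)%:E)%E; last by rewrite integral_indic// setIT.
apply: eq_integral => y _; rewrite (_ : (\int[_]__ 1)%E = 1%E) ?mule1//.
by have := @kop_cst R k 1 y.
Qed.

Lemma xi0_ae x : X x -> {ae P x, forall w, xi 0%N w = x}.
Proof.
move=> Xx; have [_ _ mxi h] := mc.
have := h x Xx [:: [set x]] => /(_ _) H.
have m0 : measurable [set w | xi 0%N w = x].
  by rewrite -[X in measurable X]setTI; apply: (mxi 0%N measurableT [set x]); exact: measurable_set1.
have e1 : P x [set w | xi 0%N w = x] = 1%E.
  transitivity (fdd k [:: [set x]] x).
    rewrite -H; last by move=> [_|//] /=; exact: measurable_set1.
    congr (P x _); apply/seteqP; split => w /= hw; last exact: (hw 0%N).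
    by move=> [|i].
  rewrite /= indicE mem_set// mul1e.
  by have := @kop_cst R k 1 x.
exists (~` [set w | xi 0%N w = x]); split => //; first exact: measurableC.
transitivity (1 - P x [set w | xi 0%N w = x])%E; first exact: probability_setC.
by rewrite e1 subee.
Qed.

Lemma kopE (F : R -> R) x : X x -> measurable_fun setT F -> (forall y, 0 <= F y) ->
  kop k (EFin \o F) x = (\int[P x]_w (F (x + theta xi w))%:E)%E.
Proof.
move=> Xx mF F0; have [_ _ mxi _] := mc.
transitivity (\int[P x]_w (F (xi 1%N w))%:E)%E; last first.
  apply: ae_eq_integral => //.
  - by apply/measurable_EFinP; exact: measurableT_comp.
  - apply/measurable_EFinP; apply: measurableT_comp => //.
    by apply: measurable_funD; [exact: measurable_cst|exact: measurable_theta].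
  - apply: filterS (xi0_ae Xx) => w e _.
    by congr (F _)%:E; rewrite /theta e; ring.
transitivity (\int[pushforward (P x) (xi 1%N)]_y (F y)%:E)%E.
  by apply: eq_measure_integral => A mA _; rewrite /= -law_xi1.
rewrite ge0_integral_pushforward//; first exact/measurable_EFinP.
by move=> y _; rewrite lee_fin.
Qed.

Lemma kop_Rintegral (F : R -> R) x : X x -> measurable_fun setT F -> (forall y, 0 <= F y) ->
  (P x).-integrable setT (EFin \o (fun w => F (x + theta xi w))) ->
  kop k (EFin \o F) x = (\int[P x]_w F (x + theta xi w))%:E.
Proof.
move=> Xx mF F0 iF; rewrite kopE// /Rintegral fineK//.
by have := integrable_fin_num measurableT iF.
Qed.



Section tails.
Variables (al c : R).
Hypothesis hT : cond_Tbal X P xi al c.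

Lemma tail_pospE x y : 0 <= y ->
  fine (P x [set w | y < posp (theta xi w)]) = tail (P x) (theta xi) y.
Proof.
move=> y0; congr (fine (P x _)); apply/seteqP; split => w /=; rewrite /posp; case: (leP 0 (theta xi w)) => //.
  by move=> _ yn; have := le_lt_trans y0 yn; rewrite ltxx.
by move=> t0 yt; have := lt_trans yt t0; rewrite ltNge y0.
Qed.

Lemma tail_negpE x y : 0 <= y ->
  fine (P x [set w | y < negp (theta xi w)]) = tail (P x) (\- theta xi) y.
Proof.
move=> y0; congr (fine (P x _)); apply/seteqP; split => w /=; rewrite /negp; case: (ltP (theta xi w) 0) => //.
  by move=> _ yn; have := le_lt_trans y0 yn; rewrite ltxx.
by move=> t0 yt; have := le_lt_trans y0 yt; rewrite oppr_gt0 ltNge t0.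
Qed.

Lemma Tbal_uniform : exists x0 : R, 0 <= x0 /\ forall eps, 0 < eps -> exists Y : R, 0 <= Y /\
  forall y x, Y <= y -> X x -> x0 <= `|x| ->
    `|y `^ al * tail (P x) (theta xi) y - c| <= eps /\
    `|y `^ al * tail (P x) (\- theta xi) y - c| <= eps.
Proof.
have [_ _ _ [x0 [x00 h]]] := hT; exists x0; split => // eps /h[Y hY].
exists (Num.max Y 0); split; first by rewrite le_max lexx orbT.
move=> y x; rewrite ge_max => /andP[Yy y0] Xx xx0.
have := hY y Yy x Xx; rewrite /tail_plus /tail_minus tail_pospE// tail_negpE//; apply.
by move: xx0; rewrite ler_normr => /orP[]; [left|right; rewrite lerNr].
Qed.

Lemma tails_uniform : exists x0 K : R, forall x, X x -> x0 <= `|x| ->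
  tails_le (P x) (theta xi) al K.
Proof.
have [a1 _ c0 _] := hT; have al0 : 0 <= al by apply: ltW; apply: lt_trans a1.
have [x0 [_ /(_ 1 ltr01)[Y [Y0 h]]]] := Tbal_uniform.
(* For s >= Y the limit bounds s^al times the tail by c + 1; for s < Y the tail is at most 1 <= Y^al
   s^-al. *)
exists x0, (c + 1 + Y `^ al) => x Xx xx0 s s0.
have mt := measurable_theta.
have mN : measurable_fun setT (\- theta xi) by exact: measurable_funN.
have key v : measurable_fun setT v -> (Y <= s -> `|s `^ al * tail (P x) v s - c| <= 1) ->
    tail (P x) v s <= (c + 1 + Y `^ al) * s `^ (- al).
  move=> mv hv; rewrite powRN ler_pdivlMr ?powR_gt0//.
  have [Ys|sY] := leP Y s.
    rewrite mulrC; have := hv Ys; rewrite ler_norml => /andP[_ +].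
    rewrite lerBlDr => /le_trans; apply.
    by rewrite [1 + c]addrC lerDl powR_ge0.
  apply: (@le_trans _ _ (1 * Y `^ al)); last by rewrite mul1r lerDr addr_ge0// ltW.
  apply: ler_pM; rewrite ?tail_ge0 ?powR_ge0 ?tail_le1//.
  by apply: ge0_ler_powR; rewrite ?nnegrE// ltW.
by split; apply: key => // Ys; have [] := h s x Ys Xx xx0.
Qed.

End tails.
End one_step.

(** * Rescaling by the distance to the origin *)

Section scaling.
Context {R : realType} d (T : measurableType d) (Q : probability T R).
Implicit Types (v : T -> R) (sg r s : R).

Lemma tail_div v r s : 0 < r -> tail Q (fun w => v w / r) s = tail Q v (s * r).
Proof.
move=> r0; congr (fine (Q _)); apply/seteqP.
by split => w /=; rewrite ltr_pdivlMr.
Qed.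

(* For x = sg * r, the point reached after a jump v is sg * r * (1 + signed sg r v). *)
Definition signed sg r v : T -> R := fun w => sg * v w / r.

Lemma tail_signed sg r v s : sg = 1 \/ sg = -1 -> 0 < r ->
  (tail Q (signed sg r v) s = tail Q v (s * r) /\
   tail Q (\- signed sg r v) s = tail Q (\- v) (s * r)) \/
  (tail Q (signed sg r v) s = tail Q (\- v) (s * r) /\
   tail Q (\- signed sg r v) s = tail Q v (s * r)).
Proof.
move=> [->|->] r0; [left|right]; rewrite -!tail_div//; split; congr (tail _ _ _);
  apply/funext => w; rewrite /signed /=; ring.
Qed.

Lemma tails_le_signed sg r v al K : sg = 1 \/ sg = -1 -> 0 < r ->
  tails_le Q v al K -> tails_le Q (signed sg r v) al (K * r `^ (- al)).
Proof.
move=> hsg r0 h s s0; have [h1 h2] := h (s * r) (mulr_gt0 s0 r0).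
have e : K * r `^ (- al) * s `^ (- al) = K * (s * r) `^ (- al).
  by rewrite powRM ?ltW//; ring.
by rewrite e; have [[-> ->]|[-> ->]] := tail_signed v s hsg r0.
Qed.

Lemma tails_err_signed sg r v al c e s0 : sg = 1 \/ sg = -1 -> 0 < r -> 0 < s0 ->
  (forall y, s0 * r <= y -> `|y `^ al * tail Q v y - c| <= e /\
     `|y `^ al * tail Q (\- v) y - c| <= e) ->
  forall s, s0 <= s ->
    `|tail Q (signed sg r v) s - c * r `^ (- al) * s `^ (- al)| <= e * r `^ (- al) * s `^ (- al) /\
    `|tail Q (\- signed sg r v) s - c * r `^ (- al) * s `^ (- al)| <= e * r `^ (- al) * s `^ (- al).
Proof.
move=> hsg r0 s00 h s ss; have sp : 0 < s by apply: lt_le_trans ss.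
have sr0 : 0 < s * r by rewrite mulr_gt0.
have pw a : a * r `^ (- al) * s `^ (- al) = a * (s * r) `^ (- al).
  by rewrite powRM ?ltW//; ring.
have key w : `|(s * r) `^ al * tail Q w (s * r) - c| <= e ->
    `|tail Q w (s * r) - c * (s * r) `^ (- al)| <= e * (s * r) `^ (- al).
  move=> hw; have P0 : 0 < (s * r) `^ al by rewrite powR_gt0.
  rewrite powRN ler_pdivlMr// -[X in _ * X <= _](gtr0_norm P0) -normrM.
  rewrite mulrBl [tail _ _ _ * _]mulrC -[c * _ * _]mulrA mulVf ?mulr1//.
  by rewrite gt_eqF.
have srs : s0 * r <= s * r by rewrite ler_pM2r.
have [h1 h2] := h _ srs.
rewrite !pw.
by have [[-> ->]|[-> ->]] := tail_signed v s hsg r0; split; apply: key.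
Qed.

Lemma measurable_signed sg r v : measurable_fun setT v -> measurable_fun setT (signed sg r v).
Proof.
by move=> mv; apply: measurable_funM => //; apply: measurable_funM.
Qed.

Lemma Rintegral_signed sg r v : Q.-integrable setT (EFin \o v) ->
  \int[Q]_w signed sg r v w = sg * \int[Q]_w v w / r.
Proof.
move=> iv; transitivity (\int[Q]_w (sg / r * v w)).
  by apply: eq_Rintegral => w _; rewrite /signed; ring.
by rewrite RintegralZl//; ring.
Qed.

End scaling.

Section numeric.
Context {R : realType}.
Implicit Types p q r h z : R.

Lemma powR_small q A eps : 0 < q -> 0 < eps ->
  exists M, 1 <= M /\ forall r, M <= r -> A * r `^ (- q) <= eps.
Proof.
move=> q0 e0; pose B := (`|A| / eps) `^ q^-1.
exists (Num.max 1 B); split; first by rewrite le_max lexx.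
move=> r; rewrite ge_max => /andP[r1 rB].
have r0 : 0 < r by apply: lt_le_trans r1.
have A0 : 0 <= `|A| / eps by rewrite divr_ge0 ?(ltW e0).
rewrite powRN ler_pdivrMr ?powR_gt0// (le_trans (ler_norm A))// mulrC -ler_pdivrMr//.
apply: (@le_trans _ _ (B `^ q)); last by apply: ge0_ler_powR; rewrite ?nnegrE ?powR_ge0// ltW.
by rewrite /B -powRrM mulVf ?gt_eqF// powRr1.
Qed.

Lemma powR_inv r p : 0 < r -> r^-1 `^ p = r `^ (- p).
Proof. by move=> r0; rewrite -powR_inv1 ?ltW// -powRrM mulN1r. Qed.

Lemma phi_scale p r z : 0 < r -> phi p 1 (r * z) = r `^ p * phi p r^-1 z.
Proof.
move=> r0; have -> : r `^ p = (r ^+ 2) `^ (p / 2) by rewrite powR_sqr gtr0_norm.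
rewrite /phi -powRM ?addr_ge0 ?sqr_ge0//; congr (_ `^ _).
by field; rewrite gt_eqF.
Qed.

Lemma psi1_bounds p h : -2 <= p -> p <= 2 -> 1 - 2 * h ^+ 2 <= psi p h 1 <= 1.
Proof.
move=> p1 p2; apply/andP; split; last first.
  by apply: le_trans (psi1_le1 h p2); exact: ler_norm.
rewrite /psi mul1r expr1n; set y := h ^+ 2; have y0 : 0 <= y by exact: sqr_ge0.
apply: (@le_trans _ _ ((y + 1) `^ (- 2))); last by apply: ler_powR; lra.
have y1 : 0 < y + 1 by lra.
rewrite powRN powR_mulrn ?(ltW y1)// -div1r ler_pdivlMr ?exprn_gt0// expr2.
by nra.
Qed.

End numeric.

Section one_step_phi.
Context {R : realType} (X : set R) (k : R.-pker R ~> R)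
  {d : measure_display} {T : measurableType d}
  (P : R -> probability T R) (xi : nat -> T -> R).
Hypothesis mc : markov_chain X k P xi.
Variables (x sg : R).
Hypotheses (Xx : X x) (sgP : sg = 1 \/ sg = -1) (sx : 0 < sg * x).
Notation r := (sg * x).
Notation u := (signed sg r (theta xi)).

Let jumpE w : sg * (x + theta xi w) = r * (1 + u w).
Proof.
by rewrite /signed [RHS]mulrDr mulr1 [r * (_ / r)]mulrCA divff ?gt_eqF// mulr1 mulrDr.
Qed.

Lemma phi_signed p h z : phi p h (sg * z) = phi p h z.
Proof. by case: sgP => ->; rewrite ?mul1r// mulN1r phiN. Qed.

Lemma kop_phi p :
  (P x).-integrable setT (EFin \o (fun w => phi p r^-1 (1 + u w))) ->
  kop k (EFin \o phi p 1) x = (r `^ p * \int[P x]_w phi p r^-1 (1 + u w))%:E.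
Proof.
move=> iu; have E w : phi p 1 (x + theta xi w) = r `^ p * phi p r^-1 (1 + u w).
  by rewrite -phi_signed jumpE phi_scale.
have mphi : measurable_fun setT (phi p 1 : R -> R).
  by apply: continuous_measurable_fun; exact: continuous_phi.
rewrite (kop_Rintegral mc Xx mphi (phi_ge0 p 1)).
  congr _%:E; rewrite -RintegralZl//.
  by apply: eq_Rintegral => w _; exact: E.
have := @integrableZl _ _ _ (P x) _ measurableT (r `^ p) _ iu.
by apply: eq_integrable => // w _; rewrite /= E.
Qed.

Lemma phiE p : phi p 1 x = r `^ p * phi p r^-1 1.
Proof. by rewrite -phi_scale// mulr1 phi_signed. Qed.

Lemma continuous_phip p h : 0 < h -> continuous (phip p h : R -> R).
Proof.
move=> h0 y; apply: (@continuous_comp _ _ _ ppart (phi p h)); first exact: continuous_ppart.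
exact: continuous_phi.
Qed.

Lemma phip_scale p (s z : R) : 0 < s -> phip p 1 (s * z) = s `^ p * phip p s^-1 z.
Proof.
move=> s0; rewrite /phip -phi_scale//; congr (phi _ _ _).
by rewrite /ppart maxr_pMr ?(ltW s0)// mulr0.
Qed.

Lemma kop_phip p :
  (P x).-integrable setT (EFin \o (fun w => phip p r^-1 (1 + u w))) ->
  kop k (EFin \o (fun z => phip p 1 (sg * z))) x =
    (r `^ p * \int[P x]_w phip p r^-1 (1 + u w))%:E.
Proof.
move=> iu; have E w : phip p 1 (sg * (x + theta xi w)) = r `^ p * phip p r^-1 (1 + u w).
  by rewrite jumpE phip_scale.
have mphi : measurable_fun setT (fun z => phip p 1 (sg * z)).
  apply: measurableT_comp; last exact: measurable_funM.
  by apply: continuous_measurable_fun; exact: continuous_phip.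
rewrite (kop_Rintegral mc Xx mphi (fun z => phi_ge0 p 1 _)).
  congr _%:E; rewrite -RintegralZl//.
  by apply: eq_Rintegral => w _; exact: E.
have := @integrableZl _ _ _ (P x) _ measurableT (r `^ p) _ iu.
by apply: eq_integrable => // w _; rewrite /= E.
Qed.

Lemma phipE p : phip p 1 r = r `^ p * phi p r^-1 1.
Proof. by rewrite -phi_scale// mulr1 /phip ppart_pos// ltW. Qed.

Lemma drift_signed : (P x).-integrable setT (EFin \o theta xi) ->
  \int[P x]_w u w = sg * mu P xi x / r.
Proof. exact: Rintegral_signed. Qed.

End one_step_phi.

(** * Sign of the leading bracket *)

Section bracket.
Context {R : realType}.
Implicit Types p b c beta J C : R.

(** The main term is -|p| |b + c C|; the four errors, from the mean drift, from the integral, from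
    the small jumps and from the tails, may each take a quarter of it. *)
Lemma bracket_le0 p b c C beta (psi1 J e1 e2 : R) : p * (b + c * C) < 0 -> 0 <= c ->
  `|psi1 * beta - b| <= `|b + c * C| / 4 ->
  c * `|J - C| <= `|b + c * C| / 4 -> e1 <= `|b + c * C| / 4 ->
  e2 <= `|p| * `|b + c * C| / 4 ->
  p * psi1 * beta + c * (p * J) + `|p| * e1 + e2 <= 0.
Proof.
move=> pB c0 h1 h2 h3 h4; set B := b + c * C in pB h1 h2 h3 h4 *.
have pp := normr_ge0 p.
have -> : p * psi1 * beta + c * (p * J) = p * B + p * (psi1 * beta - b) + p * (c * (J - C)).
  by rewrite /B; ring.
have k0 : p * B = - (`|p| * `|B|) by rewrite -normrM ltr0_norm// opprK.
have k1 : p * (psi1 * beta - b) <= `|p| * (`|B| / 4).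
  by apply: (le_trans (ler_norm _)); rewrite normrM ler_wpM2l.
have k2 : p * (c * (J - C)) <= `|p| * (`|B| / 4).
  by apply: (le_trans (ler_norm _)); rewrite normrM ler_wpM2l// normrM ger0_norm.
have k3 : `|p| * e1 <= `|p| * (`|B| / 4) by rewrite ler_wpM2l.
rewrite k0; move: k1 k2 k3 h4; rewrite mulrA.
move: (`|p| * `|B|) (p * (psi1 * beta - b)) (p * (c * (J - C))) (`|p| * e1) => *; lra.
Qed.

Lemma psi_beta_close (psi1 beta b r eta : R) : 1 - 2 * r^-1 ^+ 2 <= psi1 <= 1 ->
  `|beta - b| <= eta -> (`|b| + eta) * 2 <= eta * r -> 1 <= r ->
  `|psi1 * beta - b| <= 2 * eta.
Proof.
move=> /andP[p1 p2] hb hr r1; have r0 : 0 < r by apply: lt_le_trans r1.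
have ri : r^-1 ^+ 2 <= r^-1.
  by rewrite expr2 ler_piMr ?invr_ge0 ?(ltW r0)// invf_le1.
have e0 : 0 <= eta by apply: le_trans hb; exact: normr_ge0.
have bb : `|beta| <= `|b| + eta.
  by rewrite -[beta](subrK b) (le_trans (ler_normD _ _))// addrC lerD2l.
have p1n : `|psi1 - 1| <= 2 * r^-1.
  rewrite ler0_norm ?subr_le0// opprB lerBlDr -lerBlDl (le_trans _ p1)//.
  by rewrite lerD2l lerN2 ler_wpM2l.
have -> : psi1 * beta - b = (psi1 - 1) * beta + (beta - b) by ring.
apply: (le_trans (ler_normD _ _)); rewrite (_ : 2 * eta = eta + eta); last by ring.
rewrite lerD// normrM.
apply: (le_trans (ler_pM (normr_ge0 _) (normr_ge0 _) p1n bb)).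
by rewrite mulrAC ler_pdivrMr// mulrC.
Qed.

End bracket.

(** * Asymptotic hypotheses in uniform form *)

Section uniform_drift.
Context {R : realType} {d : measure_display} {T : measurableType d}.
Variables (X : set R) (P : R -> probability T R) (xi : nat -> T -> R).

(** The drift condition read at x = sg * r: the mean jump is counted positive away from the origin,
    so both half-lines are treated at once. *)
Definition drift_limit (gam b : R) := forall eps : R, 0 < eps -> exists M : R,
  1 <= M /\ forall x sg, X x -> sg = 1 \/ sg = -1 -> M <= sg * x ->
  `|(sg * x) `^ gam * (sg * mu P xi x) - b| <= eps.

Lemma cond_D'_limit gam b : cond_D' X P xi gam b -> drift_limit gam b.
Proof.
move=> [_ h] eps /h[M hM]; exists (Num.max 1 M); split; first by rewrite le_max lexx.
move=> x sg Xx [->|->]; rewrite ge_max => /andP[x1 xM].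
  by move: xM; rewrite !mul1r; exact: (hM x Xx).1.
move: x1 xM; rewrite !mulN1r mulrN => x1 xM.
have [_ ] := hM x Xx; rewrite lerNr => /(_ xM).
have x0 : x < 0 by rewrite -oppr_gt0 (lt_le_trans _ x1).
by rewrite (ltr0_norm x0).
Qed.

(** Reduces gamma > alpha - 1 to the critical exponent alpha - 1 with b = 0. *)
Lemma drift_limit_faster gam gam' b : gam' < gam -> drift_limit gam b -> drift_limit gam' 0.
Proof.
move=> gg h eps e0; have [M1 [M11 h1]] := h 1 ltr01.
have g0 : 0 < gam - gam' by rewrite subr_gt0.
have [M2 [_ h2]] := @powR_small R (gam - gam') (`|b| + 1) eps g0 e0.
exists (Num.max M1 M2); split; first by rewrite le_max M11.
move=> x sg Xx sgP; rewrite ge_max => /andP[x1 x2].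
have r0 : 0 < sg * x by apply: lt_le_trans x1; exact: lt_le_trans M11.
have H1 : `|(sg * x) `^ gam * (sg * mu P xi x)| <= `|b| + 1.
  rewrite -[X in `|X|](subrK b) (le_trans (ler_normD _ _))// addrC lerD2l.
  exact: h1.
apply: le_trans (h2 _ x2); rewrite subr0.
have -> : (sg * x) `^ gam' * (sg * mu P xi x) =
    (sg * x) `^ gam * (sg * mu P xi x) * (sg * x) `^ (- (gam - gam')).
  rewrite mulrAC -powRD; last by rewrite (gt_eqF r0) implybT.
  by congr (_ `^ _ * _); ring.
by rewrite normrM [X in _ * X]ger0_norm ?powR_ge0// ler_wpM2r ?powR_ge0.
Qed.

(* The weight accounts for the variation of phi p (1/|x|) near 0, of order
   |x|^-p when p < 0; this is where case (v) needs a rate for the tails. *)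
Definition tail_error (al c p : R) := forall s0 eps : R, 0 < s0 -> 0 < eps ->
  exists M : R, forall x, X x -> M <= `|x| -> exists e, [/\ 0 <= e,
    e * (2 + `|x| `^ (- p)) <= eps &
    forall y, s0 * `|x| <= y -> `|y `^ al * tail (P x) (theta xi) y - c| <= e /\
      `|y `^ al * tail (P x) (\- theta xi) y - c| <= e].

(** For p > 0 and |x| >= 1 the weight is at most 3, so plain convergence of the tails suffices. *)
Lemma tail_error_pos al c p : cond_Tbal X P xi al c -> 0 < p -> tail_error al c p.
Proof.
move=> hT p0 s0 eps s00 e0; have [x0 [x00 h]] := Tbal_uniform hT.
have e30 : 0 < eps / 3 by rewrite divr_gt0.
have [Y [Y0 hY]] := h _ e30.
exists (Num.max 1 (Num.max x0 (Y / s0))) => x Xx; rewrite !ge_max => /and3P[x1 xx0 xY].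
exists (eps / 3); split; first exact: ltW.
  have : `|x| `^ (- p) <= 1.
    by rewrite powRN invf_le1 ?powR_gt0 ?(lt_le_trans _ x1)// -[leLHS](powRr0 `|x|) ler_powR// ltW.
  by nra.
move=> y hy; apply: hY => //; apply: le_trans hy.
by rewrite mulrC -ler_pdivrMr.
Qed.

(** The error is of order |x|^-del and the weight at most 3 |x|^-p; their product is of order
    |x|^-(del + p), which vanishes for p > - del. *)
Lemma tail_error_neg al c : cond_Tbal_strong X P xi al c ->
  exists del, 0 < del /\ forall p, p < 0 -> - del < p -> tail_error al c p.
Proof.
move=> [_ _ _ [x0 [x00 [del [del0 [C [Y h]]]]]]]; exists del; split => // p p0 pd s0 eps s00 e0.
have q0 : 0 < del + p by lra.
have [M [M1 hM]] := @powR_small R (del + p) (`|C| * s0 `^ (- del) * 3) eps q0 e0.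
exists (Num.max M (Num.max x0 (Num.max Y 0 / s0))) => x Xx.
rewrite !ge_max => /and3P[xM xx0 xY].
have r1 : 1 <= `|x| := le_trans M1 xM.
have r0 : 0 < `|x| by apply: lt_le_trans r1.
exists (`|C| * (s0 * `|x|) `^ (- del)); split; first by rewrite mulr_ge0 ?powR_ge0.
  apply: le_trans (hM _ xM).
  rewrite powRM ?(ltW r0) ?(ltW s00)// opprD powRD; last by rewrite (gt_eqF r0) implybT.
  have p1 : 1 <= `|x| `^ (- p) by rewrite -[leLHS](powRr0 `|x|) ler_powR//; lra.
  rewrite -!mulrA !ler_wpM2l ?powR_ge0// mulrCA ler_wpM2l ?powR_ge0//.
  by move: p1; move: (`|x| `^ (- p)) => z; lra.
move=> y hy; have : Num.max Y 0 <= y by apply: le_trans hy; rewrite mulrC -ler_pdivrMr.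
rewrite ge_max => /andP[Yy y0].
have xs : x0 <= x \/ x <= - x0.
  by move: xx0; rewrite ler_normr => /orP[]; [left|right; rewrite lerNr].
have := h y Yy x Xx xs; rewrite /tail_plus /tail_minus tail_pospE// tail_negpE//.
have le : C * y `^ (- del) <= `|C| * (s0 * `|x|) `^ (- del).
  apply: (@le_trans _ _ (`|C| * y `^ (- del))); first by rewrite ler_wpM2r ?powR_ge0// ler_norm.
  by rewrite ler_wpM2l// le_powR_nonpos// ?mulr_gt0// oppr_le0 ltW.
by move=> [h1 h2]; split; [apply: le_trans le|apply: le_trans le].
Qed.

End uniform_drift.

Lemma sign_norm {R : realType} (x : R) : exists sg, (sg = 1 \/ sg = -1) /\ sg * x = `|x|.
Proof.
have [x0|x0] := leP 0 x; first by exists 1; rewrite mul1r ger0_norm//; split => //; left.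
by exists (-1); rewrite mulN1r ltr0_norm//; split => //; right.
Qed.

Lemma norm_half_bounds {R : realType} (p : R) : `|p| <= 2^-1 -> -2 <= p /\ p <= 2.
Proof. by rewrite ler_norml => /andP[? ?]; split; lra. Qed.

(** * Superharmonicity of the two-sided function *)

Section superharmonic.
Context {R : realType} (X : set R) (k : R.-pker R ~> R)
  {d : measure_display} {T : measurableType d}
  (P : R -> probability T R) (xi : nat -> T -> R) (al c : R).
Hypothesis mc : markov_chain X k P xi.
Hypothesis hT : cond_Tbal X P xi al c.

Lemma phi_step x sg p b K e s0 eta : X x -> sg = 1 \/ sg = -1 -> 1 <= sg * x ->
  tails_le (P x) (theta xi) al K -> `|p| <= 2^-1 -> p != 0 -> 0 < s0 -> s0 <= 2^-1 -> 0 <= e ->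
  (forall y, s0 * (sg * x) <= y -> `|y `^ al * tail (P x) (theta xi) y - c| <= e /\
      `|y `^ al * tail (P x) (\- theta xi) y - c| <= e) ->
  p * (b + c * cotpi (al / 2)) < 0 ->
  `|(sg * x) `^ (al - 1) * (sg * mu P xi x) - b| <= eta ->
  2 * eta <= `|b + c * cotpi (al / 2)| / 4 ->
  (`|b| + eta) * 2 <= eta * (sg * x) ->
  c * `|Jint al p (sg * x)^-1 - cotpi (al / 2)| <= `|b + c * cotpi (al / 2)| / 4 ->
  2 * (28 * (K + c) * (s0 `^ (2 - al) / (2 - al))) <= `|b + c * cotpi (al / 2)| / 4 ->
  2 * (e * (`|p| * 28 * (s0 `^ (1 - al) / (al - 1)) + 8 * (2 + (sg * x) `^ (- p)))) <=
    `|p| * `|b + c * cotpi (al / 2)| / 4 ->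
  (kop k (EFin \o phi p 1) x <= (phi p 1 x)%:E)%E.
Proof.
have [a1 a2 c0 _] := hT.
move=> Xx sgP r1 tK ph p0 s00 s01 e0 te pB hb heta hr hJ hS0 he.
have r0 : 0 < sg * x by apply: lt_le_trans r1.
have h0 : 0 < (sg * x)^-1 by rewrite invr_gt0.
have h1 : (sg * x)^-1 <= 1 by rewrite invf_le1.
have ra := powR_ge0 (sg * x) (- al).
have mt := measurable_theta mc.
have tu := tails_le_signed sgP r0 tK.
have te' := tails_err_signed sgP r0 s00 te.
have [iu B] := drift_precise a1 a2 (measurable_signed sg (sg * x) mt) tu ph p0 h0 h1 s00 s01
  (mulr_ge0 (ltW c0) ra) (mulr_ge0 e0 ra) te'.
rewrite (kop_phi mc Xx sgP r0 iu) (phiE sgP r0) lee_fin ler_wpM2l ?powR_ge0//.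
move: B; rewrite drift_signed//; last exact: (integrable_rv a1 mt tK).
rewrite (powR_inv _ r0) => B.
have [pb1 pb2] := norm_half_bounds ph.
have hpb := psi_beta_close (psi1_bounds _ pb1 pb2) hb hr r1.
have Z := bracket_le0 pB (ltW c0) (le_trans hpb heta) hJ hS0 he.
(* The mean of the normalised jump is r^-al times a quantity close to b, so that r^-al factors out
   of every term and the sign of the bracket decides. *)
have em : sg * mu P xi x / (sg * x) = (sg * x) `^ (- al) *
    ((sg * x) `^ (al - 1) * (sg * mu P xi x)).
  rewrite mulrA -powRD; last by rewrite (gt_eqF r0) implybT.
  by rewrite addrA addNr add0r powR_inv1 ?ltW// mulrC.
move: B; rewrite em => /(le_trans (ler_norm _)).
move: Z (mulr_ge0_le0 ra Z).
move: (\int[_]_(_ in _) _) (phi p _ 1) (psi p _ 1) (Jint _ _ _) ((sg * x) `^ (- al)).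
move: ((sg * x) `^ (al - 1) * _) (s0 `^ (2 - al) / _) (s0 `^ (1 - al) / _) ((sg * x) `^ (- p)).
move=> be S0 S1 hp I ph1 ps J y _ Z le1.
rewrite -subr_le0; apply: le_trans Z; rewrite -subr_le0.
move: le1; rewrite -subr_le0; apply: le_trans.
by rewrite le_eqVlt; apply/orP; left; apply/eqP; ring.
Qed.

(** The order of the choices matters. The range of p comes from the limit of [Jint]; then s0 makes
    the jumps below s0 r negligible, relative to p; only then is the tail error chosen, since it is
    multiplied by s0^(1-al) and must be small relative to p; the threshold on |x| comes last. *)
Lemma phi_superharmonic b : drift_limit X P xi (al - 1) b -> b + c * cotpi (al / 2) != 0 ->
  exists p1, [/\ 0 < p1, p1 <= 2^-1 & forall p, p != 0 -> `|p| <= p1 ->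
    p * (b + c * cotpi (al / 2)) < 0 -> tail_error X P xi al c p ->
    exists r1, 1 <= r1 /\ forall x, X x -> r1 <= `|x| ->
      (kop k (EFin \o phi p 1) x <= (phi p 1 x)%:E)%E].
Proof.
have [a1 a2 c0 _] := hT; have a3 : 0 < 2 - al by lra.
move=> hb; set B := b + _ => B0; have Bp : 0 < `|B| by rewrite normr_gt0.
have [x0 [K hK]] := tails_uniform mc hT.
have kJ0 : 0 < `|B| / 4 / c by rewrite !divr_gt0.
have [eJ [eJ0 eJ1 hJ]] := Jint_lim a1 a2 kJ0.
exists eJ; split => // p p0 pe pB hte.
have ph : `|p| <= 2^-1 by apply: le_trans eJ1.
have np0 : 0 < `|p| by rewrite normr_gt0.
have p1 : `|p| <= 1 by apply: (le_trans ph); rewrite invf_le1// ler1n.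
have [Ms [Ms1 hMs]] := @powR_small R (2 - al) (2 * 28 * (K + c) / (2 - al)) (`|B| / 4) a3
  (divr_gt0 Bp (ltr0n _ 4)).
have M20 : 0 < 2 * Ms by rewrite mulr_gt0// (lt_le_trans _ Ms1).
(* The factor 2 ensures s0 <= 1/2, as Ms >= 1. *)
pose s0 := (2 * Ms)^-1.
have s00 : 0 < s0 by rewrite invr_gt0.
have s01 : s0 <= 2^-1 by rewrite lef_pV2 ?posrE// ler_peMr.
have hS0 : 2 * (28 * (K + c) * (s0 `^ (2 - al) / (2 - al))) <= `|B| / 4.
  rewrite /s0 powR_inv//; apply: le_trans (hMs (2 * Ms) _); last first.
    by rewrite ler_peMl ?ler1n// (le_trans _ Ms1).
  by rewrite le_eqVlt; apply/orP; left; apply/eqP; ring.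
pose S1 := s0 `^ (1 - al) / (al - 1).
have S10 : 0 <= S1 by rewrite divr_ge0 ?powR_ge0// subr_ge0 ltW.
have S128 : 0 <= 28 * S1 by rewrite mulr_ge0.
have D0 : 0 < 8 * (28 * S1 + 8) by apply: mulr_gt0; rewrite ?ltr0n// ltr_wpDl ?ltr0n// mulr_ge0// ler0n.
have eps0 : 0 < `|p| * `|B| / (8 * (28 * S1 + 8)) by rewrite divr_gt0// mulr_gt0.
have [M1 hM1] := hte s0 _ s00 eps0.
have eta0 : 0 < `|B| / 8 by rewrite divr_gt0.
have [M2 [_ hM2]] := hb _ eta0.
pose M3 := (`|b| + `|B| / 8) * 2 / (`|B| / 8).
exists (Num.max 1 (Num.max x0 (Num.max M1 (Num.max M2 (Num.max M3 eJ^-1))))).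
split; first by rewrite le_max lexx.
move=> x Xx; rewrite !ge_max => /and5P[x1 xx0 xM1 xM2 /andP[xM3 xeJ]].
have [sg [sgP sx]] := sign_norm x.
have [e [e0 he te]] := hM1 x Xx xM1.
move: (x1) (xM2) (xM3) (xeJ) he te; rewrite -sx => y1 yM2 yM3 yeJ he te.
have y0 : 0 < sg * x by apply: lt_le_trans y1.
apply: (@phi_step x sg p b K e s0 (`|B| / 8)) => //.
- exact: hK.
- exact: hM2.
- by rewrite le_eqVlt; apply/orP; left; apply/eqP; rewrite -/B; field.
- by rewrite [_ / 8 * _]mulrC -ler_pdivrMr.
- rewrite mulrC -ler_pdivlMr// -/B; apply: hJ => //; first by rewrite invr_gt0.
  by rewrite invf_ple ?posrE.
- have W0 := powR_ge0 (sg * x) (- p).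
  have : `|p| * 28 * S1 + 8 * (2 + (sg * x) `^ (- p)) <= (28 * S1 + 8) * (2 + (sg * x) `^ (- p)).
    rewrite [leRHS]mulrDl lerD2r; apply: (@le_trans _ _ (28 * S1)).
      by rewrite -mulrA; apply: ler_piMl.
    by apply: ler_peMr => //; apply: (@le_trans _ _ 2); rewrite ?ler1n// lerDl.
  move=> /(ler_wpM2l e0) le2; rewrite -/S1 -/B.
  apply: (@le_trans _ _ (2 * (e * ((28 * S1 + 8) * (2 + (sg * x) `^ (- p)))))).
    by rewrite ler_wpM2l.
  move: he; rewrite ler_pdivlMr// => he.
  rewrite ler_pdivlMr//; apply: le_trans he.
  by rewrite le_eqVlt; apply/orP; left; apply/eqP; ring.
Qed.

End superharmonic.

(** * Recurrence and positive recurrence *)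

Section recurrence.
Context {R : realType}.
Implicit Types p z M : R.

Lemma phi_ge_powR p h z : 0 <= p -> `|z| `^ p <= phi p h z.
Proof.
move=> p0; rewrite /phi -powR_sqr; apply: ge0_ler_powR; rewrite ?nnegrE ?divr_ge0 ?sqr_ge0//.
  by rewrite addr_ge0 ?sqr_ge0.
by rewrite lerDr sqr_ge0.
Qed.

Lemma phi_le_powR p h z : p <= 0 -> z != 0 -> phi p h z <= `|z| `^ p.
Proof.
move=> p0 z0; rewrite /phi -powR_sqr; apply: le_powR_nonpos.
- by rewrite pmulr_lle0.
- by rewrite exprn_even_gt0//= z0.
- by rewrite lerDr sqr_ge0.
Qed.

Lemma phi_level_bounded p M : 0 < p -> exists L, forall z, phi p 1 z <= M -> `|z| <= L.
Proof.
move=> p0; exists (Num.max M 0 `^ p^-1) => z hz.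
have -> : `|z| = (`|z| `^ p) `^ p^-1 by rewrite -powRrM divff ?gt_eqF// powRr1.
apply: ge0_ler_powR; rewrite ?nnegrE ?powR_ge0 ?invr_ge0 ?(ltW p0) ?le_max ?lexx ?orbT//.
by rewrite (le_trans (phi_ge_powR 1 z (ltW p0)) hz).
Qed.

Lemma measurable_norm_gt M : measurable [set z : R | M < `|z|].
Proof. by apply: measurable_set_ltr => //; exact: measurableT_comp. Qed.

Lemma measurable_phi p : measurable_fun setT (phi p 1 : R -> R).
Proof. by apply: continuous_measurable_fun; exact: continuous_phi. Qed.

(** The angle pi al / 2 lies in the second quadrant. This makes the bracket negative when b = 0,
    hence recurrence for gamma > alpha - 1. *)
Lemma cotpi_lt0 (al : R) : 1 < al -> al < 2 -> cotpi (al / 2) < 0.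
Proof.
move=> a1 a2; have P := pi_gt0 R.
have s0 : 0 < sin (pi * (al / 2)) by apply: sin_pi_gt0; apply/andP; split; lra.
rewrite /cotpi pmulr_rlt0// pmulr_llt0 ?invr_gt0//.
have -> : pi * (al / 2) = pi - pi * (1 - al / 2) by ring.
rewrite cosB sinpi cospi mul0r addr0 mulN1r oppr_lt0.
by apply: cos_gt0_pihalf; apply/andP; split; nra.
Qed.

Context (X : set R) (k : R.-pker R ~> R) {d : measure_display} {T : measurableType d}
  (P : R -> probability T R) (xi : nat -> T -> R) (al c : R).
Hypothesis mc : markov_chain X k P xi.
Hypothesis hN : cond_N' X P xi.
Hypothesis hT : cond_Tbal X P xi al c.

Lemma returns_io b : drift_limit X P xi (al - 1) b -> b + c * cotpi (al / 2) < 0 ->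
  exists r1, forall x, X x ->
    {ae P x, forall w, forall N, exists2 n, (N <= n)%N & `|xi n w| <= r1}.
Proof.
have [mX kX _ _] := mc.
move=> hb B0; have [p1 [p10 p12 h]] := phi_superharmonic mc hT hb (ltr0_neq0 B0).
have [] := h p1 (lt0r_neq0 p10); rewrite ?gtr0_norm ?pmulr_rlt0//.
  exact: tail_error_pos.
move=> r1 [r11 hr]; exists r1 => x Xx.
have st y : X y -> forall e : R, 0 < e -> exists N, forall n, (N <= n)%N ->
    (stay k [set z | (r1 < `|z|)%R] n y <= e%:E)%E.
  move=> Xy e e0; apply: (stay_cvg0 mX kX _ (measurable_norm_gt r1) (measurable_phi p1)) => //.
  - by move=> D L mD DL z Xz e' e'0; exact: (stay_bounded_cvg0 mc hN mD DL Xz e'0).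
  - by move=> z; exact: phi_ge0.
  - by move=> z Xz /= /ltW; exact: hr.
  - move=> M; have [L hL] := phi_level_bounded M p10; exists L => z _; exact: hL.
apply: filterS (exits_io mc (measurable_norm_gt r1) Xx st) => w hw N.
by have [n Nn /negP] := hw N; rewrite -leNgt => hn; exists n.
Qed.

Lemma recurrent_of b : drift_limit X P xi (al - 1) b -> b + c * cotpi (al / 2) < 0 ->
  recurrent X P xi.
Proof.
move=> hb B0; have [r1 h] := returns_io hb B0; exists r1 => x Xx.
apply: filterS (h x Xx) => w hw eps e0 N; have [n Nn hn] := hw N.
by exists n => //; rewrite (le_trans hn)// lerDl ltW.
Qed.

End recurrence.

(** * Null recurrence *)

Section null.
Context {R : realType}.
Implicit Types (h y : R).

(** With y = x/h, a mean drift of order |x|^(1-al) contributes |psi(y)| |y|^(1-al) h^-al. The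
    product in y is at most |y|^(2-al) near 0 and |y|^(-2-al) at infinity, so it is bounded
    uniformly in the ratio of x to h. *)
Lemma psi_null_le al y : 1 < al -> al < 2 -> y != 0 ->
  `|psi (-2) 1 y| * `|y| `^ (1 - al) <= 1.
Proof.
move=> a1 a2 y0; have n0 : 0 < `|y| by rewrite normr_gt0.
have m (q : R) : `|y| `^ q * `|y| `^ (1 - al) = `|y| `^ (q + (1 - al)).
  by rewrite powRD// (gt_eqF n0) implybT.
have q1 : 0 <= 1 + (1 - al) by lra.
have q2 : -2 - 1 + (1 - al) <= 0 by lra.
have [y1|y1] := leP `|y| 1.
  apply: (@le_trans _ _ (`|y| `^ 1 * `|y| `^ (1 - al))).
    rewrite ler_wpM2r ?powR_ge0// powRr1 ?(ltW n0)// /psi normrM ler_piMr//.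
    rewrite ger0_norm ?powR_ge0// -[leRHS](powRr0 (1 ^+ 2 + y ^+ 2)).
    apply: ler_powR; last by lra.
    by rewrite expr1n lerDl sqr_ge0.
  rewrite m; apply: (@le_trans _ _ (1 `^ (1 + (1 - al)))); last by rewrite powR1.
  by apply: ge0_ler_powR; rewrite ?nnegrE ?(ltW n0).
apply: (@le_trans _ _ (`|y| `^ (-2 - 1) * `|y| `^ (1 - al))).
  by rewrite ler_wpM2r ?powR_ge0//; apply: psi_abs_le => //; lra.
by rewrite m -[leRHS](powRr0 `|y|); apply: ler_powR; rewrite ?(ltW y1).
Qed.

Lemma phi_nullE y : phi (-2) 1 y = (1 + y ^+ 2)^-1.
Proof.
have e : -2 / 2 = - 1 :> R by lra.
by rewrite /phi expr1n e powRN powRr1// addr_ge0 ?sqr_ge0.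
Qed.

Context (X : set R) (k : R.-pker R ~> R) {d : measure_display} {T : measurableType d}
  (P : R -> probability T R) (xi : nat -> T -> R) (al c : R).
Hypothesis mc : markov_chain X k P xi.
Hypothesis hT : cond_Tbal X P xi al c.

(** The point is uniformity in x, also for |x| far below or above h: [psi_null_le] takes care of the
    mean drift, [drift_null] of the tails. A time of order h^al is thus needed for a rise of order
    1. *)
Lemma null_drift b : drift_limit X P xi (al - 1) b -> exists x1 C, [/\ 1 <= x1, 0 < C &
  forall h x, 0 < h -> X x -> x1 <= `|x| ->
    (kop k (EFin \o (fun z => phi (-2) 1 (z / h))) x <=
     (phi (-2) 1 (x / h) + C * h `^ (- al))%:E)%E].
Proof.
have [a1 a2 c0 _] := hT; have mt := measurable_theta mc.
move=> /(_ 1 ltr01)[M [M1 hM]]; have [x0 [K hK]] := tails_uniform mc hT.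
exists (Num.max x0 M), (2 * (`|b| + 1) + 2 * `|K| * (10 * Cweight al 0)).
split; first by rewrite le_max M1 orbT.
  by rewrite ltr_pwDl ?mulr_ge0 ?Cweight_ge0// mulr_gt0// ltr_wpDl.
move=> h x h0 Xx; rewrite ge_max => /andP[xx0 xM].
have s1 : (1 : R) = 1 \/ (1 : R) = -1 by left.
have tK := hK x Xx xx0; have tu := tails_le_signed s1 h0 tK.
have [iu B] := @drift_null R _ T (P x) _ al _ a1 a2 (measurable_signed 1 h mt) tu (x / h).
have E w : phi (-2) 1 ((x + theta xi w) / h) = phi (-2) 1 (x / h + signed 1 h (theta xi) w).
  by rewrite /signed mul1r mulrDl.
have mphi : measurable_fun setT (fun z : R => phi (-2) 1 (z / h)).
  by apply: measurableT_comp; [exact: measurable_phi|exact: measurable_funM].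
rewrite (kop_Rintegral mc Xx mphi (fun z : R => phi_ge0 (-2) 1 (z / h))); last first.
  by apply: eq_integrable iu => // w _; rewrite /= E.
rewrite lee_fin (_ : Rintegral _ _ _ = \int[P x]_w phi (-2) 1 (x / h + signed 1 h (theta xi) w)); last first.
  by apply: eq_Rintegral => w _; exact: E.
move: B; rewrite Rintegral_signed; last exact: (integrable_rv a1 mt tK).
have x0' : 0 < `|x| by rewrite (lt_le_trans _ xM)// (lt_le_trans _ M1).
have xnz : x != 0 by rewrite -normr_gt0.
have xn0 : x / h != 0 by rewrite mulf_neq0// invr_eq0 gt_eqF.
have hal := powR_ge0 h (- al).
have hmu : `|psi (-2) 1 (x / h) * (1 * mu P xi x / h)| <= (`|b| + 1) * h `^ (- al).
  have [sg [sgP sx]] := sign_norm x.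
  have := hM x sg Xx sgP; rewrite sx => /(_ xM) h1.
  have h2 : `|x| `^ (al - 1) * `|mu P xi x| <= `|b| + 1.
    have -> : `|x| `^ (al - 1) * `|mu P xi x| = `| `|x| `^ (al - 1) * (sg * mu P xi x)|.
      rewrite normrM ger0_norm ?powR_ge0// normrM.
      by case: sgP => ->; rewrite ?normrN normr1 mul1r.
    by rewrite -[X in `|X| <= _](subrK b) (le_trans (ler_normD _ _))// addrC lerD2l.
  rewrite mul1r normrM.
  have -> : `|mu P xi x / h| = `|x / h| `^ (1 - al) * (`|x| `^ (al - 1) * `|mu P xi x|) * h `^ (- al).
    have -> : `|x / h| `^ (1 - al) = (`|x| `^ (al - 1))^-1 * h `^ (al - 1).
      rewrite normrM normfV (gtr0_norm h0) powRM ?invr_ge0 ?(ltW h0)//.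
      by rewrite powR_inv// -powRN; congr (_ `^ _ * _ `^ _); ring.
    have -> : h `^ (- al) = (h `^ (al - 1))^-1 * h^-1.
      rewrite -powRN -{3}[h](powRr1 (ltW h0)) -powRN -powRD; last by rewrite (gt_eqF h0) implybT.
      by congr (_ `^ _); ring.
    rewrite normrM normfV (gtr0_norm h0); field.
    by rewrite !gt_eqF ?powR_gt0.
  rewrite [leLHS]mulrA; apply: ler_wpM2r => //.
  rewrite [leLHS]mulrA -[leRHS]mul1r; apply: ler_pM; rewrite ?mulr_ge0 ?powR_ge0//.
  exact: psi_null_le.
have -> : \int[P x]_w theta xi w = mu P xi x by [].
have W0 : 0 <= 10 * Cweight al 0 by rewrite mulr_ge0 ?Cweight_ge0.
have KK : K * h `^ (- al) * (10 * Cweight al 0) <= `|K| * h `^ (- al) * (10 * Cweight al 0).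
  by do 2 apply: ler_wpM2r => //; exact: ler_norm.
move=> /(le_trans (ler_norm _)); rewrite -[in X in X -> _]mulrA.
move: hmu KK; move: (10 * Cweight al 0) (h `^ (- al)) (psi (-2) 1 (x / h) * _).
move: (Rintegral _ _ _) (phi (-2) 1 _) (`|b| + 1) `|K| => I F b1 K1 W y q.
rewrite ler_norml => /andP[q1 q2]; have -> : (2 * b1 + 2 * K1 * W) * y = 2 * (b1 * y) + 2 * (K1 * y * W).
  by ring.
rewrite -[2 * (K * y) * W]mulrA.
by move: q1; move: (b1 * y) (K1 * y * W) (K * y * W) => b2 K2 K3 q1 kk; lra.
Qed.

Lemma harmonic_series_infty (f : nat -> \bar R) (c3 : R) : 0 < c3 -> (forall n, 0 <= f n)%E ->
  (forall n, (c3 / n.+1%:R)%:E <= f n)%E -> (\sum_(0 <= n <oo) f n = +oo)%E.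
Proof.
move=> c30 f0 hf; apply: contrapT => fin.
have S0 : (0 <= \sum_(0 <= n <oo) f n)%E by exact: nneseries_ge0.
have [s Es] : exists s : R, (\sum_(0 <= n <oo) f n = s%:E)%E.
  by move: S0 fin; case: (limn _) => [s _ _|//|//]; exists s.
apply: (@dvg_harmonic R); apply: nondecreasing_is_cvgn.
  apply/nondecreasing_seqP => n; rewrite /series/= big_nat_recr//= lerDl.
  by rewrite invr_ge0.
exists (s / c3) => _ [n _ <-]; rewrite ler_pdivlMr// -lee_fin -Es.
apply: le_trans (@nneseries_lim_ge R f xpredT 0 n _); last by move=> m _ _; exact: f0.
rewrite /series/= mulr_suml -sumEFin; apply: lee_sum => i _.
by rewrite mulrC; exact: hf.
Qed.

(* h n is of order n^(1/al): from distance 3 h n the chain stays outside [-a, a]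
   during n steps with probability at least 1/2, and it jumps that far with
   probability of order 1/n. *)
Lemma stay_lower b : drift_limit X P xi (al - 1) b -> exists a0, forall a x, a0 <= a -> X x ->
  a < `|x| -> exists c3, 0 < c3 /\ forall n,
    ((c3 / n.+1%:R)%:E <= stay k [set z | (a < `|z|)%R] n.+1 x)%E.
Proof.
have [mX kX _ _] := mc; have mt := measurable_theta mc.
have [a1 a2 c0 _] := hT; have al0 : 0 < al by apply: lt_trans a1.
move=> hb; have [x1 [C [x11 C0 hC]]] := null_drift hb.
have [x0 [x00 hU]] := Tbal_uniform hT.
have c20 : 0 < c / 2 by rewrite divr_gt0.
have [Y [Y0 hY]] := hU _ c20.
exists (Num.max x0 x1) => a x; rewrite ge_max => /andP[ax0 ax1] Xx ax.
have aa1 : 1 <= a := le_trans x11 ax1.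
pose A := [set z : R | a < `|z|].
have mA : measurable A by exact: measurable_norm_gt.
pose m := Num.max `|x| Y; have m1 : 1 <= m by rewrite le_max (le_trans aa1 (ltW ax)).
have m0 : 0 < m by apply: lt_le_trans m1.
pose D := m `^ al; have D0 : 0 < D by rewrite powR_gt0.
(* During n steps the mean of [g n] rises by at most 2 C n / H n <= 1/8; the summand D keeps h n
   above |x| and above the threshold Y of the tail estimate. *)
pose H n := 16 * C * n%:R + D.
have H0 n : 0 < H n by rewrite ltr_wpDl// !mulr_ge0// ltW.
pose h n := H n `^ al^-1.
have h0 n : 0 < h n by rewrite powR_gt0.
have hal n : h n `^ (- al) = (H n)^-1.
  by rewrite -powRrM mulrN mulVf ?gt_eqF// powR_inv1// ltW.
have hm n : m <= h n.
  have -> : m = D `^ al^-1 by rewrite /D -powRrM divff ?gt_eqF// powRr1// ltW.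
  apply: ge0_ler_powR; rewrite ?nnegrE ?invr_ge0 ?(ltW al0) ?(ltW D0) ?(ltW (H0 n))//.
  by rewrite /H lerDr !mulr_ge0// ltW.
have xh n : `|x| <= h n by apply: le_trans (hm n); rewrite le_max lexx.
have Yh n : Y <= h n by apply: le_trans (hm n); rewrite le_max lexx orbT.
(* The factor 2 gives g n >= 1 on |z| <= h n, which contains [-a, a]. At |y| >= 3 h n it is at most
   2/10, and 1 - 1/5 - 1/8 >= 1/2. *)
pose g n (z : R) := 2 * phi (-2) 1 (z / h n).
have mg n : measurable_fun setT (g n).
  apply: measurable_funM => //.
  by apply: measurableT_comp; [exact: measurable_phi|exact: measurable_funM].
have g0 n z : 0 <= g n z by rewrite mulr_ge0// phi_ge0.
have half n y : X y -> 3 * h n <= `|y| -> ((2^-1)%:E <= stay k A n y)%E.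
  move=> Xy hy.
  have e0 : 0 <= 2 * (C * (H n)^-1) by rewrite !mulr_ge0 ?invr_ge0 ?(ltW C0) ?(ltW (H0 n)).
  have kg z : X z -> A z -> (kop k (EFin \o g n) z <= (g n z + 2 * (C * (H n)^-1))%:E)%E.
    move=> Xz /= az; have := hC (h n) z (h0 n) Xz (le_trans ax1 (ltW az)).
    rewrite hal => hk.
    have -> : kop k (EFin \o g n) z = (2%:E * kop k (EFin \o (fun z => phi (-2) 1 (z / h n))%R) z)%E.
      rewrite /kop -ge0_integralZl//.
      - apply/measurable_EFinP.
        by apply: measurableT_comp; [exact: measurable_phi|exact: measurable_funM].
      - by move=> w _; rewrite lee_fin phi_ge0.
    rewrite /g -mulrDr EFinM; apply: lee_wpmul2l; [by rewrite lee_fin|exact: hk].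
  have gA z : ~ A z -> 1 <= g n z.
    move=> /negP; rewrite -leNgt => za; rewrite /g phi_nullE ler_pdivlMr ?ltr_wpDr ?sqr_ge0// mul1r.
    have z1 : `|z / h n| <= 1.
      rewrite normrM normfV (gtr0_norm (h0 n)) ler_pdivrMr// mul1r.
      by rewrite (le_trans za)// (le_trans (ltW ax)).
    have : `|z / h n| ^+ 2 <= 1 by rewrite expr_le1.
    by rewrite real_normK ?num_real//; move: (_ ^+ 2) => t; lra.
  have gy : g n y <= 5^-1.
    rewrite /g phi_nullE; have y3 : 3 <= `|y / h n|.
      by rewrite normrM normfV (gtr0_norm (h0 n)) ler_pdivlMr.
    have : 3 ^+ 2 <= `|y / h n| ^+ 2 by rewrite ler_pXn2r ?nnegrE.
    rewrite real_normK ?num_real// (expr2 3); move: ((y / h n) ^+ 2) => t t9.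
    have t1 : 0 < 1 + t by lra.
    by rewrite ler_pdivrMr//; lra.
  have ne : n%:R * (2 * (C * (H n)^-1)) <= 8^-1.
    have -> : n%:R * (2 * (C * (H n)^-1)) = 2 * C * n%:R / H n by ring.
    rewrite ler_pdivrMr// /H.
    have : 0 <= C * n%:R by rewrite mulr_ge0// ltW.
    have -> : 2 * C * n%:R = 2 * (C * n%:R) by ring.
    have -> : 16 * C * n%:R = 16 * (C * n%:R) by ring.
    by move: (C * n%:R) => t t0; have := D0; lra.
  have := exit_slow mX kX n Xy mA (mg n) (g0 n) e0 kg gA.
  rewrite addeC -leeBlDr// => /(le_trans _); apply.
  rewrite -EFinB lee_fin; move: gy ne; move: (g n y) (n%:R * _) => p q; lra.
pose c3 := c / 4 * 4 `^ (- al) / (16 * C + D).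
have CD : 0 < 16 * C + D by rewrite addr_gt0// mulr_gt0.
exists c3; split; first by rewrite /c3 !mulr_gt0 ?powR_gt0 ?invr_gt0.
move=> n; rewrite staySin//.
pose E := [set z : R | 3 * h n <= `|z|].
have mE : measurable E.
  have mn : measurable_fun setT (fun z : R => `|z|) by exact: measurableT_comp.
  rewrite -[X in measurable X]setTI.
  by have := measurable_fun_ler (measurable_cst (3 * h n)) mn; apply.
pose F z : R := 2^-1 * \1_E z.
have mF : measurable_fun setT F by apply: measurable_funM => //; exact: measurable_indic.
have F0 z : 0 <= F z by rewrite mulr_ge0.
apply: (@le_trans _ _ (kop k (EFin \o F) x)); last first.
  apply: (le_kop mX kX Xx) => //.
  - by move=> y; exact: stay_ge0.
  - exact/measurable_EFinP.
  - exact: measurable_stay.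
  - move=> y Xy /=; rewrite /F indicE; have [yE|yE] := boolP (y \in E).
      by rewrite mulr1; apply: half => //; move: yE; rewrite inE.
    by rewrite mulr0 stay_ge0.
rewrite (kopE mc Xx mF F0).
(* As x >= - h n, such a jump lands beyond 3 h n, whatever the sign of x. *)
pose G := [set w | 4 * h n < theta xi w].
have mG : measurable G by exact: measurable_set_ltr.
apply: (@le_trans _ _ (\int[P x]_w (2^-1 * \1_G w)%:E)%E); last first.
  apply: ge0_le_integral => //.
  - by apply/measurable_EFinP; apply: measurable_funM => //; exact: measurable_indic.
  - apply/measurable_EFinP; apply: measurableT_comp => //.
    by apply: measurable_funD => //; exact: measurable_cst.
  - move=> w _; rewrite lee_fin /F ler_wpM2l// !indicE.
    have [wG|] := boolP (w \in G); last by rewrite ler0n.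
    rewrite mem_set//= /E /=; move: wG; rewrite inE /G /= => tw.
    have xh' : - h n <= x by move: (xh n); rewrite ler_norml => /andP[].
    apply: le_trans (ler_norm _).
    have -> : 3 * h n = - h n + 4 * h n by ring.
    by rewrite lerD// ltW.
have -> : (\int[P x]_w (2^-1 * \1_G w)%:E)%E = (2^-1 * tail (P x) (theta xi) (4 * h n))%:E.
  under eq_integral do rewrite EFinM.
  rewrite ge0_integralZl//; last by apply/measurable_EFinP; exact: measurable_indic.
  rewrite integral_indic// setIT EFinM /tail fineK//.
  by rewrite fin_num_measure.
have Y4 : Y <= 4 * h n by rewrite (le_trans (Yh n))// ler_peMl ?ler1n// ltW.
have [] := hY (4 * h n) x Y4 Xx (le_trans ax0 (ltW ax)).
rewrite ler_norml => /andP[+ _] _; move: (tail _ _ _) => t ht.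
have P4 : 0 < (4 * h n) `^ al by rewrite powR_gt0// mulr_gt0.
have tl : c / 2 * (4 `^ (- al) * (H n)^-1) <= t.
  have -> : 4 `^ (- al) * (H n)^-1 = ((4 * h n) `^ al)^-1.
    by rewrite -hal -powRM ?(ltW (h0 n))// powRN.
  rewrite (ler_pdivrMr _ _ P4) [t * _]mulrC; apply: (@le_trans _ _ (- (c / 2) + c)).
    by rewrite [X in _ <= _ + X]splitr addKr.
  by rewrite -lerBrDr.
rewrite lee_fin; apply: (@le_trans _ _ (2^-1 * (c / 2 * (4 `^ (- al) * (H n)^-1)))); last first.
  by rewrite ler_wpM2l.
have Hn : H n <= (16 * C + D) * n.+1%:R.
  rewrite /H [leRHS]mulrDl; apply: lerD; first by rewrite ler_wpM2l ?mulr_ge0 ?(ltW C0)// ler_nat.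
  by rewrite ler_peMr ?ler1n// ltW.
have -> : c3 / n.+1%:R = c / 4 * 4 `^ (- al) * ((16 * C + D) * n.+1%:R)^-1.
  by rewrite /c3 invfM; ring.
have -> : 2^-1 * (c / 2 * (4 `^ (- al) * (H n)^-1)) = c / 4 * 4 `^ (- al) * (H n)^-1.
  by field; rewrite gt_eqF.
rewrite ler_wpM2l ?mulr_ge0 ?powR_ge0 ?divr_ge0 ?(ltW c0)//.
by rewrite lef_pV2 ?posrE// mulr_gt0.
Qed.

Lemma null_of b : drift_limit X P xi (al - 1) b ->
  exists a0 : R, forall a : R, a0 <= a -> forall x : R, X x -> a < `|x| -> (\int[P x]_w tau xi a w = +oo)%E.
Proof.
move=> hb; have [a0 h] := stay_lower hb; exists a0 => a aa x Xx ax.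
have [c3 [c30 hs]] := h a x aa Xx ax.
rewrite (expectation_tau mc)//; apply: (harmonic_series_infty c30 _ hs) => n.
exact: stay_ge0.
Qed.

End null.

(** * Positive recurrence *)

Section ratio.
Context {R : realType}.
Implicit Types gam r m p : R.

Lemma drift_ratio gam r m : 0 < r -> m / r = r `^ gam * m * r `^ (- (1 + gam)).
Proof.
move=> r0; rewrite mulrAC -powRD; last by rewrite (gt_eqF r0) implybT.
have -> : gam + - (1 + gam) = -1 by ring.
by rewrite powR_inv1 ?ltW// mulrC.
Qed.

Lemma half_psi1 p r : -2 <= p -> p <= 2 -> 2 <= r -> 2^-1 <= psi p r^-1 1 <= 1.
Proof.
move=> p1 p2 r2; have /andP[h1 ->] := psi1_bounds r^-1 p1 p2; rewrite andbT.
apply: le_trans h1; have r0 : 0 < r by apply: lt_le_trans r2.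
have ri : r^-1 <= 2^-1 by rewrite lef_pV2 ?posrE.
have ri0 : 0 <= r^-1 by rewrite invr_ge0 ltW.
by rewrite expr2; move: ri ri0; move: r^-1 => s; nra.
Qed.

Lemma scaled_drift_le p (s b be : R) : 1 <= p -> 2^-1 <= s -> b < 0 -> be <= b / 2 ->
  p * (s * be) <= b / 4.
Proof.
move=> p1 s1 b0 hb; have be0 : be < 0 by lra.
have h1 : s * be <= b / 4.
  have h : (s - 2^-1) * be <= 0 by rewrite mulr_ge0_le0 ?subr_ge0// ltW.
  have -> : s * be = (s - 2^-1) * be + be / 2 by field.
  by move: h; move: (_ * be) => z; lra.
apply: le_trans h1; rewrite -[leRHS]mul1r ler_wnM2r// mulr_ge0_le0 ?(ltW be0)//.
by rewrite (le_trans _ s1).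
Qed.

Lemma le_half_of_close (b be : R) : `|be - b| <= - b / 2 -> be <= b / 2.
Proof. by rewrite ler_norml => /andP[_ ?]; lra. Qed.

Lemma lyapunov_sum_le (b y1 y2 y3 y4 : R) : y4 <= - b / 8 -> y3 <= b / 4 ->
  y1 - y2 - y3 <= y4 -> y1 + - b / 8 <= y2.
Proof. lra. Qed.

End ratio.

Section positive.
Context {R : realType} (X : set R) (k : R.-pker R ~> R)
  {d : measure_display} {T : measurableType d}
  (P : R -> probability T R) (xi : nat -> T -> R) (al c : R).
Hypothesis mc : markov_chain X k P xi.
Hypothesis hT : cond_Tbal X P xi al c.

(** For p = 1 + gam the mean drift contributes r^p r^-(1+gam), of order 1, whereas the tails
    contribute r^(p-al), which vanishes. The main term is at most b/4 and the error at most -b/8,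
    which leaves a decrease of -b/8. *)
Lemma lyapunov_positive gam b : 0 <= gam -> gam < al - 1 -> b < 0 ->
  drift_limit X P xi gam b -> exists r1, 0 < r1 /\ forall x, X x -> r1 <= `|x| ->
    (kop k (EFin \o phi (1 + gam) 1) x + (- b / 8)%:E <= (phi (1 + gam) 1 x)%:E)%E.
Proof.
have [a1 a2 c0 _] := hT; have mt := measurable_theta mc.
move=> g0 ga b0 hb; set p := 1 + gam.
have p1 : 1 <= p by rewrite /p lerDl.
have pal : p < al by rewrite /p -ltrBrDl.
have p2 : p <= 2 by rewrite ltW// (lt_trans pal).
have pm2 : -2 <= p by rewrite (le_trans _ p1).
have q0 : 0 < al - p by rewrite subr_gt0.
have mb0 : 0 < - b / 8 by rewrite divr_gt0// oppr_gt0.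
have mb2 : 0 < - b / 2 by rewrite divr_gt0// oppr_gt0.
have [x0 [K hK]] := tails_uniform mc hT.
pose C1 := p * (Kpsi p + 5) * Cweight al (p - 1).
have [M1 [_ hM1]] := @powR_small R (al - p) (2 * K * C1) _ q0 mb0.
have [M2 [_ hM2]] := hb _ mb2.
exists (Num.max 2 (Num.max x0 (Num.max M1 M2))); split; first by rewrite lt_max ltr0n.
move=> x Xx; rewrite !ge_max => /and4P[x2 xx0 xM1 xM2].
have [sg [sgP sx]] := sign_norm x; have tK := hK x Xx xx0.
move: x2 xM1 xM2; rewrite -sx => r2 rM1 rM2.
have r0 : 0 < sg * x by apply: lt_le_trans r2.
have h0 : 0 < (sg * x)^-1 by rewrite invr_gt0.
have tu := tails_le_signed sgP r0 tK.
have [iu B] := drift_phi_ge1 a1 a2 (measurable_signed sg (sg * x) mt) tu p1 pal h0.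
rewrite (kop_phi mc Xx sgP r0 iu) (phiE sgP r0) -EFinD lee_fin.
move: B; rewrite drift_signed//; last exact: (integrable_rv a1 mt tK).
rewrite (@drift_ratio R gam _ _ r0) => /(le_trans (ler_norm _)).
have := half_psi1 pm2 p2 r2; have := hM2 x sg Xx sgP rM2; have := hM1 _ rM1.
rewrite -/C1 -/p; move: (_ `^ gam * _) (Rintegral _ _ _) (phi p _ 1) (psi p _ 1) => be I ph1 ps h1 h2 h3.
have rp : 0 < (sg * x) `^ p by rewrite powR_gt0.
have e1 : (sg * x) `^ p * (sg * x) `^ (- p) = 1 by rewrite powRN divff// gt_eqF.
have e2 : (sg * x) `^ p * (sg * x) `^ (- al) = (sg * x) `^ (- (al - p)).
  by rewrite -powRD; [congr (_ `^ _); ring|rewrite (gt_eqF r0) implybT].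
move=> /(ler_wpM2l (ltW rp)).
have -> : (sg * x) `^ p * (I - ph1 - p * ps * (be * (sg * x) `^ (- p))) =
    (sg * x) `^ p * I - (sg * x) `^ p * ph1 - p * (ps * be).
  transitivity ((sg * x) `^ p * I - (sg * x) `^ p * ph1 -
    ((sg * x) `^ p * (sg * x) `^ (- p)) * (p * (ps * be))); first by ring.
  by rewrite e1 mul1r.
have -> : (sg * x) `^ p * (2 * (K * (sg * x) `^ (- al)) * C1) =
    2 * K * C1 * (sg * x) `^ (- (al - p)) by rewrite -e2; ring.
have be2 := le_half_of_close h2.
have /andP[s1 _] := h3.
have pb := scaled_drift_le p1 s1 b0 be2.
move: h1 pb.
move: (_ * I) (_ * ph1) (p * _) (_ * _ `^ _) => y1 y2 y3 y4 h1 pb.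
exact: lyapunov_sum_le.
Qed.

Lemma positive_of gam b : 0 <= gam -> gam < al - 1 -> b < 0 ->
  drift_limit X P xi gam b -> positive_recurrent X P xi.
Proof.
have [mX kX _ _] := mc.
move=> g0 ga b0 hb; have [r1 [r10 h]] := lyapunov_positive g0 ga b0 hb.
have e0 : 0 < - b / 8 by rewrite divr_gt0// oppr_gt0.
exists r1 => a ra x Xx; rewrite (expectation_tau mc)//.
apply: (@le_lt_trans _ _ (phi (1 + gam) 1 x / (- b / 8))%:E); last exact: ltry.
apply: lime_le.
  by apply: is_cvg_nneseries => n _ _; exact: stay_ge0.
apply: nearW => n; apply: (occupation_le mX kX) => //.
- exact: measurable_norm_gt.
- exact: measurable_phi.
- by move=> y; exact: phi_ge0.
- by move=> y Xy /= ay; apply: h => //; rewrite (le_trans ra)// ltW.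
Qed.

End positive.

(** * Transience *)

Section onesided_numeric.
Context {R : realType}.
Implicit Types p b K C y z : R.

Lemma signed_le_norm (x sg : R) : sg = 1 \/ sg = -1 -> sg * x <= `|x|.
Proof.
by move=> [->|->]; [rewrite mul1r ler_norm|rewrite mulN1r -normrN ler_norm].
Qed.

Lemma onesided_neg_sum (p b s be w : R) : p < 0 -> 2^-1 <= s -> 0 < b -> `|be - b| <= b / 2 ->
  w <= - p * b / 4 -> p * (s * be) + w <= 0.
Proof.
move=> p0 s1 b0; rewrite ler_norml => /andP[hb _] hw.
have be0 : b / 2 <= be by lra.
have h1 : b / 4 <= s * be.
  apply: (@le_trans _ _ (2^-1 * (b / 2))); first by lra.
  by apply: ler_pM => //; lra.
have h2 : p * (s * be) <= p * (b / 4) by rewrite ler_wnM2l ?(ltW p0).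
by move: h2 hw; move: (p * (s * be)) => z; lra.
Qed.

Lemma onesided_pos_sum (p s be b c tl del K : R) : 0 < p -> 0 <= s -> s <= 1 ->
  `|be - b| <= 1 -> p * (`|b| + 1 + K) <= c / 8 -> 0 < c -> 4^-1 <= del -> c / 2 <= tl ->
  p * (s * be) + p * K - tl * del <= 0.
Proof.
move=> p0 s0 s1 hb hp c0 hd ht.
have hbe : be <= `|b| + 1.
  rewrite (le_trans (ler_norm _))// -[be](subrK b) (le_trans (ler_normD _ _))//.
  by rewrite addrC lerD2l.
have b1 : 0 <= `|b| + 1 by rewrite addr_ge0.
have h1 : s * be <= `|b| + 1.
  apply: (@le_trans _ _ (s * (`|b| + 1))); first by rewrite ler_wpM2l.
  by rewrite ler_piMl.
have h2 : p * (s * be) + p * K <= c / 8.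
  by apply: le_trans hp; rewrite -mulrDr ler_wpM2l ?(ltW p0)// lerD2r.
have h3 : c / 8 <= tl * del.
  apply: (@le_trans _ _ (c / 2 * 4^-1)); first by lra.
  by apply: ler_pM => //; lra.
by move: h2 h3; move: (p * _ + _) (tl * _) => x y; lra.
Qed.

End onesided_numeric.

Section onesided.
Context {R : realType} (X : set R) (k : R.-pker R ~> R)
  {d : measure_display} {T : measurableType d}
  (P : R -> probability T R) (xi : nat -> T -> R) (al c : R).
Hypothesis mc : markov_chain X k P xi.
Hypothesis hT : cond_Tbal X P xi al c.

Definition onesided_superharmonic p r1 := forall x sg, X x -> sg = 1 \/ sg = -1 ->
  r1 <= sg * x ->
  (kop k (EFin \o (fun z => phip p 1 (sg * z))) x <= (phip p 1 (sg * x))%:E)%E.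

Lemma onesided_superharmonic_neg gam b : 0 <= gam -> gam < al - 1 -> 0 < b ->
  drift_limit X P xi gam b -> exists p r1, [/\ p < 0, 1 <= r1 & onesided_superharmonic p r1].
Proof.
have [a1 a2 c0 _] := hT; have mt := measurable_theta mc.
move=> g0 ga b0 hb.
have ga0 : 0 < al - 1 - gam by rewrite subr_gt0.
(* The tail terms, of order r^(-al-p), must be negligible against the mean drift, of order
   r^(-1-gam): this asks for al - 1 - gam + p > 0, and half of the gap is taken. *)
pose p := - ((al - 1 - gam) / 2).
have p0 : p < 0 by rewrite oppr_lt0 divr_gt0.
have ph : `|p| <= 2^-1 by rewrite normrN gtr0_norm ?divr_gt0//; lra.
have p1 : `|p| <= 1 by apply: (le_trans ph); rewrite invf_le1// ler1n.
have q0 : 0 < al - 1 - gam + p by rewrite /p; lra.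
have pn : p != 0 by rewrite lt_eqF.
have [pm2 p2] := norm_half_bounds ph.
have [x0 [K hK]] := tails_uniform mc hT.
pose C1 := 28 * Cweight al 0 + 24.
have pb0 : 0 < - p * b / 4 by rewrite divr_gt0// mulr_gt0// oppr_gt0.
have [M1 [_ hM1]] := @powR_small R _ (2 * K * C1) _ q0 pb0.
have b20 : 0 < b / 2 by rewrite divr_gt0.
have [M2 [_ hM2]] := hb _ b20.
exists p, (Num.max 2 (Num.max x0 (Num.max M1 M2))); split => //.
  by rewrite le_max ler1n.
move=> x sg Xx sgP; rewrite !ge_max => /and4P[r2 rx0 rM1 rM2].
have r1 : 1 <= sg * x by apply: le_trans r2; rewrite ler1n.
have r0 : 0 < sg * x by apply: lt_le_trans r1.
have xx0 : x0 <= `|x|.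
  exact: le_trans (signed_le_norm x sgP).
have tK := hK x Xx xx0; have K0 := tails_le_ge0 tK.
have h0 : 0 < (sg * x)^-1 by rewrite invr_gt0.
have h1 : (sg * x)^-1 <= 1 by rewrite invf_le1.
have tu := tails_le_signed sgP r0 tK.
have [iu B] := drift_onesided_crude a1 a2 (measurable_signed sg (sg * x) mt) tu ph pn h0 h1.
rewrite (kop_phip mc Xx r0 iu) phipE// lee_fin ler_wpM2l ?powR_ge0//.
move: B; rewrite drift_signed//; last exact: (integrable_rv a1 mt tK).
rewrite (@drift_ratio R gam _ _ r0) => /(le_trans (ler_norm _)).
have /andP[s1 _] := half_psi1 pm2 p2 r2.
have hbe := hM2 x sg Xx sgP rM2; have hw := hM1 _ rM1.
have L := onesided_neg_sum p0 s1 b0 hbe hw.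
have rg := powR_ge0 (sg * x) (- (1 + gam)).
move: (mulr_ge0_le0 rg L); rewrite (powR_inv _ r0).
have W1 : 1 <= (sg * x) `^ (- p).
  by rewrite -[leLHS](powRr0 (sg * x)) ler_powR// oppr_ge0 ltW.
have C0 : 0 <= Cweight al 0 by exact: Cweight_ge0.
have e3 : 2 * (K * (sg * x) `^ (- al)) * (`|p| * 28 * Cweight al 0 + 8 * (2 + (sg * x) `^ (- p))) <=
    (sg * x) `^ (- (1 + gam)) * (2 * K * C1 * (sg * x) `^ (- (al - 1 - gam + p))).
  have e1 : (sg * x) `^ (- (1 + gam)) * (sg * x) `^ (- (al - 1 - gam + p)) =
      (sg * x) `^ (- al) * (sg * x) `^ (- p).
    rewrite -!powRD; [|by rewrite (gt_eqF r0) implybT|by rewrite (gt_eqF r0) implybT].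
    by congr (_ `^ _); ring.
  rewrite [leRHS]mulrCA e1.
  have -> : 2 * (K * (sg * x) `^ (- al)) = 2 * K * (sg * x) `^ (- al) by ring.
  have -> : 2 * K * C1 * ((sg * x) `^ (- al) * (sg * x) `^ (- p)) =
    2 * K * (sg * x) `^ (- al) * (C1 * (sg * x) `^ (- p)) by ring.
  rewrite ler_wpM2l ?mulr_ge0 ?powR_ge0//.
  rewrite /C1 [leRHS]mulrDl; apply: lerD.
    rewrite -mulrA; apply: (@le_trans _ _ (28 * Cweight al 0)).
      by rewrite ler_piMl ?mulr_ge0.
    by rewrite ler_peMr ?mulr_ge0.
  by move: W1; move: (_ `^ (- p)) => z; lra.
move: e3; move: (_ `^ gam * _) (Rintegral _ _ _) (phi p _ 1) (psi p _ 1).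
move: (2 * (_ * _) * _) (2 * K * C1 * _) ((sg * x) `^ (- (1 + gam))).
move=> w1 w2 y be I ph1 ps e3 Z le1.
rewrite -subr_le0; apply: le_trans Z; rewrite -subr_le0.
move: (le_trans le1 e3); rewrite -subr_le0; apply: le_trans.
by rewrite le_eqVlt; apply/orP; left; apply/eqP; ring.
Qed.

Lemma onesided_superharmonic_pos b : drift_limit X P xi (al - 1) b ->
  exists p r1, [/\ 0 < p, 1 <= r1 & onesided_superharmonic p r1].
Proof.
have [a1 a2 c0 _] := hT; have mt := measurable_theta mc.
move=> /(_ 1 ltr01)[M1 [_ hM1]].
have [x0 [K hK]] := tails_uniform mc hT.
have [x2 [x20 hU]] := Tbal_uniform hT.
have c20 : 0 < c / 2 by rewrite divr_gt0.
have [Y [Y0 hY]] := hU _ c20.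
have C0 : 0 <= Cweight al 0 by exact: Cweight_ge0.
pose K2 := 2 * `|K| * 28 * Cweight al 0.
have K20 : 0 <= K2 by rewrite !mulr_ge0.
have B0 : 0 < `|b| + 1 + K2 by rewrite ltr_wpDr// ltr_wpDl.
(* All contributions of order p then add up to at most c/8, which is the gain c/2 * 1/4 from jumps
   across the origin: a tail of at least c/2, after division by r^-al, times a fall of [phi] of at
   least 1/4. *)
pose p := Num.min 2^-1 (c / 8 / (`|b| + 1 + K2)).
have p0 : 0 < p by rewrite lt_min invr_gt0 ltr0n !divr_gt0.
have ph : p <= 2^-1 by rewrite ge_min lexx.
have [pm2 p2] : -2 <= p /\ p <= 2 by split; lra.
have hp : p * (`|b| + 1 + K2) <= c / 8 by rewrite -ler_pdivlMr// ge_min lexx orbT.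
have q40 : 0 < 4^-1 :> R by rewrite invr_gt0.
have [M2 [_ hM2]] := @powR_small R p 1 4^-1 p0 q40.
exists p, (Num.max 2 (Num.max x0 (Num.max M1 (Num.max M2 (Num.max x2 Y))))); split => //.
  by rewrite le_max ler1n.
move=> x sg Xx sgP; rewrite !ge_max => /and5P[r2 rx0 rM1 rM2 /andP[rx2 rY]].
have r1 : 1 <= sg * x by apply: le_trans r2; rewrite ler1n.
have r0 : 0 < sg * x by apply: lt_le_trans r1.
have xx := signed_le_norm x sgP.
have tK := hK x Xx (le_trans rx0 xx); have K0 := tails_le_ge0 tK.
have h0 : 0 < (sg * x)^-1 by rewrite invr_gt0.
have h1 : (sg * x)^-1 <= 1 by rewrite invf_le1.
have tu := tails_le_signed sgP r0 tK.
have ms := measurable_signed sg (sg * x) mt.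
have pn : p != 0 by rewrite gt_eqF.
have pha : `|p| <= 2^-1 by rewrite gtr0_norm.
have [iu _] := drift_onesided_crude a1 a2 ms tu pha pn h0 h1.
have B := drift_onesided_pos a1 a2 ms tu p0 ph h0 h1.
rewrite (kop_phip mc Xx r0 iu) phipE// lee_fin ler_wpM2l ?powR_ge0//.
move: B; rewrite drift_signed//; last exact: (integrable_rv a1 mt tK).
rewrite (@drift_ratio R (al - 1) _ _ r0).
have -> : 1 + (al - 1) = al by ring.
have /andP[s1 s2] := half_psi1 pm2 p2 r2.
have s0 : 0 <= psi p (sg * x)^-1 1 by apply: le_trans s1.
have hbe := hM1 x sg Xx sgP rM1.
have ra : 0 < (sg * x) `^ (- al) by rewrite powR_gt0.
have te : forall y, 1 * (sg * x) <= y -> `|y `^ al * tail (P x) (theta xi) y - c| <= c / 2 /\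
     `|y `^ al * tail (P x) (\- theta xi) y - c| <= c / 2.
  move=> y; rewrite mul1r => ry; apply: hY => //; first exact: le_trans ry.
  exact: le_trans xx.
have [_ ] := tails_err_signed sgP r0 ltr01 te (lexx 1).
have -> : 1 `^ (- al) = 1 :> R by rewrite powR1.
rewrite !mulr1; move: (tail _ _ 1) => tl htl.
have htl2 : c / 2 <= tl / (sg * x) `^ (- al).
  rewrite ler_pdivlMr//; move: htl; rewrite ler_norml => /andP[+ _].
  rewrite lerBrDr -mulNr -mulrDl; apply: le_trans; rewrite ler_wpM2r ?(ltW ra)//.
  by rewrite [X in _ <= _ + X]splitr addKr.
have hdel : 4^-1 <= phi p (sg * x)^-1 2^-1 - phi p (sg * x)^-1 0.
  have e0 : phi p (sg * x)^-1 0 <= 4^-1.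
    rewrite /phi expr0n/= addr0 powR_sqr gtr0_norm// powR_inv// -[leLHS]mul1r.
    exact: hM2.
  have e1 : 2^-1 <= phi p (sg * x)^-1 2^-1.
    apply: le_trans (phi_ge_powR (sg * x)^-1 2^-1 (ltW p0)).
    rewrite ger0_norm ?invr_ge0//; apply: (@le_trans _ _ (2^-1 `^ 1)).
      by rewrite powRr1 ?invr_ge0.
    by apply: ger_powR; [rewrite invr_gt0 ltr0n invf_le1 ?ler1n|lra].
  by move: e0 e1; move: (phi _ _ 0) (phi _ _ 2^-1) => *; lra.
have L := onesided_pos_sum p0 s0 s2 hbe hp c0 hdel htl2.
move: (mulr_ge0_le0 (ltW ra) L).
have KK : 2 * (K * (sg * x) `^ (- al) * (p * 28 * Cweight al 0)) <= (sg * x) `^ (- al) * (p * K2).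
  by rewrite /K2 (ger0_norm K0) le_eqVlt; apply/orP; left; apply/eqP; ring.
have et : tl = (sg * x) `^ (- al) * (tl / (sg * x) `^ (- al)).
  by rewrite mulrCA divff ?mulr1// gt_eqF.
rewrite {2}et; move: KK (tl / _) {htl htl2 L et} => KK t0.
move: KK; move: (_ `^ (al - 1) * _) (Rintegral _ _ _) (phi p _ 2^-1 - _) (phi p _ 1) (psi p _ 1).
move: (2 * (K * (sg * x) `^ (- al) * (p * 28 * Cweight al 0))) ((sg * x) `^ (- al)).
move=> w1 y be I del ph1 ps KK Z le1.
rewrite -subr_le0; apply: le_trans Z; rewrite -subr_le0.
move: (lerD le1 KK); rewrite -subr_le0; apply: le_trans.
by rewrite le_eqVlt; apply/orP; left; apply/eqP; ring.
Qed.

End onesided.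

(** * Capped superharmonic functions and confinement to one side *)

Section transience.
Context {R : realType} (X : set R) (k : R.-pker R ~> R)
  {d : measure_display} {T : measurableType d}
  (P : R -> probability T R) (xi : nat -> T -> R) (al c : R).
Hypothesis mc : markov_chain X k P xi.
Hypothesis hN : cond_N' X P xi.
Hypothesis hT : cond_Tbal X P xi al c.

Definition cap (f : R -> R) L z : R := Num.min 1 (f z / L).

Lemma cap_bounds (f : R -> R) L z : (forall y, 0 <= f y) -> 0 < L -> 0 <= cap f L z <= 1.
Proof.
by move=> f0 L0; rewrite /cap le_min ler01/= divr_ge0 ?(ltW L0)//= ge_min lexx.
Qed.

Lemma measurable_cap (f : R -> R) L : measurable_fun setT f -> measurable_fun setT (cap f L).
Proof.
by move=> mf; apply: measurable_minr => //; apply: measurable_funM.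
Qed.

(** Where f >= L the cap equals 1, its maximum, and its mean after one step cannot exceed it; so an
    inequality known on A only extends to all of X. *)
Lemma kop_cap (f : R -> R) L (A : set R) : measurable_fun setT f -> (forall y, 0 <= f y) ->
  0 < L -> (forall y, X y -> A y -> (kop k (EFin \o f) y <= (f y)%:E)%E) ->
  (forall y, ~ A y -> L <= f y) ->
  forall x, X x -> (kop k (EFin \o cap f L) x <= (cap f L x)%:E)%E.
Proof.
have [mX kX _ _] := mc; move=> mf f0 L0 hA hnA x Xx.
have mc1 : measurable_fun setT (cap f L) by exact: measurable_cap.
have c0 y : (0 <= (EFin \o cap f L) y)%E.
  by rewrite lee_fin; have /andP[] := cap_bounds y f0 L0.
have mEc : measurable_fun setT (EFin \o cap f L) by exact/measurable_EFinP.
have le1 : (kop k (EFin \o cap f L) x <= 1%:E)%E.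
  rewrite -(kop_cst k 1 x); apply: (le_kop mX kX Xx) => // y _.
  by rewrite lee_fin; have /andP[] := cap_bounds y f0 L0.
rewrite {2}/cap EFin_min le_min le1/=.
have [Ax|nA] := pselect (A x); last first.
  by apply: (le_trans le1); rewrite lee_fin ler_pdivlMr// mul1r hnA.
have fL0 y : 0 <= L^-1 * f y by rewrite mulr_ge0 ?invr_ge0 ?(ltW L0).
apply: (@le_trans _ _ (kop k (fun y => (L^-1)%:E * (EFin \o f) y)%E x)).
  apply: (le_kop mX kX Xx) => //.
  - by apply/measurable_EFinP; apply: measurable_funM.
  - by move=> y _; rewrite -EFinM lee_fin /cap ge_min [_^-1 * _]mulrC lexx orbT.
rewrite /kop ge0_integralZl//; [|exact/measurable_EFinP|by move=> y _; rewrite lee_fin|by rewrite lee_fin invr_ge0 ltW].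
by rewrite mulrC EFinM; apply: lee_wpmul2l; [rewrite lee_fin invr_ge0 ltW|exact: hA].
Qed.

Lemma phip_antitone p (a b : R) : p <= 0 -> a <= b -> phip p 1 b <= phip p 1 a.
Proof.
move=> p0 ab; rewrite /phip /phi.
have ab' : ppart a <= ppart b by rewrite /ppart ge_max !le_max ab lexx orbT.
apply: le_powR_nonpos; first by rewrite pmulr_lle0.
  by rewrite expr1n ltr_pwDl ?sqr_ge0.
by rewrite lerD2l ler_pXn2r ?nnegrE ?ppart_ge0.
Qed.

Lemma phip_gt0 p z : 0 < phip p 1 z :> R.
Proof. by rewrite /phip /phi powR_gt0// expr1n ltr_pwDl ?sqr_ge0. Qed.

Definition side sg (M : R) := [set z : R | M < sg * z].

Lemma measurable_side sg M : measurable (side sg M).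
Proof. by apply: measurable_set_ltr => //; exact: measurable_funM. Qed.

Lemma measurable_phip p sg : measurable_fun setT (fun z : R => phip p 1 (sg * z)).
Proof.
apply: measurableT_comp; last exact: measurable_funM.
by apply: continuous_measurable_fun; exact: continuous_phip.
Qed.

(** Neither one-sided function tends to 0 on both sides, but the minimum of their caps does, and a
    minimum of superharmonic functions is superharmonic. *)
Lemma eventually_side p r1 M x : p < 0 -> 1 <= r1 -> onesided_superharmonic X k p r1 ->
  r1 <= M -> X x ->
  {ae P x, forall w, (exists N, forall n, (N <= n)%N -> side 1 M (xi n w)) \/
                     (exists N, forall n, (N <= n)%N -> side (-1) M (xi n w))}.
Proof.
have [mX kX _ _] := mc; move=> p0 r11 hs rM Xx.
have M0 : 0 < M by rewrite (lt_le_trans _ rM)// (lt_le_trans _ r11).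
pose f sg (z : R) := phip p 1 (sg * z); pose L := phip p 1 M.
have L0 : 0 < L by exact: phip_gt0.
have f0 sg z : 0 <= f sg z by exact: phi_ge0.
have mf sg : measurable_fun setT (f sg) by exact: measurable_phip.
pose g z := Num.min (cap (f 1) L z) (cap (f (-1)) L z).
have g01 z : 0 <= g z <= 1.
  have /andP[h1 h2] := cap_bounds z (f0 1) L0; have /andP[h3 h4] := cap_bounds z (f0 (-1)) L0.
  by rewrite /g le_min h1 h3/= ge_min h2.
have mg : measurable_fun setT g by apply: measurable_minr; exact: measurable_cap.
have kc sg : sg = 1 \/ sg = -1 -> forall y, X y ->
    (kop k (EFin \o cap (f sg) L) y <= (cap (f sg) L y)%:E)%E.
  move=> sgP; apply: (@kop_cap _ _ (side sg M)) => // y.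
    by move=> Xy /= /ltW My; apply: hs => //; exact: le_trans My.
  by move=> /negP; rewrite -leNgt => My; apply: phip_antitone => //; exact: ltW.
have cA sg : forall y, ~ side sg M y -> 1 <= cap (f sg) L y.
  move=> y /negP; rewrite -leNgt => My; rewrite /cap le_min lexx/= ler_pdivlMr// mul1r.
  by apply: phip_antitone => //; exact: ltW.
have s1 : (1 : R) = 1 \/ (1 : R) = -1 by left.
have s2 : (-1 : R) = 1 \/ (-1 : R) = -1 by right.
have kg y : X y -> (kop k (EFin \o g) y <= (g y)%:E)%E.
  move=> Xy; rewrite {2}/g EFin_min le_min.
  have le sg : measurable_fun setT (cap (f sg) L) -> (forall z, g z <= cap (f sg) L z) ->
      (kop k (EFin \o cap (f sg) L) y <= (cap (f sg) L y)%:E)%E ->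
      (kop k (EFin \o g) y <= (cap (f sg) L y)%:E)%E.
    move=> mh hg; apply: le_trans; apply: (le_kop mX kX Xy).
    - by move=> z; rewrite lee_fin; have /andP[] := g01 z.
    - by move=> z; rewrite lee_fin; have /andP[] := cap_bounds z (f0 sg) L0.
    - exact/measurable_EFinP.
    - exact/measurable_EFinP.
    - by move=> z _; rewrite lee_fin.
  apply/andP; split; apply: le; do ?[exact: measurable_cap|exact: kc].
  - by move=> z; rewrite /g ge_min lexx.
  - by move=> z; rewrite /g ge_min lexx orbT.
have ginf e : 0 < e -> exists M' : R, forall y, X y -> M' <= `|y| -> g y <= e.
  move=> e0; have np : 0 < - p by rewrite oppr_gt0.
  have [M' [M'1 hM']] := @powR_small R (- p) L^-1 e np e0.
  exists M' => y Xy My; have [sg [sgP sy]] := sign_norm y.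
  have y0 : 0 < `|y| by rewrite (lt_le_trans _ My)// (lt_le_trans _ M'1).
  apply: (@le_trans _ _ (f sg y / L)).
    by case: sgP => ->; rewrite /g /cap !ge_min lexx !orbT.
  rewrite mulrC; apply: le_trans (hM' _ My); rewrite opprK ler_wpM2l ?invr_ge0 ?(ltW L0)//.
  rewrite /f sy /phip ppart_pos//.
  by have := @phi_le_powR R p 1 `|y| (ltW p0); rewrite normr_id; apply; rewrite gt_eqF.
apply: (eventually_in mc (measurable_side 1 M) (measurable_side (-1) M) _ mg) => //.
- rewrite -subset0 => z []; rewrite /side /= mul1r mulN1r => h1 h2.
  by have := lt_trans M0 h1; rewrite ltNge ltW// -oppr_gt0 (lt_trans M0).
- by move=> y; have /andP[] := g01 y.
(* The cap that realises the minimum bounds the probability of leaving its own side, and staying on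
   that side is one of the two alternatives. *)
- move=> n y Xy; rewrite {1}/g; case: (leP (cap (f 1) L y) (cap (f (-1)) L y)) => _.
    apply: le_trans (hit_le mX kX n Xy (measurable_side 1 M) (measurable_cap L (mf 1)) _ (kc 1 s1) (cA 1)) _.
      by move=> z; have /andP[] := cap_bounds z (f0 1) L0.
    by rewrite leeD2l// leeDl// stay_ge0.
  apply: le_trans (hit_le mX kX n Xy (measurable_side (-1) M) (measurable_cap L (mf (-1))) _ (kc (-1) s2) (cA (-1))) _.
    by move=> z; have /andP[] := cap_bounds z (f0 (-1)) L0.
  by rewrite leeD2l// leeDr// stay_ge0.
- move=> e e0; apply: (superharmonic_cvg0 mX kX _ Xx mg g01 kg ginf e0).
  by move=> D L' mD DL z Xz e' e'0; exact: (stay_bounded_cvg0 mc hN mD DL Xz e'0).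
Qed.

End transience.

(** * Directional and oscillatory transience *)

Section transience.
Context {R : realType} (X : set R) (k : R.-pker R ~> R)
  {d : measure_display} {T : measurableType d}
  (P : R -> probability T R) (xi : nat -> T -> R) (al c : R).
Hypothesis mc : markov_chain X k P xi.
Hypothesis hN : cond_N' X P xi.
Hypothesis hT : cond_Tbal X P xi al c.

Lemma nat_above (r M : R) : exists n : nat, M <= r + n%:R.
Proof.
exists (Num.truncn `|M - r|).+1; rewrite -lerBlDl.
by apply: (le_trans (ler_norm _)); apply: ltW; exact: truncnS_gt.
Qed.

Lemma directional_of gam b : 0 <= gam -> gam < al - 1 -> 0 < b ->
  drift_limit X P xi gam b -> directional_transient X P xi.
Proof.
move=> g0 ga b0 hb; have [p [r1 [p0 r11 hs]]] := onesided_superharmonic_neg mc hT g0 ga b0 hb.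
move=> x Xx.
have rn n : r1 <= r1 + n%:R by rewrite lerDl.
apply: filterS (ae_foralln (fun n => eventually_side mc hN p0 r11 hs (rn n) Xx)) => w h.
have r0 : 0 <= r1 by rewrite (le_trans _ r11).
have excl n m : (exists N, forall i, (N <= i)%N -> side 1 (r1 + n%:R) (xi i w)) ->
    (exists N, forall i, (N <= i)%N -> side (-1) (r1 + m%:R) (xi i w)) -> False.
  move=> [N1 h1] [N2 h2]; have := h1 (maxn N1 N2) (leq_maxl _ _).
  have := h2 (maxn N1 N2) (leq_maxr _ _); rewrite /side /= mul1r mulN1r => h3 h4.
  have : 0 < xi (maxn N1 N2) w by apply: le_lt_trans h4; rewrite addr_ge0.
  by rewrite ltNge ltW// -oppr_gt0; apply: le_lt_trans h3; rewrite addr_ge0.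
have [h0|h0] := h 0%N; [left|right] => M.
  have [n Mn] := nat_above r1 M; have [[N hn]|hn] := h n; last by have := excl _ _ h0 hn.
  by exists N => i /hn; rewrite /side /= mul1r; exact: le_lt_trans.
have [n Mn] := nat_above r1 (- M); have [hn|[N hn]] := h n; first by have := excl _ _ hn h0.
exists N => i /hn; rewrite /side /= mulN1r => hi.
by rewrite -ltrN2; exact: le_lt_trans hi.
Qed.

Lemma phi_phip p (z : R) : phi p 1 z = phip p 1 `|z|.
Proof.
rewrite /phip ppart_pos//; have [z0|z0] := leP 0 z; first by rewrite ger0_norm.
by rewrite ltr0_norm// phiN.
Qed.

(** The scheme of [eventually_side] for the two-sided function, with the empty set as second
    alternative of [eventually_in]. *)
Lemma eventually_large p r1 M x : p < 0 -> 1 <= r1 ->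
  (forall y, X y -> r1 <= `|y| -> (kop k (EFin \o phi p 1) y <= (phi p 1 y)%:E)%E) ->
  r1 <= M -> X x ->
  {ae P x, forall w, exists N, forall n, (N <= n)%N -> M < `|xi n w|}.
Proof.
have [mX kX _ _] := mc; move=> p0 r11 hs rM Xx.
have M0 : 0 < M by rewrite (lt_le_trans _ rM)// (lt_le_trans _ r11).
pose L := phip p 1 M; have L0 : 0 < L by exact: phip_gt0.
have f0 z : 0 <= phi p 1 z :> R by exact: phi_ge0.
have mf := measurable_phi p; have mA := measurable_norm_gt M.
pose g := cap (phi p 1) L.
have mg : measurable_fun setT g by exact: measurable_cap.
have g01 z : 0 <= g z <= 1 by exact: cap_bounds.
have hL z : ~ (M < `|z|) -> L <= phi p 1 z.
  by move=> /negP; rewrite -leNgt => zM; rewrite phi_phip phip_antitone// ltW.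
have kg : forall y, X y -> (kop k (EFin \o g) y <= (g y)%:E)%E.
  apply: (@kop_cap _ _ _ _ _ _ _ mc _ _ [set z | M < `|z|]) => // y Xy /= /ltW My.
  by apply: hs => //; exact: le_trans My.
have gA z : ~ (M < `|z|) -> 1 <= g z.
  by move=> /hL hz; rewrite /g /cap le_min lexx/= ler_pdivlMr// mul1r.
have ginf e : 0 < e -> exists M' : R, forall y, X y -> M' <= `|y| -> g y <= e.
  move=> e0; have np : 0 < - p by rewrite oppr_gt0.
  have [M' [M'1 hM']] := @powR_small R (- p) L^-1 e np e0.
  exists M' => y Xy My.
  have y0 : 0 < `|y| by rewrite (lt_le_trans _ My)// (lt_le_trans _ M'1).
  apply: (@le_trans _ _ (phi p 1 y / L)); first by rewrite /g /cap ge_min lexx orbT.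
  rewrite mulrC; apply: le_trans (hM' _ My); rewrite opprK ler_wpM2l ?invr_ge0 ?(ltW L0)//.
  by apply: phi_le_powR; [exact: ltW|rewrite -normr_gt0].
have : {ae P x, forall w, (exists N, forall n, (N <= n)%N -> [set z | M < `|z|] (xi n w)) \/
    (exists N, forall n, (N <= n)%N -> set0 (xi n w))}.
  apply: (eventually_in mc mA measurable0 _ mg) => //.
  - by rewrite setI0.
  - by move=> y; have /andP[] := g01 y.
  - move=> n y Xy; apply: le_trans (hit_le mX kX n Xy mA mg _ kg gA) _.
      by move=> z; have /andP[] := g01 z.
    by rewrite leeD2l// leeDl// stay_ge0.
  - move=> e e0; apply: (superharmonic_cvg0 mX kX _ Xx mg g01 kg ginf e0).
    by move=> D L' mD DL z Xz e' e'0; exact: (stay_bounded_cvg0 mc hN mD DL Xz e'0).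
by apply: filterS => w [//|[N /(_ N (leqnn N))]].
Qed.

(** [stay_cvg0] asks for bounded level sets only within the set to be left; on the half-line
    considered the one-sided function coincides with [phi], which grows. *)
Lemma exits_side b : drift_limit X P xi (al - 1) b -> exists r1, forall x sg, X x ->
  sg = 1 \/ sg = -1 ->
  {ae P x, forall w, forall N, exists2 n, (N <= n)%N & sg * xi n w <= r1}.
Proof.
have [mX kX _ _] := mc; move=> hb.
have [p [r1 [p0 r11 hs]]] := onesided_superharmonic_pos mc hT hb.
exists r1 => x sg Xx sgP.
have st y : X y -> forall e : R, 0 < e -> exists N, forall n, (N <= n)%N ->
    (stay k (side sg r1) n y <= e%:E)%E.
  move=> Xy e e0; apply: (stay_cvg0 mX kX _ (measurable_side sg r1) (measurable_phip p sg)) => //.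
  - by move=> D L mD DL z Xz e' e'0; exact: (stay_bounded_cvg0 mc hN mD DL Xz e'0).
  - by move=> z; exact: phi_ge0.
  - by move=> z Xz /= /ltW; exact: hs.
  - move=> M; have [L hL] := phi_level_bounded M p0; exists L => z rz.
    rewrite /phip ppart_pos; last by rewrite (le_trans _ (ltW rz))// (le_trans _ r11).
    by rewrite phi_signed//; exact: hL.
apply: filterS (exits_io mc (measurable_side sg r1) Xx st) => w hw N.
by have [n Nn /negP] := hw N; rewrite -leNgt => hn; exists n.
Qed.

Lemma oscillatory_of b : cond_Tbal_strong X P xi al c -> drift_limit X P xi (al - 1) b ->
  0 < b + c * cotpi (al / 2) -> oscillatory_transient X P xi.
Proof.
move=> hS hb B0 x Xx.
have [p1 [p10 p12 h]] := phi_superharmonic mc hT hb (lt0r_neq0 B0).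
have [del [del0 hdel]] := tail_error_neg hS.
(* The exponent -q must be small enough for the sign of the bracket and stay above - del for the
   control of the tails. *)
pose q := Num.min p1 (del / 2).
have q0 : 0 < q by rewrite lt_min p10 divr_gt0.
have p0 : - q < 0 by rewrite oppr_lt0.
have qd : - del < - q.
  have q2 : q <= del / 2 by rewrite ge_min lexx orbT.
  by rewrite ltrN2 (le_lt_trans q2)// gtr_pMr// invf_lt1// ltr1n.
have [] := h (- q) (ltr0_neq0 p0) _ _ (hdel _ p0 qd).
- by rewrite normrN gtr0_norm// ge_min lexx.
- by rewrite nmulr_rlt0.
move=> r1 [r11 hr].
have rn n : r1 <= r1 + n%:R by rewrite lerDl.
have L := ae_foralln (fun n => eventually_large p0 r11 hr (rn n) Xx).
have [r2 hr2] := exits_side hb.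
have s1 : (1 : R) = 1 \/ (1 : R) = -1 by left.
have s2 : (-1 : R) = 1 \/ (-1 : R) = -1 by right.
have E1 := hr2 x 1 Xx s1; have E2 := hr2 x (-1) Xx s2.
apply: filterS3 L E1 E2 => w hL h1 h2.
have big M : exists N, forall n, (N <= n)%N -> M < `|xi n w|.
  have [n Mn] := nat_above r1 M; have [N hn] := hL n.
  by exists N => i /hn; exact: le_lt_trans.
have cross sg M N : sg = 1 \/ sg = -1 ->
    (forall N, exists2 n, (N <= n)%N & sg * xi n w <= r2) ->
    exists2 n, (N <= n)%N & sg * xi n w < M.
  (* Once |xi_n| > r2, a visit with sg * xi_n <= r2 must have sg * xi_n negative, and |xi_n| > - M
     then puts it below M. *)
  move=> sgP hsg; have [N' hN'] := big (Num.max r2 (- M)).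
  have [n] := hsg (maxn N N'); rewrite geq_max => /andP[Nn N'n] hn; exists n => //.
  move: (hN' n N'n); rewrite gt_max => /andP[a1 a2].
  have e : `|xi n w| = `|sg * xi n w|.
    by case: sgP => ->; rewrite ?mul1r// mulN1r normrN.
  move: a1 a2; rewrite e; have [y0|y0] := leP 0 (sg * xi n w).
    by rewrite ger0_norm// => /lt_le_trans /(_ hn); rewrite ltxx.
  by rewrite ltr0_norm// ltrN2.
split => [//|M N|M N].
  by have [n Nn hn] := cross 1 M N s1 h1; exists n => //; move: hn; rewrite mul1r.
have [n Nn hn] := cross (-1) (- M) N s2 h2; exists n => //.
by move: hn; rewrite mulN1r ltrN2.
Qed.

End transience.

Theorem theorem2p7 (R : realType) (X : set R)
  (k : R.-pker R ~> R) (d : measure_display) (T : measurableType d)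
  (P : R -> probability T R) (xi : nat -> T -> R) (alpha c gamma b : R) :
  ~ finite_set X ->
  ~ (exists M : R, forall x, X x -> `|x| <= M) ->
  markov_chain X k P xi ->
  cond_N' X P xi ->
  cond_Tbal X P xi alpha c ->
  cond_D' X P xi gamma b ->
  [/\ (alpha - 1 < gamma -> null_recurrent X P xi),
      (gamma < alpha - 1 -> b < 0 -> positive_recurrent X P xi),
      (gamma < alpha - 1 -> 0 < b -> directional_transient X P xi),
      (gamma = alpha - 1 ->
         b + c * pi * (cos (pi * alpha / 2) / sin (pi * alpha / 2)) < 0 ->
         null_recurrent X P xi) &
      (cond_Tbal_strong X P xi alpha c ->
       gamma = alpha - 1 ->
         b + c * pi * (cos (pi * alpha / 2) / sin (pi * alpha / 2)) > 0 ->
         oscillatory_transient X P xi)].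
Proof.
move=> _ _ mc hN hT hD; have hb := cond_D'_limit hD.
have [g0 _] := hD; have [a1 a2 c0 _] := hT.
have ecot : c * pi * (cos (pi * alpha / 2) / sin (pi * alpha / 2)) = c * cotpi (alpha / 2).
  by rewrite /cotpi !mulrA.
rewrite !ecot; split.
- move=> ga; have h0 := drift_limit_faster ga hb; split; last exact (null_of mc hT h0).
  apply: (recurrent_of mc hN hT h0).
  by rewrite add0r pmulr_rlt0// cotpi_lt0.
- by move=> ga b0; exact (positive_of mc hT g0 ga b0 hb).
- by move=> ga b0; exact (directional_of mc hN hT g0 ga b0 hb).
- move=> ga B0; rewrite ga in hb.
  by split; [exact (recurrent_of mc hN hT hb B0)|exact (null_of mc hT hb)].
- by move=> hS ga B0; rewrite ga in hb; exact (oscillatory_of mc hN hT hS hb B0).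
Qed.
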